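(* Let $d,k\ge 2$ be integers. Any proper closed cocompact subgroup $H$ of $G=\mathcal N_{d,k}$ fixes a point $\xi\in\partial\mathcal T_{d,k}$. Moreover $H$ is a finite index subgroup of the stabilizer $G_\xi$. In particular, the only closed cocompact unimodular subgroup of $G$ is $G$ itself.
   Context: Neretin groups. Let $d,k\ge 2$ be integers and let $\mathcal T_{d,k}$ be the rooted tree in which the root has $k$ descendants and every other vertex has $d$ descendants. An almost automorphism of $\mathcal T_{d,k}$ is a triple $(A,B,\varphi)$ where $A,B$ are finite subtrees of $\mathcal T_{d,k}$ containing the root with $|\partial A|=|\partial B|$ (here $\partial A$ may be taken to be the set of vertices outside $A$ adjacent to $A$, i.e. the complements $\mathcal T_{d,k}\setminus A$ and $\mathcal T_{d,k}\setminus B$ have the same number of connected components) and $\varphi:\mathcal T_{d,k}\setminus A\to\mathcal T_{d,k}\setminus B$ is an isomorphism of forests. Two triples $(A,B,\varphi)$, $(A',B',\varphi')$ are identified if there is a finite subtree $A''\supseteq A\cup A'$ such that $\varphi$ and $\varphi'$ coincide on $\mathcal T_{d,k}\setminus A''$. The set of equivalence classes is a group $\mathcal N_{d,k}$ under composition, the Neretin group; it acts faithfully by homeomorphisms on the space of ends $\partial\mathcal T_{d,k}$. It carries a unique locally compact group topology for which the inclusion of the profinite group $\mathrm{Aut}(\mathcal T_{d,k})$ (automorphisms of the rooted tree) is continuous and open; it is always endowed with this topology. A closed subgroup $H\le G$ is cocompact if $G/H$ is compact. *)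

(* Defs.v *)
From HB Require Import structures.
From mathcomp Require Import all_boot all_order all_algebra.
From mathcomp Require Import all_classical all_reals.
From mathcomp Require Import topology ereal measure.

Set Implicit Arguments.
Unset Strict Implicit.
Unset Printing Implicit Defensive.

Local Open Scope classical_set_scope.
Local Open Scope card_scope.
Local Open Scope ring_scope.
Local Open Scope group_scope.

HB.mixin Record isTopologicalGroup G of Topological G & Group G := {
  mulg_continuous : continuous (fun xy : G * G => xy.1 * xy.2) ;
  invg_continuous : continuous (fun x : G => x^-1)
}.

#[short(type="topologicalGroupType")]
HB.structure Definition TopologicalGroup :=
  {G of PointedTopological G & Group G & isTopologicalGroup G}.

Section Subgroup.
Context (G : topologicalGroupType) (H : groupClosed G).

(* H as a topological group in its own right, with the topology induced by G *)
Record subgroup := Subgroup { sgval : G ; _ : sgval \in (H : {pred G}) }.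

HB.instance Definition _ := [isSub for sgval].
HB.instance Definition _ := [Choice of subgroup by <:].

Let subgroup_closed : group_closed (H : {pred G}).
Proof. by split; [exact: gpred1 | exact: gpredF]. Qed.

HB.instance Definition _ :=
  SubChoice_isSubGroup.Build G (fun x => x \in (H : {pred G})) subgroup
    subgroup_closed.
HB.instance Definition _ := isPointed.Build subgroup 1.
HB.instance Definition _ :=
  Topological.copy subgroup (initial_topology sgval).

Let sgval_continuous : continuous sgval.
Proof. exact: (@initial_continuous subgroup G sgval). Qed.

Let subgroup_mulg_continuous :
  continuous (fun xy : subgroup * subgroup => xy.1 * xy.2).
Proof.
apply: (@continuous_comp_initial subgroup _ G sgval) => -[x y].
apply: (@continuous_comp _ _ _ (fun z => (sgval z.1, sgval z.2))
  (fun xy : G * G => xy.1 * xy.2)); last exact: mulg_continuous.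
apply: cvg_pair.
  apply: (@continuous_comp _ _ _ fst sgval); first exact: cvg_fst.
  exact: sgval_continuous.
apply: (@continuous_comp _ _ _ snd sgval); first exact: cvg_snd.
exact: sgval_continuous.
Qed.

Let subgroup_invg_continuous : continuous (fun x : subgroup => x^-1).
Proof.
apply: (@continuous_comp_initial subgroup _ G sgval) => x.
have -> : sgval \o (fun x : subgroup => x^-1) = (fun x => x^-1) \o sgval.
  by apply/funext => y /=; exact: (gmulfV (val : subgroup -> G)).
apply: continuous_comp; first exact: sgval_continuous.
exact: invg_continuous.
Qed.

HB.instance Definition _ := isTopologicalGroup.Build subgroup
  subgroup_mulg_continuous subgroup_invg_continuous.

Definition left_coset_rel : rel G := fun x y => x^-1 * y \in (H : {pred G}).

Let left_coset_refl : reflexive left_coset_rel.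
Proof. by move=> x; rewrite /left_coset_rel mulVg gpred1. Qed.

Let left_coset_sym : symmetric left_coset_rel.
Proof. by move=> x y; rewrite /left_coset_rel -gpredV invgM invgK. Qed.

Let left_coset_trans : transitive left_coset_rel.
Proof.
move=> y x z xy yz; rewrite /left_coset_rel.
have -> : x^-1 * z = (x^-1 * y) * (y^-1 * z) by rewrite mulgA mulgK.
exact: gpredM.
Qed.

Canonical left_coset_equiv :=
  EquivRel left_coset_rel left_coset_refl left_coset_sym left_coset_trans.

Definition left_cosets := quotient_topology {eq_quot left_coset_rel}%qT.

(* compactness of G / H in the quotient topology; it is only used for closed H,
   for which G / H is Hausdorff *)
Definition cocompact := compact [set: left_cosets].

(* the left cosets g H with g in K are finitely many; meant for H contained in
   the subgroup K *)
Definition finite_index (K : set G) :=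
  finite_set [set (fun h => g * h) @` [set` H] | g in K].

End Subgroup.

Section Haar.
Context (R : realType) (G : topologicalGroupType).

Definition borel : Type := g_sigma_algebraType (@open G).
HB.instance Definition _ := Measurable.on borel.

Definition left_invariant (mu : set G -> \bar R) :=
  forall (g : G) (B : set G), (@measurable _ borel) B ->
    mu ((fun x => g * x) @` B) = mu B.

Definition right_invariant (mu : set G -> \bar R) :=
  forall (g : G) (B : set G), (@measurable _ borel) B ->
    mu ((fun x => x * g) @` B) = mu B.

(* Regular Borel measures on a Hausdorff G. Compact sets are then closed, hence
   Borel. *)
Definition radon (mu : set G -> \bar R) :=
  [/\ forall K : set G, compact K -> (mu K < +oo)%E,
      forall B : set G, (@measurable _ borel) B ->
        mu B = ereal_inf [set mu U | U in [set U : set G | open U /\ B `<=` U]] &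
      forall U : set G, open U ->
        mu U = ereal_sup
          [set mu K | K in [set K : set G | compact K /\ K `<=` U]]].

Definition left_haar (mu : {measure set borel -> \bar R}) :=
  [/\ mu setT <> 0%E, radon mu & left_invariant mu].

(* A left Haar measure exists and is unique up to a positive factor, so asking for
   one left Haar measure to be right invariant is asking it for all of them; the
   existential form does not rely on the existence theorem. *)
Definition unimodular :=
  exists2 mu : {measure set borel -> \bar R},
    left_haar mu & right_invariant mu.

End Haar.
Section Neretin.
Variables d k : nat.

(* The vertices of T_{d,k} are the words whose first letter is < k and whose other
   letters are < d: the word rcons u x is the x-th descendant of u. *)
Definition is_vertex (s : seq nat) : bool :=
  if s is x :: s' then (x < k)%N && all (fun y => y < d)%N s' else true.

Record vertex := Vertex { word :> seq nat ; wordP : is_vertex word }.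

HB.instance Definition _ := [isSub for word].
HB.instance Definition _ := [Countable of vertex by <:].

Definition root : vertex := @Vertex [::] isT.

HB.instance Definition _ := isPointed.Build vertex root.

Definition child (u v : vertex) : bool :=
  (size v == (size u).+1) && prefix u v.

Definition adj (u v : vertex) : bool := child u v || child v u.

Implicit Types (u v w : vertex) (A B C : set vertex) (phi : vertex -> vertex).

(* A set of vertices containing the root spans a (connected) subtree iff it
   contains the parent of each of its vertices. *)
Definition finite_subtree A :=
  [/\ finite_set A, A root & forall u v, child u v -> A v -> A u].

Definition boundary A : set vertex :=
  [set v | ~ A v /\ exists2 u, A u & adj u v].

(* A graph isomorphism between the forests T \ A and T \ B. The values of phi on A
   are irrelevant; eq_germ below ignores them. *)
Definition forest_iso A B phi :=
  set_bij (~` A) (~` B) phi /\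
  forall u v, ~ A u -> ~ A v -> adj (phi u) (phi v) = adj u v.

Record almost_aut := AlmostAut {
  src : set vertex ;
  tgt : set vertex ;
  amap :> vertex -> vertex ;
  src_subtree : finite_subtree src ;
  tgt_subtree : finite_subtree tgt ;
  card_boundary : boundary src #= boundary tgt ;
  amap_iso : forest_iso src tgt amap }.

HB.instance Definition _ := gen_eqMixin almost_aut.
HB.instance Definition _ := gen_choiceMixin almost_aut.

Lemma childP u v : reflect (exists x, word v = rcons u x) (child u v).
Proof.
apply: (iffP andP) => [[/eqP sv /prefixP[s vE]]|[x ->]]; last first.
  by rewrite size_rcons eqxx prefix_rcons.
move: sv; rewrite vE size_cat -addn1 => /addnI.
case: s vE => [|x [|//]] // vE _; exists x; by rewrite cats1.
Qed.

Lemma is_vertex_rcons s x : is_vertex (rcons s x) =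
  is_vertex s && (x < if s is [::] then k else d)%N.
Proof. by case: s => [|y s] /=; rewrite ?andbT// all_rcons andbAC -andbA. Qed.

Lemma adjC u v : adj u v = adj v u. Proof. by rewrite /adj orbC. Qed.

Lemma size_child u v : child u v -> size v = (size u).+1.
Proof. by case/andP => /eqP. Qed.

Lemma parent_uniq u u' v : child u v -> child u' v -> u = u'.
Proof.
move=> /childP[x e] /childP[y]; rewrite e => /eqP; rewrite eqseq_rcons.
by case/andP => /eqP uu' _; apply/val_inj.
Qed.

Lemma has_parent v : v <> root -> exists u, child u v.
Proof.
case: v => s; case/lastP: s => [|s x] vs; first by case; exact/val_inj.
move=> _; have sP : is_vertex s by move: vs; rewrite is_vertex_rcons => /andP[].
by exists (Vertex sP); apply/childP; exists x.
Qed.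

Lemma child_root u v : child u v -> v <> root.
Proof. by move=> /size_child + vr; rewrite vr. Qed.

Lemma nth_child_subproof v (i : 'I_d) : v <> root -> is_vertex (rcons v i).
Proof.
case: v => s vs vr; rewrite is_vertex_rcons /= vs /=.
case: s vs vr => [|x s] vs vr; last exact: ltn_ord.
by case: vr; exact/val_inj.
Qed.

Definition nth_child v (vr : v <> root) (i : 'I_d) :=
  Vertex (nth_child_subproof i vr).

Lemma nth_childP v (vr : v <> root) i : child v (nth_child vr i).
Proof. by apply/childP; exists i. Qed.

Lemma nth_child_inj v (vr : v <> root) : injective (nth_child vr).
Proof.
by move=> i j /(congr1 word)/= /rcons_inj[] /val_inj.
Qed.

Lemma child_nth v w (vr : v <> root) : child v w -> exists i, w = nth_child vr i.
Proof.
move=> /childP[x wE]; have := wordP w; rewrite wE is_vertex_rcons.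
case/andP => _; case E : (word v) => [|y s] xd.
  by case: vr; exact/val_inj.
by exists (Ordinal xd); apply/val_inj.
Qed.

Lemma subtree_child A u v : finite_subtree A -> child u v -> ~ A u -> ~ A v.
Proof. by move=> [_ _ cA] uv Au /(cA _ _ uv). Qed.

Lemma boundaryP A v : finite_subtree A ->
  boundary A v <-> ~ A v /\ exists2 u, A u & child u v.
Proof.
move=> sA; split=> -[Av [u Au]]; last first.
  by move=> uv; split => //; exists u => //; rewrite /adj uv.
case/orP => uv; first by split => //; exists u.
by case: Av; case: sA => _ _; apply; eauto.
Qed.

Lemma subtreeU A B : finite_subtree A -> finite_subtree B ->
  finite_subtree (A `|` B).
Proof.
move=> [fA rA cA] [fB rB cB]; split; first by rewrite finite_setU.
  by left.
by move=> u v uv [/(cA _ _ uv)|/(cB _ _ uv)]; [left|right].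
Qed.

Lemma subtree_root : finite_subtree [set root].
Proof. by split => // u v uv /= vr; case: (child_root uv). Qed.

Definition forest_inv A phi w := xget root [set v | ~ A v /\ phi v = w].

Section ForestIso.
Variables (A B : set vertex) (phi : vertex -> vertex).
Hypothesis iphi : forest_iso A B phi.
Local Notation psi := (forest_inv A phi).

Lemma iso_notin v : ~ A v -> ~ B (phi v).
Proof. by case: iphi => -[h _ _] _; exact: h. Qed.

Lemma iso_inj u v : ~ A u -> ~ A v -> phi u = phi v -> u = v.
Proof. by case: iphi => -[_ h _] _ Au Av; apply: h; rewrite inE. Qed.

Lemma iso_invP w : ~ B w -> ~ A (psi w) /\ phi (psi w) = w.
Proof.
case: iphi => -[_ _ h] _ /h[v Av vw].
by apply: (@xgetPex _ root [set v | ~ A v /\ phi v = w]); exists v.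
Qed.

Lemma iso_invK v : ~ A v -> psi (phi v) = v.
Proof.
move=> Av; have [h1 h2] := iso_invP (iso_notin Av).
exact: iso_inj.
Qed.

Lemma iso_adj u v : ~ A u -> ~ A v -> adj (phi u) (phi v) = adj u v.
Proof. by case: iphi => _; exact. Qed.

Lemma forest_iso_inv : forest_iso B A psi.
Proof.
split; [split|].
- by move=> w /iso_invP[].
- move=> w w'; rewrite !inE => /iso_invP[_ {2}<-] /iso_invP[_ {2}<-].
  by move=> ->.
- by move=> v Av; exists (phi v); [exact: iso_notin|exact: iso_invK].
- move=> w w' /iso_invP[a b] /iso_invP[a' b'].
  by rewrite -{2}b -{2}b' iso_adj.
Qed.

End ForestIso.

Lemma iso_boundary1 A B phi v : finite_subtree A -> finite_subtree B ->
  forest_iso A B phi -> boundary A v -> boundary B (phi v).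
Proof.
move=> sA sB iphi bv; have Av := bv.1; have Bw := iso_notin iphi Av.
set w := phi v in Bw *.
have notroot C x : finite_subtree C -> ~ C x -> x <> root.
  by move=> [_ rC _] Cx xr; apply: Cx; rewrite xr.
have wr := notroot _ _ sB Bw; have vr := notroot _ _ sA Av.
have [p pw] := has_parent wr.
have [Bp|Bp] := pselect (B p); first by apply/boundaryP => //; split=> //; exists p.
exfalso.
pose f (o : option 'I_d) := if o is Some i then nth_child wr i else p.
have f_inj : injective f.
  move=> [i|] [j|] //=; first by move=> /nth_child_inj ->.
    move=> e; have := size_child pw; rewrite -e (size_child (nth_childP wr i)).
    by move=> /eqP; rewrite -addn2 -[X in X == _]addn0 eqn_add2l.
  move=> e; have := size_child pw; rewrite e (size_child (nth_childP wr j)).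
  by move=> /eqP; rewrite -addn2 -[X in X == _]addn0 eqn_add2l.
have fB o : ~ B (f o).
  by case: o => [i|//]; apply: subtree_child sB (nth_childP wr i) Bw.
have fadj o : adj w (f o).
  by case: o => [i|] /=; rewrite /adj ?nth_childP// pw orbT.
pose g o := forest_inv A phi (f o).
have gA o : ~ A (g o) by have [] := iso_invP iphi (fB o).
have gc o : child v (g o).
  have : adj v (g o).
    by rewrite -(iso_adj iphi Av (gA o)) (iso_invP iphi (fB o)).2.
  case/orP => // gv; have [_ [u Au uv]] := (boundaryP _ sA).1 bv.
  by case: (gA o); rewrite (parent_uniq gv uv).
have g_inj : injective g.
  move=> o o' e; apply: f_inj.
  by rewrite -(iso_invP iphi (fB o)).2 -(iso_invP iphi (fB o')).2 -/(g _) e.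
pose h o := projT1 (cid (child_nth vr (gc o))).
have hE o : g o = nth_child vr (h o) by exact: projT2 (cid (child_nth vr (gc o))).
have : injective h by move=> o o' e; apply: g_inj; rewrite !hE e.
by move=> /leq_card; rewrite card_option card_ord ltnn.
Qed.

Lemma iso_boundary A B phi v : finite_subtree A -> finite_subtree B ->
  forest_iso A B phi -> ~ A v -> boundary B (phi v) <-> boundary A v.
Proof.
move=> sA sB iphi Av; split; last exact: iso_boundary1.
move=> /(iso_boundary1 sB sA (forest_iso_inv iphi)).
by rewrite (iso_invK iphi).
Qed.

Lemma iso_card_boundary A B phi : finite_subtree A -> finite_subtree B ->
  forest_iso A B phi -> boundary A #= boundary B.
Proof.
move=> sA sB iphi; apply/card_set_bijP; exists phi; split.
- by move=> v; exact: iso_boundary1.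
- by move=> u v; rewrite !inE => -[Au _] [Av _]; exact: (iso_inj iphi).
- move=> w bw; have [a b] := iso_invP iphi bw.1.
  by exists (forest_inv A phi w) => //; apply/(iso_boundary sA sB iphi); rewrite ?b.
Qed.

Lemma iso_child A B phi u v : finite_subtree A -> finite_subtree B ->
  forest_iso A B phi -> ~ A u -> child u v -> child (phi u) (phi v).
Proof.
move=> sA sB iphi.
have [n] := ubnP (size u); elim: n u v => // n IH u v /ltnSE un Au uv.
have Av := subtree_child sA uv Au.
have : adj (phi u) (phi v) by rewrite (iso_adj iphi)// /adj uv.
case/orP => // vu'; exfalso.
have ur : u <> root by move=> e; apply: Au; rewrite e; case: sA.
have [p pu] := has_parent ur.
have [Ap|Ap] := pselect (A p).
  have : boundary A u by apply/boundaryP => //; split=> //; exists p.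
  move=> /(iso_boundary1 sA sB iphi) /(boundaryP _ sB)[_ [q Bq qu]].
  by apply: (iso_notin iphi Av); rewrite (parent_uniq vu' qu).
have pu' : child (phi p) (phi u).
  by apply: IH => //; rewrite -(size_child pu).
have e := iso_inj iphi Ap Av (parent_uniq pu' vu').
have := size_child uv; rewrite -e (size_child pu) => /eqP.
by rewrite -addn2 -[X in X == _]addn0 eqn_add2l.
Qed.

Lemma iso_childE A B phi u v : finite_subtree A -> finite_subtree B ->
  forest_iso A B phi -> ~ A u -> ~ A v -> child (phi u) (phi v) = child u v.
Proof.
move=> sA sB iphi Au Av; apply/idP/idP; last exact: (iso_child sA sB iphi).
move=> c; have := iso_child sB sA (forest_iso_inv iphi) (iso_notin iphi Au) c.
by rewrite !(iso_invK iphi).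
Qed.

(* T \ comp_set A phi C is the preimage of T \ C under phi : T \ A -> T *)
Definition comp_set A phi C : set vertex := [set v | ~ A v -> C (phi v)].

Lemma comp_setC A phi C v : ~ comp_set A phi C v <-> ~ A v /\ ~ C (phi v).
Proof. by rewrite /comp_set /= not_implyE. Qed.

Lemma comp_subtree A B phi C : finite_subtree A -> finite_subtree B ->
  forest_iso A B phi -> finite_subtree C -> finite_subtree (comp_set A phi C).
Proof.
move=> sA sB iphi sC; split.
- apply: (@sub_finite_set _ _ (A `|` forest_inv A phi @` C)).
    move=> v; have [Av|Av] := pselect (A v); first by left.
    by move=> /(_ Av) Cv; right; exists (phi v) => //; exact: (iso_invK iphi).
  rewrite finite_setU; split; first by case: sA.
  by apply: finite_image; case: sC.
- by case: sA => _ rA _ /(_ rA).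
- move=> u v uv Cv Au; case: (sC) => _ _; apply; first exact: (iso_child sA sB iphi Au uv).
  exact/Cv/(subtree_child sA uv).
Qed.

Section Composition.
Variables t s : almost_aut.

Let is_ := amap_iso s.
Let it := amap_iso t.
Let src_c := comp_set (src s) s (src t).
Let tgt_c := comp_set (tgt t) (forest_inv (src t) t) (tgt s).

Let src_c_subtree : finite_subtree src_c.
Proof.
exact: comp_subtree (src_subtree s) (tgt_subtree s) is_ (src_subtree t).
Qed.

Let tgt_c_subtree : finite_subtree tgt_c.
Proof.
exact: comp_subtree (tgt_subtree t) (src_subtree t) (forest_iso_inv it)
  (tgt_subtree s).
Qed.

Let comp_iso : forest_iso src_c tgt_c (t \o s).
Proof.
split; [split|].
- move=> v /comp_setC[sv tv]; apply/comp_setC => /=; split.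
    exact: (iso_notin it).
  by rewrite (iso_invK it)//; exact: (iso_notin is_).
- move=> u v; rewrite !inE => /comp_setC[su tu] /comp_setC[sv tv] /=.
  by move=> /(iso_inj it tu tv) /(iso_inj is_ su sv).
- move=> w /comp_setC[tw sw]; have [a b] := iso_invP it tw.
  have [a' b'] := iso_invP is_ sw.
  exists (forest_inv (src s) s (forest_inv (src t) t w)); last by rewrite /= b' b.
  by apply/comp_setC; rewrite b'.
- move=> u v /comp_setC[su tu] /comp_setC[sv tv] /=.
  by rewrite (iso_adj it)// (iso_adj is_).
Qed.

Definition comp_aut := AlmostAut src_c_subtree tgt_c_subtree
  (iso_card_boundary src_c_subtree tgt_c_subtree comp_iso) comp_iso.

Definition inv_aut := AlmostAut (tgt_subtree t) (src_subtree t)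
  (iso_card_boundary (tgt_subtree t) (src_subtree t) (forest_iso_inv it))
  (forest_iso_inv it).

End Composition.

(* Aut(T_{d,k}) *)
Record rooted_aut := RootedAut {
  rmap :> vertex -> vertex ;
  rmap_bij : bijective rmap ;
  rmap_root : rmap root = root ;
  rmap_adj : forall u v, adj (rmap u) (rmap v) = adj u v }.

Lemma rooted_iso (a : rooted_aut) : forest_iso [set root] [set root] a.
Proof.
have ai := bij_inj (rmap_bij a).
split; last by move=> u v _ _; exact: rmap_adj.
split=> [v /= vr e|u v _ _ /ai //|v /= vr].
  by apply: vr; apply: ai; rewrite e rmap_root.
have [b ab ba] := rmap_bij a; exists (b v) => //= e.
by apply: vr; rewrite -(ba v) e rmap_root.
Qed.

Definition aut_of_rooted (a : rooted_aut) : almost_aut :=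
  AlmostAut subtree_root subtree_root (card_eqxx _) (rooted_iso a).

Definition id_rooted : rooted_aut :=
  @RootedAut id (Bijective (fun=> erefl) (fun=> erefl)) erefl (fun _ _ => erefl).

Definition eq_germ : rel almost_aut := fun t t' =>
  `[< exists C, [/\ finite_subtree C, src t `<=` C, src t' `<=` C &
        forall v, ~ C v -> t v = t' v] >].

Lemma eq_germ_refl : reflexive eq_germ.
Proof. by move=> t; apply/asboolP; exists (src t); split=> //; exact: src_subtree. Qed.

Lemma eq_germ_sym : symmetric eq_germ.
Proof.
suff h t t' : eq_germ t t' -> eq_germ t' t by move=> t t'; apply/idP/idP; exact: h.
move=> /asboolP[C [sC c c' e]]; apply/asboolP; exists C; split=> // v /e //.
Qed.

Lemma eq_germ_trans : transitive eq_germ.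
Proof.
move=> y x z /asboolP[C [sC cx cy e]] /asboolP[C' [sC' cy' cz e']].
apply/asboolP; exists (C `|` C'); split.
- exact: subtreeU.
- by move=> v /cx; left.
- by move=> v /cz; right.
- by move=> v /not_orP[Cv C'v]; rewrite e// e'.
Qed.

Canonical eq_germ_equiv := EquivRel eq_germ eq_germ_refl eq_germ_sym eq_germ_trans.

(* the product of (the classes of) t and s is the class of t \o s *)
Definition neretin : Type := {eq_quot eq_germ}%qT.
HB.instance Definition _ := Choice.on neretin.
HB.instance Definition _ := EqQuotient.on neretin.

Local Notation cls := (\pi_neretin)%qT.

Lemma eq_clsP (t t' : almost_aut) : reflect
  (exists C, [/\ finite_subtree C, src t `<=` C, src t' `<=` C &
        forall v, ~ C v -> t v = t' v]) (cls t == cls t').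
Proof. by rewrite eqquotE; exact: asboolP. Qed.

Lemma eq_cls (t t' : almost_aut) C : finite_subtree C ->
  (forall v, ~ C v -> t v = t' v) -> cls t = cls t'.
Proof.
move=> sC e; apply/eqP/eq_clsP; exists (C `|` (src t `|` src t')); split.
- by do 2?[apply: subtreeU => //]; exact: src_subtree.
- by move=> v; right; left.
- by move=> v; right; right.
- by move=> v /not_orP[/e].
Qed.

Definition neretin_one : neretin := cls (aut_of_rooted id_rooted).
Definition neretin_mul (g h : neretin) : neretin :=
  cls (comp_aut (repr g) (repr h)).
Definition neretin_inv (g : neretin) : neretin := cls (inv_aut (repr g)).

Lemma cls_ex t t' : cls t = cls t' ->
  exists C, [/\ finite_subtree C, src t `<=` C, src t' `<=` C &
    forall v, ~ C v -> t v = t' v].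
Proof. by move=> /eqP/eq_clsP. Qed.

Lemma cls_mul t s : cls (comp_aut t s) = neretin_mul (cls t) (cls s).
Proof.
rewrite /neretin_mul.
have [C [sC ct ct' e]] := cls_ex (esym (reprK (cls t))).
have [D [sD cs cs' e']] := cls_ex (esym (reprK (cls s))).
apply: (@eq_cls _ _ (D `|` comp_set (src s) s C)).
  apply: subtreeU => //.
  exact: comp_subtree (src_subtree s) (tgt_subtree s) (amap_iso s) sC.
move=> v /not_orP[Dv /comp_setC[sv tv]] /=; by rewrite -e'// e.
Qed.

Lemma cls_inv t : cls (inv_aut t) = neretin_inv (cls t).
Proof.
rewrite /neretin_inv; set r := repr _.
have [C [sC ct cr e]] := cls_ex (esym (reprK (cls t))).
pose it := amap_iso t; pose ir := amap_iso r.
apply: (@eq_cls _ _ (tgt r `|` comp_set (tgt t) (forest_inv (src t) t) C)).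
  apply: subtreeU; first exact: tgt_subtree.
  exact: comp_subtree (tgt_subtree t) (src_subtree t) (forest_iso_inv it) sC.
move=> w /not_orP[rw /comp_setC[tw cw]] /=.
have [a b] := iso_invP it tw.
have [a' b'] := iso_invP ir rw.
apply: (iso_inj ir) => //; first by move=> /cr.
by rewrite b' -[RHS]b -e.
Qed.

Lemma cls_surj (g : neretin) : exists t, g = cls t.
Proof. by exists (repr g); rewrite reprK. Qed.

Lemma neretin_mulA : associative neretin_mul.
Proof.
move=> x y z; have [[[r ->] [s ->]] [t ->]] := (cls_surj x, cls_surj y, cls_surj z).
by rewrite -!cls_mul; apply: (eq_cls subtree_root).
Qed.

Lemma neretin_mul1 : right_id neretin_one neretin_mul.
Proof.
move=> x; have [r ->] := cls_surj x.
by rewrite -!cls_mul; apply: (eq_cls subtree_root).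
Qed.

Lemma neretin_1mul : left_id neretin_one neretin_mul.
Proof.
move=> x; have [r ->] := cls_surj x.
by rewrite -!cls_mul; apply: (eq_cls subtree_root).
Qed.

Lemma neretin_mulV : right_inverse neretin_one neretin_inv neretin_mul.
Proof.
move=> x; have [r ->] := cls_surj x.
rewrite -cls_inv -!cls_mul; apply: (eq_cls (tgt_subtree r)) => v rv /=.
exact: (iso_invP (amap_iso r) rv).2.
Qed.

Lemma neretin_Vmul : left_inverse neretin_one neretin_inv neretin_mul.
Proof.
move=> x; have [r ->] := cls_surj x.
rewrite -cls_inv -!cls_mul; apply: (eq_cls (src_subtree r)) => v rv /=.
exact: (iso_invK (amap_iso r) rv).
Qed.

HB.instance Definition _ := isGroup.Build neretin
  neretin_mulA neretin_1mul neretin_mul1 neretin_Vmul neretin_mulV.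

Definition rooted_inclusion (a : rooted_aut) : neretin :=
  cls (aut_of_rooted a).

Definition fixes_ball n (a : rooted_aut) := forall v, (size v <= n)%N -> a v = v.

Program Definition rooted_comp (a b : rooted_aut) : rooted_aut :=
  @RootedAut (a \o b) (bij_comp (rmap_bij a) (rmap_bij b)) _ _.
Next Obligation. by move=> a b /=; rewrite !rmap_root. Qed.
Next Obligation. by move=> a b u v /=; rewrite !rmap_adj. Qed.

Lemma rooted_inv (a : rooted_aut) :
  exists b : rooted_aut, cancel a b /\ cancel b a.
Proof.
have [f af fa] := rmap_bij a.
have fbij : bijective f by exists a.
have froot : f root = root by rewrite -{1}(rmap_root a) af.
have fadj u v : adj (f u) (f v) = adj u v by rewrite -(rmap_adj a) !fa.
by exists (RootedAut fbij froot fadj).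
Qed.

Let mulE (g h : neretin) : g * h = neretin_mul g h. Proof. by []. Qed.

Lemma rooted_inclusionM a b :
  rooted_inclusion (rooted_comp a b) = rooted_inclusion a * rooted_inclusion b.
Proof.
rewrite /rooted_inclusion mulE -cls_mul.
by apply: (eq_cls subtree_root).
Qed.

Lemma rooted_inclusion1 : rooted_inclusion id_rooted = 1.
Proof. by []. Qed.

Lemma fixes_comp n a b : fixes_ball n a -> fixes_ball n b ->
  fixes_ball n (rooted_comp a b).
Proof. by move=> fa fb v vn /=; rewrite fb// fa. Qed.

Lemma fixes_le m n a : (m <= n)%N -> fixes_ball n a -> fixes_ball m a.
Proof. by move=> mn fa v vm; apply: fa; exact: leq_trans mn. Qed.

Lemma inclusion_inv n a : fixes_ball n a ->
  exists2 b, fixes_ball n b & (rooted_inclusion a)^-1 = rooted_inclusion b.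
Proof.
move=> fa; have [b [ab ba]] := rooted_inv a; exists b.
  by move=> v /fa av; rewrite -{1}av ab.
have e : rooted_inclusion a * rooted_inclusion b = 1.
  rewrite -rooted_inclusionM; apply: (eq_cls subtree_root) => v _ /=.
  by rewrite ba.
by rewrite -[RHS](mulKg (rooted_inclusion a)) e mulg1.
Qed.

Lemma finite_bounded A : finite_set A -> exists n, forall v, A v -> (size v <= n)%N.
Proof.
move=> /finite_setP[n]; elim: n A => [|n IH] A.
  by rewrite II0 card_eq0 => /eqP ->; exists 0%N.
move=> /eq_cardSP[v Av /IH[m mP]]; exists (maxn m (size v)) => w Aw.
have [->|wv] := eqVneq w v; first by rewrite leq_maxr.
by rewrite leq_max mP//; split=> // /eqP; rewrite (negbTE wv).
Qed.

Lemma finite_ball n : finite_set [set v : vertex | (size v <= n)%N].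
Proof.
pose S n := [set s : seq nat | (size s <= n)%N /\ all (fun x => x < maxn k d)%N s].
have fS m : finite_set (S m).
  elim: m => [|m IH].
    apply: (sub_finite_set _ (finite_set1 [::])) => s [].
    by rewrite leqn0 => /nilP -> _.
  apply: (@sub_finite_set _ _ ([set [::]] `|`
    [set x :: s | x in `I_(maxn k d) & s in S m])).
    move=> -[|x s] /= [sm]; first by left.
    by move=> /andP[xk xs]; right; exists x => //; exists s.
  rewrite finite_setU; split; first exact: finite_set1.
  by apply: finite_image2 => //; exact: finite_II.
apply: (sub_finite_set (B := word @^-1` S n)); last first.
  by apply: finite_preimage => // u v _ _; exact: val_inj.
move=> -[s sv] /= sn; split=> //; case: s sv sn => //= x s /andP[xk /allP sd] _.
rewrite leq_max xk/=; apply/allP => y /sd yd.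
by rewrite leq_max yd orbT.
Qed.

Lemma conj_inclusion g n : exists m, forall a, fixes_ball m a ->
  exists2 b, fixes_ball n b & rooted_inclusion a * g = g * rooted_inclusion b.
Proof.
have [t ->] := cls_surj g.
set A := src t; set B := tgt t; set phi := amap t.
have sA : finite_subtree A := src_subtree t.
have sB : finite_subtree B := tgt_subtree t.
have iphi : forest_iso A B phi := amap_iso t.
pose psi := forest_inv A phi.
have [m1 m1P] : exists n, forall v, B v -> (size v <= n)%N.
  by apply: finite_bounded; case: sB.
have [m2 m2P] : exists m, forall v, (phi @` [set v : vertex | (size v <= n)%N]) v ->
    (size v <= m)%N.
  by apply: finite_bounded; apply: finite_image; exact: finite_ball.
exists (maxn m1.+1 m2) => a fa.
have faB w : B w -> a w = w.
  by move=> /m1P wm; apply: fa; rewrite leq_max (leqW wm).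
have fadB w : boundary B w -> a w = w.
  move=> /(boundaryP _ sB)[_ [u /m1P um /size_child wu]]; apply: fa.
  by rewrite wu leq_max ltnS um.
have [a' [aa' a'a]] := rooted_inv a.
have fix' w : a w = w -> a' w = w by move=> aw; rewrite -{1}aw aa'.
pose conj (c : vertex -> vertex) v := if v \in A then v else psi (c (phi v)).
have conjA c v : A v -> conj c v = v by move=> Av; rewrite /conj mem_set.
have conjN c v : ~ A v -> conj c v = psi (c (phi v)).
  by move=> Av; rewrite /conj memNset.
have cN (c : rooted_aut) : (forall w, B w -> c w = w) ->
    forall w, ~ B w -> ~ B (c w).
  move=> cB w Bw Bcw; apply: Bw.
  by rewrite -(bij_inj (rmap_bij c) (cB _ Bcw)).
have conjNA (c : rooted_aut) : (forall w, B w -> c w = w) ->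
    forall v, ~ A v -> ~ A (conj c v) /\ phi (conj c v) = c (phi v).
  move=> cB v Av; rewrite conjN//.
  by apply: (iso_invP iphi); apply: cN => //; exact: (iso_notin iphi).
have a'B w : B w -> a' w = w by move=> /faB/fix'.
have conjK (c c' : rooted_aut) : (forall w, B w -> c w = w) ->
    cancel c c' -> cancel (conj c) (conj c').
  move=> cB cc' v; have [Av|Av] := pselect (A v); first by rewrite !conjA.
  have [h1 h2] := conjNA c cB v Av.
  by rewrite (conjN c')// h2 cc' /psi (iso_invK iphi).
have bbij : bijective (conj a) by exists (conj a'); exact: conjK.
have rA : A root by case: sA.
have badj u v : adj (conj a u) (conj a v) = adj u v.
  have bdry w : ~ A w -> boundary A w \/ boundary A (conj a w) -> conj a w = w.
    move=> Aw; have [h1 h2] := conjNA a faB w Aw => bw.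
    apply: (iso_inj iphi) => //; rewrite h2; case: bw => [bw|bw].
      by apply: fadB; exact: (iso_boundary1 sA sB iphi).
    apply: (bij_inj (rmap_bij a)); apply: fadB; rewrite -h2.
    exact: (iso_boundary1 sA sB iphi).
  have mixed x y : A x -> ~ A y -> adj x (conj a y) = adj x y.
    move=> Ax Ay; have [h1 h2] := conjNA a faB y Ay.
    apply/idP/idP => xy; have by_ : conj a y = y.
    - by apply: bdry => //; right; split => //; exists x.
    - by rewrite -by_.
    - by apply: bdry => //; left; split => //; exists x.
    - by rewrite by_.
  have [Au|Au] := pselect (A u); have [Av|Av] := pselect (A v).
  - by rewrite !conjA.
  - by rewrite conjA// mixed.
  - by rewrite [in LHS]adjC (conjA a v)// mixed// adjC.
  - have [h1 h2] := conjNA a faB u Au; have [h3 h4] := conjNA a faB v Av.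
    by rewrite -(iso_adj iphi)// h2 h4 rmap_adj (iso_adj iphi).
exists (RootedAut bbij (conjA a root rA) badj).
  move=> v vn /=; have [Av|Av] := pselect (A v); first exact: conjA.
  rewrite conjN// fa /psi ?(iso_invK iphi)//.
  by rewrite leq_max m2P ?orbT//; exists v.
rewrite /rooted_inclusion !mulE -!cls_mul.
apply: (eq_cls sA) => v Av /=.
by have [_ e] := conjNA a faB v Av; exact: esym e.
Qed.

(* The fixators of the balls around the root are a basis of neighbourhoods of 1 in
   the profinite group Aut(T). A group topology on N for which the inclusion of
   Aut(T) is continuous and open therefore has their images as a basis of
   neighbourhoods of 1, and their left translates by g as a basis at g. *)
Definition neretin_nbhs (g : neretin) : set_system neretin :=
  [set U | exists n, forall a, fixes_ball n a -> U (g * rooted_inclusion a)].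

HB.instance Definition _ := hasNbhs.Build neretin neretin_nbhs.

Let nbhs_pfilter (g : neretin) : ProperFilter (nbhs g).
Proof.
have fid n : fixes_ball n id_rooted by [].
split; first by move=> [n /(_ id_rooted)]; exact.
split.
- by exists 0%N.
- move=> U V [m mU] [n nV]; exists (maxn m n) => a fa; split.
    by apply: mU; apply: fixes_le fa; rewrite leq_maxl.
  by apply: nV; apply: fixes_le fa; rewrite leq_maxr.
- by move=> U V UV [n nU]; exists n => a /nU /UV.
Qed.

Let nbhs_singl (g : neretin) U : nbhs g U -> U g.
Proof.
by move=> [n /(_ id_rooted)]; rewrite rooted_inclusion1 mulg1; exact.
Qed.

Let nbhs_nbhs_ (g : neretin) U : nbhs g U -> nbhs g (nbhs^~ U).
Proof.
move=> [n nU]; exists n => a fa; exists n => b fb.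
by rewrite -mulgA -rooted_inclusionM; apply: nU; exact: fixes_comp.
Qed.

HB.instance Definition _ :=
  Nbhs_isNbhsTopological.Build neretin nbhs_pfilter nbhs_singl nbhs_nbhs_.
HB.instance Definition _ := isPointed.Build neretin 1.

Let neretin_mulg_continuous :
  continuous (fun xy : neretin * neretin => xy.1 * xy.2).
Proof.
move=> [g h] U [n nU]; have [m mP] := conj_inclusion h n.
exists ([set g * rooted_inclusion a | a in fixes_ball m],
        [set h * rooted_inclusion a | a in fixes_ball n]).
  by split; [exists m|exists n] => a fa; exists a.
move=> [_ _] /= [[a fa <-] [b fb <-]].
have [c fc e] := mP a fa.
rewrite -(mulgA g) (mulgA _ h) e !mulgA -(mulgA _ (_ c)) -rooted_inclusionM.
by apply: nU; exact: fixes_comp.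
Qed.

Let neretin_invg_continuous : continuous (fun x : neretin => x^-1).
Proof.
move=> g U [n nU]; have [m mP] := conj_inclusion g^-1 n.
exists m => a fa; rewrite /= invgM.
have [b fb ->] := inclusion_inv fa.
by have [c fc ->] := mP b fb; exact: nU.
Qed.

HB.instance Definition _ := isTopologicalGroup.Build neretin
  neretin_mulg_continuous neretin_invg_continuous.

(* an end of T is represented by the infinite ray from the root towards it *)
Record tree_end := TreeEnd {
  ray_letters :> nat -> nat ;
  ray_vertex : forall n, is_vertex (mkseq ray_letters n) }.

Definition ray (xi : tree_end) n : vertex := Vertex (ray_vertex xi n).

(* t sends all but finitely many vertices of the ray xi into the ray eta *)
Definition maps_end (t : almost_aut) (xi eta : tree_end) :=
  exists N, forall n, (N <= n)%N -> exists m, t (ray xi n) = ray eta m.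

Lemma size_ray xi n : size (ray xi n) = n. Proof. by rewrite size_mkseq. Qed.

Lemma child_ray xi n : child (ray xi n) (ray xi n.+1).
Proof. by apply/childP; exists (xi n); rewrite /= mkseqS. Qed.

Lemma ray_leave A xi : finite_subtree A ->
  exists N, forall n, (N <= n)%N -> ~ A (ray xi n).
Proof.
move=> [/finite_bounded[N NA] _ _]; exists N.+1 => n Nn /NA.
by rewrite size_ray leqNgt Nn.
Qed.

Lemma ray_nth xi i n : (i < n)%N -> nth 0%N (ray xi n) i = xi i.
Proof. by move=> ni; rewrite nth_mkseq. Qed.

Lemma tree_end_eq (xi eta : tree_end) : xi =1 eta -> xi = eta.
Proof.
case: xi eta => [x xP] [y yP] /funext /= e; subst y.
by congr TreeEnd; exact: Prop_irrelevance.
Qed.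

Lemma maps_end_ex t xi : exists eta, maps_end t xi eta.
Proof.
have [N NA] := ray_leave xi (src_subtree t).
pose w i := t (ray xi (N + i)).
have wc i : child (w i) (w i.+1).
  rewrite /w addnS.
  apply: (iso_child (src_subtree t) (tgt_subtree t) (amap_iso t)).
    by apply: NA; rewrite leq_addr.
  exact: child_ray.
have sw i : size (w i) = (size (w 0%N) + i)%N.
  by elim: i => [|i IH]; rewrite ?addn0// (size_child (wc i)) IH addnS.
have pw i j : (i <= j)%N -> prefix (w i) (w j).
  elim: j => [|j IH]; first by rewrite leqn0 => /eqP ->; exact: prefix_refl.
  rewrite leq_eqVlt => /orP[/eqP ->|]; first exact: prefix_refl.
  by move=> /IH /prefix_trans; apply; case/andP: (wc j).
pose f j := nth 0%N (w j.+1) j.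
have fE i : mkseq f (size (w i)) = w i.
  apply: (@eq_from_nth _ 0%N); rewrite size_mkseq// => j ji.
  rewrite nth_mkseq// /f.
  have [h|h] := leqP j.+1 i.
    have /prefixP[s ->] := pw _ _ h; rewrite nth_cat.
    by rewrite sw addnS ltnS leq_addl.
  by have /prefixP[s ->] := pw _ _ (ltnW h); rewrite nth_cat ji.
have fP n : is_vertex (mkseq f n).
  have [->//|n0] := posnP n.
  have nw : (n <= size (w n))%N by rewrite sw leq_addl.
  have := wordP (w n); rewrite -fE.
  case: n n0 nw => // n _ nw; rewrite -(subnKC nw) /mkseq iotaD map_cat /= all_cat.
  by case/andP => -> /andP[].
exists (TreeEnd fP); exists N => n Nn; exists (size (w (n - N)%N)).
by apply/val_inj; rewrite /= fE /w subnKC.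
Qed.

Lemma maps_end_uniq t xi eta eta' :
  maps_end t xi eta -> maps_end t xi eta' -> eta = eta'.
Proof.
move=> [N NP] [N' NP']; apply: tree_end_eq => i.
have [M MA] := ray_leave xi (src_subtree t).
pose n j := (maxn M (maxn N N') + j)%N.
have grow j : (j <= size (t (ray xi (n j))))%N.
  elim: j => // j IH; rewrite /n addnS.
  rewrite (size_child (iso_child (src_subtree t) (tgt_subtree t) (amap_iso t) _
    (child_ray xi _))) ?ltnS//.
  by apply: MA; rewrite (leq_trans _ (leq_addr _ _))// leq_maxl.
have [m e] : exists m, t (ray xi (n i.+1)) = ray eta m.
  by apply: NP; rewrite (leq_trans _ (leq_addr _ _))// !leq_max leqnn orbT.
have [m' e'] : exists m, t (ray xi (n i.+1)) = ray eta' m.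
  by apply: NP'; rewrite (leq_trans _ (leq_addr _ _))// !leq_max leqnn !orbT.
have im : (i < m)%N by have := grow i.+1; rewrite e size_ray.
have im' : (i < m')%N by have := grow i.+1; rewrite e' size_ray.
by rewrite -(ray_nth eta im) -(ray_nth eta' im') -e e'.
Qed.

Definition end_act (g : neretin) (xi : tree_end) : tree_end :=
  projT1 (cid (maps_end_ex (repr g) xi)).

Lemma end_actE t xi : maps_end t xi (end_act (cls t) xi).
Proof.
have [N NP] := projT2 (cid (maps_end_ex (repr (cls t)) xi)).
have [C [sC _ _ e]] := cls_ex (esym (reprK (cls t))).
have [M MA] := ray_leave xi sC.
exists (maxn M N) => n; rewrite geq_max => /andP[Mn Nn].
by rewrite e; [exact: NP|exact: MA].
Qed.

Lemma end_act1 xi : end_act 1 xi = xi.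
Proof.
apply: (maps_end_uniq (end_actE (aut_of_rooted id_rooted) xi)).
by exists 0%N => n _; exists n.
Qed.

Lemma end_actM g h xi : end_act (g * h) xi = end_act g (end_act h xi).
Proof.
have [t ->] := cls_surj g; have [s ->] := cls_surj h.
rewrite mulE -cls_mul.
apply: (maps_end_uniq (end_actE _ _)).
have [N NP] := end_actE s xi; have [M MP] := end_actE t (end_act (cls s) xi).
have [L LA] := ray_leave xi (src_subtree s).
pose K := maxn L N.
have grow j : (j <= size (s (ray xi (K + j))))%N.
  elim: j => // j IH; rewrite addnS.
  rewrite (size_child (iso_child (src_subtree s) (tgt_subtree s) (amap_iso s) _
    (child_ray xi _))) ?ltnS//.
  by apply: LA; rewrite (leq_trans _ (leq_addr _ _))// leq_maxl.
exists (K + M)%N => n KMn /=.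
have [m e] : exists m, s (ray xi n) = ray (end_act (cls s) xi) m.
  by apply: NP; apply: leq_trans KMn; rewrite (leq_trans _ (leq_addr _ _))// leq_maxr.
rewrite e; apply: MP; have := grow (n - K)%N.
rewrite subnKC ?(leq_trans _ KMn) ?leq_addr// e size_ray => /(leq_trans _); apply.
by rewrite leq_subRL ?(leq_trans _ KMn) ?leq_addr.
Qed.

Definition end_stab (xi : tree_end) : set neretin := [set g | end_act g xi = xi].

End Neretin.

(* Main.v *)
From HB Require Import structures.
Require Import Defs.
From mathcomp Require Import all_boot all_order all_algebra all_fingroup all_solvable.
From mathcomp Require Import finmap all_classical all_reals.
From mathcomp Require Import topology ereal measure sequences.

(* The boundary of the tree is 'I_k * (nat -> 'I_d), and the Neretin group G acts on
   it by the homeomorphisms that are similarities on the pieces of some finite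
   partition into balls, a frame. Let H be closed and cocompact, and let U be the
   compact open subgroup of isometries. As G is a finite union of double cosets H r U,
   H realizes all but an exponential factor of the n! permutations of the pieces of a
   frame with n pieces. So it realizes some permutation of prime order p > d fixing a
   given piece; the powers of a representative with exponents (d!)^l converge to an
   element of H that is trivial on the fixed pieces. Commutators of such elements give
   3-cycles of three balls which are trivial elsewhere, and any large family of disjoint
   balls contains one. Being joined by a 3-cycle is an equivalence relation on the pieces
   of a frame; merging pieces shows that it has at most one large class. A point is bad
   if it has no neighbourhood among the balls of large classes. Bad points are finitely
   many, and by cocompactness two of them would be separated at a fixed level by all the
   double coset representatives, while G brings them arbitrarily close; so there is at
   most one. On balls avoiding it H contains the even permutations, then all, since an odd
   permutation of pieces can be made even on all the deeper levels. It follows that H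
   contains every element of G that preserves the bad point and some ball around it. If
   there is no bad point, then H = G. Otherwise H fixes the bad point xi and contains the
   kernel of the contraction homomorphism from the stabilizer of xi to the integers; it
   also contains, by the pigeonhole principle on double cosets, a power of an element tau
   of degree 1. So H has finite index in the stabilizer, and it is not unimodular because
   tau conjugates a compact open subgroup into a proper subgroup.
   Conversely, an element of G that permutes the pieces of a frame by isometries
   normalizes a compact open subgroup, so right translation by it preserves Haar measure;
   such elements generate G. *)

Set Implicit Arguments.
Unset Strict Implicit.
Unset Printing Implicit Defensive.

(** * Streams and local similarities *)

Section Streams.
Variables (d : nat) (hd : 1 < d).

(** Cocompactness describes elements only up to isometries: an element of H is known to permute some
    balls, but not what it does inside them. A prime p > d overcomes this. The isometries act on the
    words of a given length through a group whose order divides a power of d!, so exponents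
    divisible by high powers of d! destroy the isometric part, while exponents congruent to 1 modulo
    p keep a permutation of order p. Such a p exists because n! outgrows every exponential: the
    frames with n = #|I0| + m(d-1) pieces fall into at most N d!^m classes, and a group of
    permutations whose order has only prime divisors up to d has order at most d!^n. Locality comes
    from the only invariant of a frame, its number of pieces modulo d - 1: when this number allows
    it, everything outside a few chosen pieces becomes one single ball, and an element that is
    exactly trivial on this ball is supported by the chosen pieces. *)

Definition stream := nat -> 'I_d.
Definition letter0 : 'I_d := Ordinal (ltnW hd).
Definition letter1 : 'I_d := Ordinal hd.
Definition stream0 : stream := fun=> letter0.

Implicit Types (x y z : stream) (u v w : seq 'I_d) (a b : stream -> stream).

Definition agree n x y := forall i, i < n -> x i = y i.
(** The default value of [nth] is the letter of [x] wanted beyond the end of [w]; this replaces a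
    case distinction on the position. *)
Definition scat w x : stream := fun n => nth (x (n - size w)) w n.
Definition sdrop n x : stream := fun i => x (n + i).

Lemma scat0 x : scat [::] x = x.
Proof. by apply/funext => n; rewrite /scat subn0 nth_nil. Qed.

Lemma scat_cat u v x : scat (u ++ v) x = scat u (scat v x).
Proof.
apply/funext => n; rewrite /scat nth_cat size_cat subnDA.
by case: ltnP => // h; [exact: set_nth_default | rewrite [in RHS]nth_default].
Qed.

Lemma scat_lt w x n : n < size w -> scat w x n = nth letter0 w n.
Proof. by move=> h; exact: set_nth_default. Qed.

Lemma scat_add w x n : scat w x (size w + n) = x n.
Proof. by rewrite /scat nth_default ?leq_addr// addKn. Qed.

Lemma scatK w x : mkseq (scat w x) (size w) = w.
Proof.
apply: (@eq_from_nth _ letter0); rewrite size_mkseq// => i iw.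
by rewrite nth_mkseq// scat_lt.
Qed.

Lemma sdrop_scat w x : sdrop (size w) (scat w x) = x.
Proof. by apply/funext => n; exact: scat_add. Qed.

Lemma scat_mkseq n x : scat (mkseq x n) (sdrop n x) = x.
Proof.
apply/funext => i; have [h|h] := ltnP i n.
  by rewrite scat_lt ?size_mkseq// nth_mkseq.
have := scat_add (mkseq x n) (sdrop n x) (i - n).
by rewrite size_mkseq /sdrop subnKC.
Qed.

Lemma scat_inj u v x y : size u = size v -> scat u x = scat v y -> u = v /\ x = y.
Proof.
move=> uv e; split.
  by rewrite -(scatK u x) e uv scatK.
by rewrite -(sdrop_scat u x) e uv sdrop_scat.
Qed.

Lemma scat_prefix u v x y : size u <= size v -> scat u x = scat v y ->
  exists v', v = u ++ v' /\ x = scat v' y.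
Proof.
move=> uv e; exists (drop (size u) v).
have tv : size u = size (take (size u) v) by rewrite size_take; case: ltngtP uv.
rewrite -{1}(cat_take_drop (size u) v) scat_cat in e.
have [e1 e2] := scat_inj tv e.
by rewrite -[v in LHS](cat_take_drop (size u) v) -e1 e2.
Qed.

Lemma mkseqDr x m n : mkseq x (m + n) = mkseq x m ++ mkseq (sdrop m x) n.
Proof.
apply: (@eq_from_nth _ letter0); first by rewrite size_cat !size_mkseq.
move=> i; rewrite size_mkseq => imn; rewrite nth_mkseq// nth_cat size_mkseq.
case: ltnP => h; rewrite nth_mkseq//; first by rewrite /sdrop subnKC.
by rewrite -(ltn_add2l m) subnKC.
Qed.

Lemma agreeP n x y : agree n x y <-> mkseq x n = mkseq y n.
Proof.
split=> [e|e i iN]; first by apply/eq_in_map => i; rewrite mem_iota; exact: e.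
by rewrite -(nth_mkseq letter0 x iN) e nth_mkseq.
Qed.

Lemma agree_sym n x y : agree n x y -> agree n y x.
Proof. by move=> h i iN; rewrite h. Qed.

Lemma agree_trans n x y z : agree n x y -> agree n y z -> agree n x z.
Proof. by move=> h1 h2 i iN; rewrite h1// h2. Qed.

Lemma agree_le m n x y : m <= n -> agree n x y -> agree m x y.
Proof. by move=> mn h i im; apply: h; exact: leq_trans mn. Qed.

Lemma agree_all x y : (forall n, agree n x y) -> x = y.
Proof. by move=> h; apply/funext => n; exact: (h n.+1). Qed.

Lemma agree_scat w n x y : agree (size w + n) (scat w x) (scat w y) <-> agree n x y.
Proof.
split=> h i iN; first by rewrite -(scat_add w x) -(scat_add w y) h// ltn_add2l.
have [iw|iw] := ltnP i (size w); first by rewrite !scat_lt.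
by rewrite -(subnKC iw) !scat_add h// -(ltn_add2l (size w)) subnKC.
Qed.

Lemma agree_scatl w x y : agree (size w) (scat w x) (scat w y).
Proof. by rewrite -[X in agree X]addn0; apply/agree_scat. Qed.

Lemma agree_mkseq n x y : agree n x (scat (mkseq x n) y).
Proof. by move=> i iN; rewrite scat_lt ?size_mkseq// nth_mkseq. Qed.

Definition nonexp a := forall n x y, agree n x y -> agree n (a x) (a y).
Definition isom a := exists b, [/\ cancel a b, cancel b a, nonexp a & nonexp b].

Lemma isom_id : isom id. Proof. by exists id; split. Qed.

Lemma isom_comp a b : isom a -> isom b -> isom (a \o b).
Proof.
move=> [a' [h1 h2 h3 h4]] [b' [k1 k2 k3 k4]]; exists (b' \o a').
by split; [exact: can_comp|exact: can_comp|move=> n x y /k3/h3|move=> n x y /h4/k4].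
Qed.

Lemma isom_inv a : isom a -> exists b, [/\ isom b, cancel a b & cancel b a].
Proof. by move=> [b [h1 h2 h3 h4]]; exists b; split=> //; exists a. Qed.

Lemma isom_nonexp a : isom a -> nonexp a. Proof. by case=> b []. Qed.

Lemma isom_inj a : isom a -> injective a. Proof. by case=> b [/can_inj]. Qed.

Lemma isom_agree a n x y : isom a -> agree n (a x) (a y) <-> agree n x y.
Proof.
by move=> [b [h1 h2 h3 h4]]; split=> [/h4|/h3//]; rewrite !h1.
Qed.

(** The first [size w] letters of the image are constant on the ball of [w], because [a] is
    nonexpanding; the same argument for the inverse makes the rest of the map an isometry. *)
Lemma isom_scat w a : isom a -> exists u a',
  [/\ size u = size w, isom a' & forall x, a (scat w x) = scat u (a' x)].
Proof.
move=> [b [ab ba na nb]].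
pose u := mkseq (a (scat w stream0)) (size w).
have su : size u = size w by rewrite size_mkseq.
have au x : a (scat w x) = scat u (sdrop (size w) (a (scat w x))).
  have /agreeP e := na _ _ _ (@agree_scatl w stream0 x).
  by rewrite /u e scat_mkseq.
have bw x : b (scat u x) = scat w (sdrop (size w) (b (scat u x))).
  have := nb _ _ _ (@agree_scatl u x (sdrop (size w) (a (scat w stream0)))).
  rewrite -au ab su => /agreeP; rewrite scatK => e.
  by rewrite -{1}e scat_mkseq.
exists u, (fun x => sdrop (size w) (a (scat w x))); split=> //.
exists (fun x => sdrop (size w) (b (scat u x))); split.
- by move=> x; rewrite -au ab sdrop_scat.
- by move=> x; rewrite -bw ba -su sdrop_scat.
- move=> n x y h; apply/(@agree_scat u); rewrite -!au; apply: na; rewrite su.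
  exact/agree_scat.
- move=> n x y h; apply/(@agree_scat w); rewrite -!bw; apply: nb; rewrite -su.
  exact/agree_scat.
Qed.

(* A ball is given by a chart b : stream -> T, which matters up to sim. *)
Definition sim (T : Type) (b b' : stream -> T) := exists2 a, isom a & b = b' \o a.

Lemma sim_refl T (b : stream -> T) : sim b b.
Proof. by exists id => //; exact: isom_id. Qed.

Lemma sim_sym T (b b' : stream -> T) : sim b b' -> sim b' b.
Proof.
move=> [a /isom_inv[a' [ia ? h]] ->]; exists a' => //.
by apply/funext => x /=; rewrite h.
Qed.

Lemma sim_trans T (b1 b2 b3 : stream -> T) : sim b1 b2 -> sim b2 b3 -> sim b1 b3.
Proof.
by move=> [a ia ->] [a' ia' ->]; exists (a' \o a) => //; exact: isom_comp.
Qed.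

Lemma sim_comp T T' (h : T -> T') (b b' : stream -> T) : sim b b' -> sim (h \o b) (h \o b').
Proof. by move=> [a ia ->]; exists a. Qed.

Definition img (T : Type) (b : stream -> T) (p : T) := exists x, b x = p.

Lemma sim_img T (b b' : stream -> T) p : sim b b' -> img b p <-> img b' p.
Proof.
suff h (b1 b2 : stream -> T) : sim b1 b2 -> img b1 p -> img b2 p.
  by move=> bb'; split; apply: h => //; exact: sim_sym.
by move=> [a ia ->] [x <-]; exists (a x).
Qed.

Definition sub (T : Type) (b : stream -> T) w : stream -> T := fun x => b (scat w x).

Lemma sub_cat T (b : stream -> T) u v : sub b (u ++ v) = sub (sub b u) v.
Proof. by apply/funext => x; rewrite /sub scat_cat. Qed.

Lemma sub0 T (b : stream -> T) : sub b [::] = b.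
Proof. by apply/funext => x; rewrite /sub scat0. Qed.

Lemma sim_sub T (b b' : stream -> T) w : sim b b' ->
  exists2 u, size u = size w & sim (sub b w) (sub b' u).
Proof.
move=> [a ia ->]; have [u [a' [su ia' e]]] := isom_scat w ia.
by exists u => //; exists a' => //; apply/funext => x; rewrite /sub /= e.
Qed.

End Streams.

(** * Local similarities between disjoint unions of balls *)

Section Homs.
Variables (d : nat) (hd : 1 < d).
Local Notation C := (stream d).
Implicit Types I J K : finType.

(* The maps that are similarities on all balls of depth m. The invertible ones with
   any m form the Neretin group of a forest of #|I| trees when I = J. *)
Definition lsm I J m (f : I * C -> J * C) := forall i w, m <= size w ->
  exists j u a, isom a /\ forall x, f (i, scat w x) = (j, scat u (a x)).

Definition ls I J (f : I * C -> J * C) := exists m, lsm m f.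

(** Deeper balls follow from those of depth exactly [m], since a similarity restricts to a
    similarity of each sub-ball. *)
Lemma lsm_eq I J m (f : I * C -> J * C) : (forall i w, size w = m ->
  exists j u a, isom a /\ forall x, f (i, scat w x) = (j, scat u (a x))) -> lsm m f.
Proof.
move=> h i w mw; have sw : size (take m w) = m by rewrite size_takel.
have [j [u [a [ia e]]]] := h i _ sw.
have [v [a' [sv ia' e']]] := isom_scat hd (drop m w) ia.
exists j, (u ++ v), a'; split=> // x.
by rewrite -{1}(cat_take_drop m w) !scat_cat e e'.
Qed.

Lemma ls_comp I J K (f : I * C -> J * C) (g : J * C -> K * C) :
  ls f -> ls g -> ls (g \o f).
Proof.
move=> [m fm] [n gn]; exists (m + n); apply: lsm_eq => i w sw.
have [|j [u [a [ia e]]]] := fm i (take m w).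
  by rewrite size_takel// sw leq_addr.
have [v [a' [sv ia' e']]] := isom_scat hd (drop m w) ia.
(* The similarity may enlarge the ball of depth [m], but it keeps the number of letters that follow:
   [u ++ v] has at least [n] letters whatever [u] is. *)
have [|k [t [b [ib e2]]]] := gn j (u ++ v).
  by rewrite size_cat sv size_drop sw addKn leq_addl.
exists k, t, (b \o a'); split; first exact: isom_comp.
move=> x; rewrite /= -{1}(cat_take_drop m w) scat_cat e e' -e2.
by rewrite scat_cat.
Qed.

Definition hom I J (f : I * C -> J * C) :=
  exists g, [/\ cancel f g, cancel g f, ls f & ls g].

Lemma hom_ls I J (f : I * C -> J * C) : hom f -> ls f.
Proof. by case=> g []. Qed.

Lemma hom_inj I J (f : I * C -> J * C) : hom f -> injective f.
Proof. by case=> g [/can_inj]. Qed.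

Lemma hom_inv I J (f : I * C -> J * C) : hom f ->
  exists g, [/\ hom g, cancel f g & cancel g f].
Proof. by case=> g [? ? ? ?]; exists g; split=> //; exists f. Qed.

Lemma hom_comp I J K (f : I * C -> J * C) (g : J * C -> K * C) :
  hom f -> hom g -> hom (g \o f).
Proof.
move=> [f' [h1 h2 h3 h4]] [g' [k1 k2 k3 k4]]; exists (f' \o g').
by split; [exact: can_comp|exact: can_comp|exact: ls_comp|exact: ls_comp].
Qed.

Definition pw I J (s : I -> J) (a : I -> C -> C) : I * C -> J * C :=
  fun p => (s p.1, a p.1 p.2).

Lemma hom_pw I J (s : I -> J) (a : I -> C -> C) :
  bijective s -> (forall i, isom (a i)) -> hom (pw s a).
Proof.
move=> [t st ts] ia.
have /choice[b bP] i : exists b, [/\ isom b, cancel (a i) b & cancel b (a i)].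
  exact: isom_inv.
exists (pw t (fun j => b (t j))); split.
- by move=> [i x]; rewrite /pw /= st; case: (bP i) => _ -> _.
- by move=> [j x]; rewrite /pw /= ts; case: (bP (t j)) => _ _ ->.
- exists 0; apply: lsm_eq => i w /size0nil ->; exists (s i), [::], (a i).
  by split=> // x; rewrite !scat0.
- exists 0; apply: lsm_eq => i w /size0nil ->; exists (t i), [::], (b (t i)).
  by case: (bP (t i)) => ? _ _; split=> // x; rewrite !scat0.
Qed.

Definition relab I J (s : I -> J) : I * C -> J * C := fun p => (s p.1, p.2).

Lemma hom_relab I J (s : I -> J) : bijective s -> hom (relab s).
Proof. by move=> bs; apply: (hom_pw bs (a := fun=> id)) => i; exact: isom_id. Qed.

Lemma hom_id I : hom (@id (I * C)).
Proof.
have e : @id (I * C) = relab id by apply/funext => -[].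
by rewrite e; apply: hom_relab; exists id.
Qed.

(* c is a complete prefix code when cmap c is bijective *)
Definition cmap I J (c : J -> I * seq 'I_d) : J * C -> I * C :=
  fun p => ((c p.1).1, scat (c p.1).2 p.2).

Lemma hom_cmap I J (c : J -> I * seq 'I_d) : bijective (cmap c) -> hom (cmap c).
Proof.
move=> [g cg gc]; exists g; split=> //.
  exists 0; apply: lsm_eq => j w /size0nil ->; exists (c j).1, (c j).2, id.
  by split; [exact: isom_id|move=> x; rewrite scat0].
(* A word at least as long as all code words extends the code word of the piece that contains it,
   and the inverse just deletes this prefix. *)
pose m := \max_j size (c j).2; exists m; apply: lsm_eq => i w sw.
case E : (g (i, scat w (stream0 hd))) => [j y].
have := gc (i, scat w (stream0 hd)); rewrite E /cmap /= => -[ei /(scat_prefix hd)].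
case; first by rewrite sw; exact: (leq_bigmax j).
move=> w' [ew ey]; exists j, w', id; split; first exact: isom_id.
move=> x; apply: (can_inj cg); rewrite gc /cmap /=; congr (_, _); first exact: esym.
by rewrite ew scat_cat.
Qed.

(* the pieces left when each piece i is cut into its balls of depth l i *)
Definition ref_idx I (l : I -> nat) : finType := {i : I & (l i).-tuple 'I_d}.

Definition ref_code I (l : I -> nat) (t : ref_idx l) : I * seq 'I_d :=
  (tag t, tagged t : seq _).

Definition rmp I (l : I -> nat) : ref_idx l * C -> I * C := cmap (@ref_code I l).

Definition mkt I (l : I -> nat) i (x : C) : ref_idx l :=
  Tagged (fun i => (l i).-tuple 'I_d)
    (@Tuple (l i) _ (mkseq x (l i)) (introT eqP (size_mkseq x (l i)))).

Lemma mkt_eq I (l : I -> nat) (t : ref_idx l) x : mkt l (tag t) (scat (tagged t) x) = t.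
Proof.
case: t => i w /=; rewrite /mkt; congr Tagged; apply/val_inj => /=.
by rewrite -[X in mkseq _ X](size_tuple w) scatK.
Qed.

Lemma hom_rmp I (l : I -> nat) : hom (@rmp I l).
Proof.
apply: hom_cmap; exists (fun p => (mkt l p.1 p.2, sdrop (l p.1) p.2)).
  move=> [t x]; rewrite /cmap /= mkt_eq -[X in sdrop X](size_tuple (tagged t)).
  by rewrite sdrop_scat.
by move=> [i x]; rewrite /cmap /= scat_mkseq.
Qed.

(** Each cut replaces one piece by d ^ l pieces, and d ^ l is 1 modulo d - 1. *)
Lemma card_ref_mod I (l : I -> nat) : #|ref_idx l| = #|I| %[mod d.-1].
Proof.
rewrite card_tagged sumnE big_map big_enum /= -sum1_card.
rewrite (eq_bigr (fun i => d ^ l i)); last by move=> i _; rewrite card_tuple card_ord.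
elim/big_rec2: _ => // i x y _ e; rewrite -modnDm e modnDm -modnDml.
have -> : d ^ l i = 1 %[mod d.-1] ; last by rewrite modnDml.
rewrite -modnXm -{1}(ltn_predK hd) -addn1 modnDl modnXm exp1n //.
Qed.

Lemma card_ref_ge I (l : I -> nat) i : d ^ l i <= #|ref_idx l|.
Proof.
rewrite card_tagged sumnE big_map big_enum /= (bigD1 i)//= card_tuple card_ord.
exact: leq_addr.
Qed.

Lemma hom_eq_card I J : #|I| = #|J| -> exists s : I -> J, bijective s.
Proof.
move=> e; exists (fun i => enum_val (cast_ord e (enum_rank i))).
exists (fun j => enum_val (cast_ord (esym e) (enum_rank j))) => i.
  by rewrite enum_valK cast_ordK enum_rankK.
by rewrite enum_valK cast_ordKV enum_rankK.
Qed.

(** The number of pieces modulo d - 1 is the only obstruction to merging them all into one ball. The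
    induction step regards the pieces of [K] as those of a family with d - 1 fewer pieces, one of
    which has been cut into its d children. *)
Lemma hom_merge K : 0 < #|K| -> #|K| = 1 %[mod d.-1] ->
  exists f : K * C -> unit * C, hom f.
Proof.
move=> k0 kd.
have [m km] : exists m, #|K| = (m * d.-1).+1.
  exists (#|K|.-1 %/ d.-1).
  have : #|K|.-1 = 0 %[mod d.-1].
    by apply/eqP; rewrite -(eqn_modDr 1) addn1 prednK// add0n; apply/eqP.
  by rewrite mod0n => /eqP; rewrite -/(dvdn _ _) => /divnK ->; rewrite prednK.
elim: m => [|m IH] in K km k0 kd *.
  have [s bs] := @hom_eq_card K unit ltac:(by rewrite km card_unit).
  by exists (relab s); exact: hom_relab.
pose K' : finType := 'I_(m * d.-1).+1.
have cK' : #|K'| = (m * d.-1).+1 by rewrite card_ord.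
have [||f hf] := IH K' cK'; rewrite ?cK'//.
  by rewrite -addn1 modnMDl.
pose l (i : K') : nat := i == ord0.
have cr : #|K| = #|ref_idx l|.
  rewrite km card_tagged sumnE big_map big_enum /= (bigD1 ord0)//=.
  rewrite (eq_bigr (fun=> 1)); last first.
    by move=> i /negPf i0; rewrite card_tuple /l i0.
  rewrite sum_nat_const muln1 card_tuple card_ord expn1 cardC1 card_ord.
  by rewrite -{2}(ltn_predK hd) addSn mulSn.
have [s bs] := hom_eq_card cr.
exists (f \o rmp (l := l) \o relab s).
apply: hom_comp (hom_relab bs) _; exact: hom_comp (hom_rmp l) hf.
Qed.

End Homs.

(** * Isometries *)

Section Numbers.

Lemma sum_halves K n : \sum_(1 <= k < K.+1) n %/ 2 ^ k <= n.
Proof.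
elim: K n => [|K IH] n; first by rewrite big_geq.
rewrite big_nat_recl//= expn1.
apply: (@leq_trans (n %/ 2 + n %/ 2)); last first.
  by rewrite addnn -muln2 leq_trunc_div.
rewrite leq_add2l; apply: leq_trans (IH (n %/ 2)).
by apply: leq_sum => k _; rewrite expnS divnMA.
Qed.

Lemma logn_fact_le p n : prime p -> logn p n`! <= n.
Proof.
move=> pp; rewrite logn_fact//; apply: leq_trans (sum_halves n n).
apply: leq_sum => -[|k] _; first by rewrite !expn0.
by apply: leq_div2l; rewrite ?expn_gt0// leq_exp2r ?prime_gt1.
Qed.

(** By Legendre's formula the p-part of n! is at most p ^ n, and only primes up to [d]
    contribute. *)
Lemma smooth_dvd_fact d m n : 0 < m -> m %| n`! ->
  (forall p, prime p -> p %| m -> p <= d) -> m <= d`! ^ n.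
Proof.
move=> m0 mn sm.
have <- : m`_[pred p | p <= d] = m.
  by apply: part_pnat_id; apply/pnatP => // p pp pm; rewrite inE; exact: sm.
(* The maximum with 1 keeps the factor at p = 0 positive, so that the product may be extended to all
   numbers up to [d]. *)
pose F p := maxn p 1 ^ n.
have F0 p : 0 < F p by rewrite expn_gt0 leq_max orbT.
apply: (@leq_trans (\prod_(0 <= p < m.+1 | p <= d) F p)).
  apply: leq_prod => p _; have [pp|np] := boolP (prime p); last first.
    by rewrite lognE (negPf np) expn0.
  rewrite /F (maxn_idPl (prime_gt0 pp)) leq_exp2l ?prime_gt1//.
  by apply: leq_trans (logn_fact_le n pp); exact: dvdn_leq_log (fact_gt0 _) mn.
pose K := m.+1 + d.+1.
rewrite (big_nat_widen _ _ K) ?leq_addr//.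
apply: (@leq_trans (\prod_(0 <= p < K | p < d.+1) F p)).
  rewrite big_mkcond [leqRHS]big_mkcond /=; apply: leq_prod => p _.
  by rewrite !ltnS; case: (p <= d) => //=; case: ifP.
rewrite -(big_nat_widen _ _ _ predT) ?leq_addl// big_nat_recl// {1}/F exp1n mul1n.
rewrite fact_prod big_add1 /=.
rewrite (big_morph (fun x => x ^ n) (fun x y => expnMn x y n) (exp1n n)).
by apply: leq_prod => p _; rewrite /F (maxn_idPl _).
Qed.

(** The factors of n! beyond 2B exceed 2B, and the spare powers of 2 absorb the constants. *)
Lemma fact_gt_exp B N : exists n0, forall n, n0 <= n -> N * B ^ n.+1 < n`!.
Proof.
have [->|B0] := posnP B.
  by exists 0 => n _; rewrite exp0n// muln0 fact_gt0.
pose b := (2 * B).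
have low n : b <= n -> b ^ (n - b) <= n`!.
  elim: n => [|n IH]; first by rewrite leqn0 => /eqP ->; rewrite subnn.
  rewrite leq_eqVlt => /orP[/eqP ->|bn].
    by rewrite subnn expn0 fact_gt0.
  by rewrite subSn// expnS factS leq_mul// ?IH// ltnW.
exists (b + N * B ^ b.+1) => n hn.
have bn : b <= n by apply: leq_trans hn; exact: leq_addr.
apply: leq_trans (low _ bn); rewrite /b expnMn -/b.
rewrite -{1}(subnKC bn) -addSn expnD mulnA ltn_pmul2r ?expn_gt0 ?B0//.
by apply: leq_ltn_trans (ltn_expl _ (isT : 1 < 2)); rewrite leq_subRL.
Qed.
End Numbers.

Section Isometries.
Variables (d : nat) (hd : 1 < d).
Local Notation C := (stream d).
Implicit Types (I J : finType).

Lemma isom_iter (a : C -> C) n : isom a -> isom (iter n a).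
Proof.
move=> ia; elim: n => [|n IH]; first exact: isom_id.
exact: (isom_comp ia IH).
Qed.

(** The inverses converge as well, and their limit inverts the limit. A limit reads its letter [n]
    from the term of index [n.+1], where this letter has become stable. *)
Lemma isom_limit (c : nat -> C -> C) : (forall l, isom (c l)) ->
  (forall l x, agree l (c l x) (c l.+1 x)) ->
  exists a, isom a /\ forall l x, agree l (c l x) (a x).
Proof.
move=> ic cc.
have lim (e : nat -> C -> C) : (forall l x, agree l (e l x) (e l.+1 x)) ->
    forall l x, agree l (e l x) (fun n => e n.+1 x n).
  move=> ee; have le l k x : agree l (e l x) (e (l + k) x).
    elim: k => [|k IH]; rewrite ?addn0// addnS; apply: agree_trans IH _.
    by apply: (@agree_le _ _ (l + k)); [exact: leq_addr|exact: ee].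
  by move=> l x i il; rewrite -(subnKC il) -le.
have /choice[c' c'P] l : exists b, [/\ isom b, cancel (c l) b & cancel b (c l)].
  exact: isom_inv.
have cc' l x : agree l (c' l x) (c' l.+1 x).
  have [ib _ k] := c'P l; have [_ _ k'] := c'P l.+1.
  by apply/(isom_agree l _ _ (ic l)); rewrite k -{1}(k' x); exact/agree_sym/cc.
have la := lim _ cc; have lb := lim _ cc'.
have nonex (e : nat -> C -> C) (ie : forall l, isom (e l)) (a : C -> C) :
    (forall l x, agree l (e l x) (a x)) -> nonexp a.
  move=> ea n x y xy; apply: agree_trans (ea n y).
  by apply: (agree_trans (agree_sym (ea n x))); exact: (isom_nonexp (ie n)).
have ic' l : isom (c' l) by case: (c'P l).
exists (fun x n => c n.+1 x n); split=> //.
exists (fun x n => c' n.+1 x n); split.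
- move=> x; apply: agree_all => n; apply: agree_sym.
  have [_ k _] := c'P n; rewrite -{1}(k x); apply: agree_trans (lb n _).
  by apply/(isom_agree _ _ _ (ic' n)); exact: la.
- move=> x; apply: agree_all => n; apply: agree_sym.
  have [_ _ k] := c'P n; rewrite -{1}(k x); apply: agree_trans (la n _).
  by apply/(isom_agree _ _ _ (ic n)); exact: lb.
- exact: (nonex c ic _ la).
- exact: (nonex c' ic' _ lb).
Qed.

(** Once a power fixes all prefixes of length [l], it permutes the d letters that may follow such a
    prefix, and the exponent d! trivializes this permutation. Each level costs one factor d!. *)
Lemma isom_exponent (a : C -> C) l x : isom a -> agree l x (iter (d`! ^ l) a x).
Proof.
move=> ia; elim: l x => [//|l IH] x.
rewrite expnS iterM; set b := iter _ a in IH *.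
have ib : isom b by exact: isom_iter.
pose y i := scat (mkseq x l) (fun=> i).
pose s i := b (y i) l.
have agS n (u v : C) : agree n u v -> u n = v n -> agree n.+1 u v.
  by move=> uv e i; rewrite ltnS leq_eqVlt => /orP[/eqP ->|/uv].
have bs z : agree l x z -> b z l = s (z l).
  move=> xz; have : agree l.+1 (b z) (b (y (z l))).
    apply/(isom_agree _ _ _ ib); apply: agS.
      exact: agree_trans (agree_sym xz) (agree_mkseq hd _ _).
    by rewrite /y /scat nth_default ?size_mkseq// subnn.
  exact.
have ys i : y i l = i by rewrite /y /scat nth_default ?size_mkseq.
have s_inj : injective s.
  move=> i j e; have : agree l.+1 (b (y i)) (b (y j)).
    apply: agS => //; apply/(isom_agree _ _ _ ib).
    exact: agree_trans (agree_sym (agree_mkseq hd _ _)) (agree_mkseq hd _ _).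
  by move=> /(isom_agree _ _ _ ib)/(_ l (ltnSn l)); rewrite !ys.
pose p := perm s_inj.
have it n : agree l x (iter n b x) /\ iter n b x l = (p ^+ n)%g (x l).
  elim: n => [|n [h1 h2]]; first by rewrite expg0 perm1.
  split; first exact: agree_trans h1 (IH _).
  by rewrite /= bs// h2 expgSr permM [in RHS]permE.
have [h1 h2] := it d`!; apply: agS => //; rewrite h2.
suff -> : (p ^+ d`! = 1)%g by rewrite perm1.
by apply/eqP; rewrite -order_dvdn -card_Sn -cardsT; apply: order_dvdG; rewrite inE.
Qed.

Lemma agree_isom_scat (a : C -> C) w : isom a -> (forall x, agree (size w) x (a x)) ->
  exists2 a', isom a' & forall x, a (scat w x) = scat w (a' x).
Proof.
move=> ia aw; have [u [a' [su ia' e]]] := isom_scat hd w ia; exists a' => // x.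
rewrite e; have := aw (scat w x); rewrite e => /(agreeP hd).
by rewrite scatK// -{1}su scatK// => ->.
Qed.

Definition piso I m (a : I -> C -> C) := forall i, isom (a i) /\ forall x, agree m x (a i x).

(* the isometries fixing the m-balls are a basis of neighbourhoods of 1 that is
   independent of the frame *)
Lemma piso_conj I J (f : I * C -> J * C) m : hom f -> exists n, forall a, piso n a ->
  exists2 b, piso m b & f \o pw id a = pw id b \o f.
Proof.
(* On balls of depth [M] the map [f] is a similarity; the [m] further letters that the isometry
   fixes survive the transport. *)
move=> [f' [ff' f'f [M fM] lf']]; exists (M + m) => a aP.
have loc (c : I -> C -> C) : piso (M + m) c -> forall j y, exists v y' e,
    [/\ isom e, y = scat v y', forall z, agree m z (e z) &
      forall z, f (pw id c (f' (j, scat v z))) = (j, scat v (e z))].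
  move=> cP j y; case E : (f' (j, y)) => [i x].
  have sw : size (mkseq x M) = M by rewrite size_mkseq.
  have [j' [v [b [ib e]]]] := fM i _ (eq_leq (esym sw)).
  have ex := scat_mkseq hd M x.
  have [|a' ia' ea] := @agree_isom_scat (c i) (mkseq x M) (cP i).1.
    by move=> z; rewrite sw; apply: agree_le (leq_addr _ _) _; exact: (cP i).2.
  have [b' [ib' bb' b'b]] := isom_inv ib.
  have [ej ey] : j = j' /\ y = scat v (b (sdrop M x)).
    by have := e (sdrop M x); rewrite ex -E f'f => -[-> ->].
  exists v, (b (sdrop M x)), (b \o a' \o b'); split=> //.
  - by apply: isom_comp ib'; exact: isom_comp.
  - move=> z /=; rewrite -{1}(b'b z); apply/(isom_agree _ _ _ ib).
    apply/(@agree_scat _ hd (mkseq x M)); rewrite sw -ea; exact: (cP i).2.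
  - move=> z; rewrite -{1}(b'b z) {1}ej -e ff' /pw /= ea e ej.
    by [].
have fst_id a' : piso (M + m) a' -> forall j y, (f (pw id a' (f' (j, y)))).1 = j.
  by move=> a'P j y; have [v [y' [e [_ -> _ ->]]]] := loc _ a'P j y.
pose b a' j y := (f (pw id a' (f' (j, y)))).2.
have bE a' : piso (M + m) a' -> forall j y, f (pw id a' (f' (j, y))) = (j, b a' j y).
  by move=> a'P j y; rewrite -{2}(fst_id _ a'P j y) /b; case: (f _).
have bm a' : piso (M + m) a' -> forall j y, agree m y (b a' j y).
  move=> a'P j y; have [v [y' [e [ie -> em eE]]]] := loc _ a'P j y.
  rewrite /b eE /=; apply: agree_le (leq_addl (size v) _) _.
  exact/agree_scat.
have bne a' : piso (M + m) a' -> forall j, nonexp (b a' j).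
  move=> a'P j n y1 y2 y12.
  have [v1 [y1' [e1 [ie1 E1 em1 eE1]]]] := loc _ a'P j y1.
  have [v2 [y2' [e2 [ie2 E2 em2 eE2]]]] := loc _ a'P j y2.
  have go v z1 z2 e (ie : isom e)
      (eE : forall z, f (pw id a' (f' (j, scat v z))) = (j, scat v (e z))) :
      agree n (scat v z1) z2 -> size v <= n ->
      agree n (b a' j (scat v z1)) (b a' j z2).
    move=> zz vn; have E : z2 = scat v (sdrop (size v) z2).
      rewrite -{1}(scat_mkseq hd (size v) z2); congr scat.
      have /(agreeP hd) <- := agree_le vn zz; exact: scatK.
    rewrite E /b !eE /= -(subnKC vn); apply/agree_scat => //.
    apply/(isom_agree _ _ _ ie); apply/(@agree_scat _ hd v).
    by rewrite -E subnKC.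
  have [h1|h1] := leqP (size v1) n; first by rewrite E1; apply: go eE1 _ h1; rewrite -?E1.
  have [h2|h2] := leqP (size v2) n.
    by apply: agree_sym; rewrite E2; apply: go eE2 _ h2; rewrite -?E2//; exact: agree_sym.
  have near v z e (eE : forall z, f (pw id a' (f' (j, scat v z))) = (j, scat v (e z))) :
      n < size v -> agree n (scat v z) (b a' j (scat v z)).
    move=> nv; rewrite /b eE /=; apply: agree_le (ltnW nv) _; exact: agree_scatl.
  rewrite E1 E2 in y12 *.
  apply: agree_trans (near _ _ _ eE2 h2).
  exact: agree_trans (agree_sym (near _ _ _ eE1 h1)) y12.
have /choice[a' a'P] i : exists b, [/\ isom b, cancel (a i) b & cancel b (a i)].
  by apply: isom_inv; case: (aP i).
have a'm : piso (M + m) a'.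
  move=> i; have [i1 i2 i3] := a'P i; split=> // x.
  by rewrite -{1}(i3 x); apply: agree_sym; exact: (aP i).2.
have bK c c' : piso (M + m) c -> piso (M + m) c' -> (forall i, cancel (c i) (c' i)) ->
    forall j, cancel (b c j) (b c' j).
  move=> cP c'P cc' j y; have := bE _ c'P j (b c j y).
  rewrite -bE// ff'; case E : (f' (j, y)) => [i x].
  by rewrite /pw /= cc' -E f'f => -[].
exists (b a).
  move=> j; split; last exact: bm.
  exists (b a' j); split; [| | exact: bne | exact: bne].
    by apply: bK => // i; case: (a'P i).
  by apply: bK => // i; case: (a'P i).
apply/funext => -[i x]; rewrite /= -{1}(ff' (i, x)); case: (f (i, x)) => j y.
by rewrite bE.
Qed.

End Isometries.

(** * Frames and double cosets *)

Section Frames.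
Variables (d : nat) (hd : 1 < d) (I0 : finType).
Local Notation C := (stream d).
Local Notation P := (I0 * C)%type.
Implicit Types (I J K : finType) (HH : (P -> P) -> Prop).

Definition chart I (T : Type) (f : I * C -> T) i : C -> T := fun x => f (i, x).

Record homgroup HH : Prop := HomGroup {
  hg_hom : forall h, HH h -> hom h ;
  hg1 : HH id ;
  hgM : forall g h, HH g -> HH h -> HH (g \o h) ;
  hgV : forall h, HH h -> exists2 g, HH g & cancel h g /\ cancel g h }.

(** The maps [pw id a] with [piso m a] shrink to the identity as [m] grows, so the premise places
    [g] in the closure of [HH]. *)
Definition homclosed HH := forall g, hom g ->
  (forall m, exists2 h, HH h & exists2 a, piso m a & g = h \o pw id a) -> HH g.

(* HH \ G / U is finite, where U is the open subgroup of isometries *)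
Definition homcocompact HH := exists N (r : 'I_N -> P -> P),
  (forall i, hom (r i)) /\ forall g, hom g -> exists i h a,
    [/\ HH h, piso 0 a & g = h \o r i \o pw id a].

Lemma hg_iter HH h n : homgroup HH -> HH h -> HH (iter n h).
Proof.
move=> gH hh; elim: n => [|n IH]; first exact: (hg1 gH).
exact: (hgM gH hh IH).
Qed.

(** By [piso_conj] small isometries of a frame are small isometries of [P], up to a change of depth,
    so limits may be computed in the most convenient frame. *)
Lemma homclosed_frame HH I (f : I * C -> P) g : homgroup HH -> homclosed HH ->
  hom f -> hom g ->
  (forall m, exists2 h, HH h & exists2 a, piso m a & g \o f = h \o f \o pw id a) ->
  HH g.
Proof.
move=> gH cH hf hg gf; apply: cH => // m.
have [n nP] := piso_conj hd m hf.
have [h hh [a aP e]] := gf n; have [b bP fb] := nP a aP.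
exists h => //; exists b => //.
have [f' [_ _ ff']] := hom_inv hf.
apply/funext => p; have := congr1 (fun g => g (f' p)) e.
have := congr1 (fun g => g (f' p)) fb.
by rewrite /= ff' => -> ->.
Qed.

Definition moves T (h : T -> T) (b b' : C -> T) := sim (h \o b) b'.

Lemma moves_id T (b : C -> T) : moves id b b. Proof. exact: sim_refl. Qed.

Lemma moves_comp T (g h : T -> T) b1 b2 b3 :
  moves h b1 b2 -> moves g b2 b3 -> moves (g \o h) b1 b3.
Proof. by move=> /(sim_comp g) h1 h2; exact: sim_trans h1 h2. Qed.

Lemma moves_inv T (g h : T -> T) b1 b2 : cancel h g -> moves h b1 b2 -> moves g b2 b1.
Proof.
move=> hg /(sim_comp g)/sim_sym; rewrite /moves.
suff -> : g \o (h \o b1) = b1 by [].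
by apply/funext => x /=.
Qed.

Lemma moves_img T (h : T -> T) b b' p : moves h b b' -> img b p -> img b' (h p).
Proof. by move=> [a _ e] [x <-]; exists (a x); have := congr1 (@^~ x) e. Qed.

Lemma moves_pw I (f : I * C -> P) h (s : I -> I) :
  (forall i, moves h (chart f i) (chart f (s i))) ->
  exists2 a, (forall i, isom (a i)) & h \o f = f \o pw s a.
Proof.
move=> m; have /choice[a aP] i : exists a, isom a /\ h \o chart f i = chart f (s i) \o a.
  by have [a ia e] := m i; exists a.
exists a; first by move=> i; case: (aP i).
by apply/funext => -[i x]; have [_ /(congr1 (@^~ x))] := aP i.
Qed.

Lemma pw_moves I (f : I * C -> P) h (s : I -> I) a :
  (forall i, isom (a i)) -> h \o f = f \o pw s a ->
  forall i, moves h (chart f i) (chart f (s i)).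
Proof.
move=> ia e i; exists (a i) => //; apply/funext => x.
by have := congr1 (@^~ (i, x)) e.
Qed.

Section Split.
Variable A : finType.

Definition split_code (j : 'I_d + A) : (unit + A) * seq 'I_d :=
  match j with inl u => (inl tt, [:: u]) | inr a => (inr a, [::]) end.
Definition split_map := cmap split_code.

Lemma hom_split : hom split_map.
Proof.
apply: (hom_cmap hd).
exists (fun p : (unit + A) * C => match p.1 with
  | inl _ => (inl (p.2 0), sdrop 1 p.2) | inr a => (inr a, p.2) end).
  move=> [[u|a] x]; rewrite /cmap /=; last by rewrite scat0.
  by rewrite -[1]/(size [:: u]) sdrop_scat.
move=> [[[]|a] x]; rewrite /cmap /=; last by rewrite scat0.
congr (_, _); rewrite -[in RHS](scat_mkseq hd 1 x).
by [].
Qed.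

End Split.

(* The exponential bound: an isometry meets each of the m splits of a piece
   through one of d! permutations. *)
Lemma frames_few HH : homgroup HH -> homcocompact HH -> 0 < #|I0| ->
  exists N, forall m I, #|I| = #|I0| + m * d.-1 ->
  exists (T : finType) (L : T -> I * C -> P), #|T| <= N * d`! ^ m /\
    forall f : I * C -> P, hom f -> exists t h a,
      [/\ HH h, piso 0 a & f = h \o L t \o pw id a].
Proof.
move=> gH [N [r [hr rP]]] i0; exists N; elim=> [|m IH] I cI.
  have [s bs] : exists s : I -> I0, bijective s.
    by apply: hom_eq_card; rewrite cI addn0.
  exists 'I_N, (fun i => r i \o relab s); split.
    by rewrite card_ord muln1.
  have [t st ts] := bs; move=> f hf.
  have ht : hom (relab (d := d) t) by apply: (hom_relab hd); exists s.
  have [i [h [a [hh aP e]]]] := rP _ (hom_comp hd ht hf).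
  exists i, h, (fun j => a (s j)); split=> //.
  apply/funext => -[j x]; have := congr1 (@^~ (s j, x)) e.
  by rewrite /relab /= st.
(* A frame with [m.+1] cuts arises from one with [m] cuts by cutting one piece; [A] indexes the
   other pieces of the latter. *)
pose A : finType := 'I_(#|I0| + m * d.-1).-1.
have cA : #|{: unit + A}| = #|I0| + m * d.-1.
  by rewrite card_sum card_unit card_ord add1n prednK// ltn_addr.
have [T [L [cT LP]]] := IH (unit + A : finType)%type cA.
have [s bs] : exists s : I -> ('I_d + A)%type, bijective s.
  apply: hom_eq_card; rewrite card_sum card_ord.
  have -> : #|A| = (#|I0| + m * d.-1).-1 by rewrite card_ord.
  rewrite cI mulSn addnCA; have X0 : 0 < #|I0| + m * d.-1 by rewrite ltn_addr.
  by rewrite -{1}(prednK X0) addnS -addSn (ltn_predK hd).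
have [t st ts] := bs; have hs := hom_relab hd bs.
have ht : hom (relab (d := d) t) by apply: (hom_relab hd); exists s.
have [q [hq sq qs]] := hom_inv (hom_split A).
pose R (p : {perm 'I_d}) (j : 'I_d + A) : 'I_d + A :=
  match j with inl u => inl (p u) | inr a => inr a end.
exists (T * {perm 'I_d})%type,
  (fun tp => L tp.1 \o split_map (A := A) \o relab (R tp.2) \o relab s).
split.
  by rewrite card_prod card_Sn expnS mulnCA mulnC leq_mul2l cT orbT.
move=> f hf.
have [t0 [h [a [hh aP e]]]] := LP _ (hom_comp hd hq (hom_comp hd ht hf)).
(* the isometry [a] of the split piece permutes its children *)
have /choice[e1 e1P] u : exists v, exists2 a', isom a' &
    forall x, a (inl tt) (scat [:: u] x) = scat [:: v] (a' x).
  have [w [a' [sw ia' E]]] := isom_scat hd [:: u] (aP (inl tt)).1.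
  by case: w sw E => [//|v [|//]] _ E; exists v, a'.
have e1_inj : injective e1.
  move=> u v uv; have [a' ia' E] := e1P u; have [a2 ia2 E2] := e1P v.
  have [b' [_ _ k]] := isom_inv ia'; have [b2 [_ _ k2]] := isom_inv ia2.
  have : a (inl tt) (scat [:: u] (b' (stream0 hd))) =
         a (inl tt) (scat [:: v] (b2 (stream0 hd))).
    by rewrite E E2 k k2 uv.
  by move=> /(isom_inj (aP _).1) /(scat_inj hd)[]// [].
have /choice[b bP] u : exists a', isom a' /\
    forall x, a (inl tt) (scat [:: u] x) = scat [:: e1 u] (a' x).
  by have [a' ? ?] := e1P u; exists a'.
pose c (j : 'I_d + A) := match j with inl u => b u | inr x => a (inr x) end.
exists (t0, perm e1_inj), h, (fun i => c (s i)); split=> //.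
  move=> i; split=> //; case: (s i) => [u|x] /=; first by case: (bP u).
  by case: (aP (inr x)).
apply/funext => -[i x]; have := congr1 (@^~ (split_map (s i, x))) e.
rewrite /= sq /relab /= st => ->; congr (h (L t0 _)).
rewrite /split_map /cmap /pw /=; case: (s i) => [u|y] /=; last by rewrite !scat0.
by rewrite permE; case: (bP u) => _ ->.
Qed.

Definition realized HH I (f : I * C -> P) (s : I -> I) :=
  exists2 h, HH h & forall i, moves h (chart f i) (chart f (s i)).

Lemma large_stabilizer HH : homgroup HH -> homcocompact HH -> 0 < #|I0| ->
  exists n, [/\ 1 < n, n = #|I0| %[mod d.-1] &
    forall I (f : I * C -> P), hom f -> #|I| = n -> forall i0 : I,
    exists p (s : {perm I}),
      [/\ prime p, d < p, #[s]%g = p, s i0 = i0 & realized HH f s]].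
Proof.
(* In the base d! * d! of the exponential, one factor d! stands for the number of classes, the other
   for the order of a group without prime divisors above [d]. *)
move=> gH fH I0pos; have [N NP] := frames_few gH fH I0pos.
have [n1 n1P] := fact_gt_exp (d`! * d`!) N.
pose m := n1.+2; pose n := #|I0| + m * d.-1.
have d0 : 0 < d.-1 by rewrite -subn1 subn_gt0.
have mn : m <= n by apply: leq_trans (leq_addl _ _); rewrite leq_pmulr.
exists n; split; first exact: leq_trans mn.
  by rewrite /n addnC modnMDl.
move=> I f hf cI i0; have [T [L [cT LP]]] := NP _ _ cI.
have hpw (s : {perm I}) : hom (f \o pw s (fun=> @id C)).
  apply: (hom_comp hd _ hf); apply: (hom_pw hd); first exact: injF_bij perm_inj.
  by move=> i; exact: isom_id.
have /choice[t tP] (s : {perm I}) := LP _ (hpw s).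
have rM (s s' : {perm I}) : realized HH f s -> realized HH f s' ->
    realized HH f (s * s')%g.
  move=> [h hh hm] [h' hh' hm']; exists (h' \o h); first exact: (hgM gH).
  by move=> i; rewrite permM; apply: moves_comp (hm i) (hm' _).
have tE (s s' : {perm I}) : t s = t s' -> realized HH f (s^-1 * s')%g.
  have [h [a [hh aP e]]] := tP s; have [h' [a' [hh' aP' e']]] := tP s'.
  move=> E; have [g hg [gh _]] := hgV gH hh; exists (h' \o g); first exact: (hgM gH).
  have m1 i : moves h (fun x => L (t s) (i, x)) (chart f (s i)).
    have [b [ib ab ba]] := isom_inv (aP i).1; exists b => //.
    apply/funext => x; have := congr1 (@^~ (i, b x)) e.
    by rewrite /pw /= ba => <-.
  have m2 i : moves h' (fun x => L (t s) (i, x)) (chart f (s' i)).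
    have [b [ib ab ba]] := isom_inv (aP' i).1; exists b => //.
    apply/funext => x; have := congr1 (@^~ (i, b x)) e'.
    by rewrite /pw /= ba E => <-.
  move=> i; rewrite permM; set j := (s^-1)%g i.
  have -> : i = s j by rewrite /j permKV.
  exact: moves_comp (moves_inv gh (m1 _)) (m2 _).
pose S := [set s : {perm I} | perm_on [set~ i0] s].
pose Q := [set s : {perm I} | `[< realized HH f s >] && (s i0 == i0)].
have gQ : group_set Q.
  apply/group_setP; split.
    rewrite inE perm1 eqxx andbT; apply/asboolP; exists id; first exact: (hg1 gH).
    by move=> i; rewrite perm1; exact: moves_id.
  move=> s s'; rewrite !inE => /andP[/asboolP rs /eqP es] /andP[/asboolP rs' /eqP es'].
  by rewrite permM es es' eqxx andbT; apply/asboolP; exact: rM.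
have SP s : (s \in S) = (s i0 == i0).
  rewrite inE; apply/idP/eqP => [/out_perm->//|si]; first by rewrite !inE eqxx.
  by apply/fintype.subsetP => i; rewrite !inE; apply: contraNneq => ->; rewrite si.
have cS : #|S| = n.-1`!.
  by rewrite /S cardsE card_perm cardsC1 cI.
have leS : #|S| <= #|T| * #|Q|.
  pose rep u := odflt 1%g [pick s | (s \in S) && (t s == u)].
  have repP s : s \in S -> rep (t s) \in S /\ t (rep (t s)) = t s.
    move=> sS; rewrite /rep; case: pickP => [s' /andP[? /eqP//]|/(_ s)].
    by rewrite sS eqxx.
  pose F s := (t s, ((rep (t s))^-1 * s)%g).
  have F_inj : {in S &, injective F}.
    by move=> s s' _ _ [-> /mulgI].
  rewrite -(card_in_imset F_inj) -cardsT -cardsX; apply: subset_leq_card.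
  apply/fintype.subsetP => _ /imsetP[s sS ->]; have [r1 r2] := repP s sS.
  rewrite !inE /=; apply/andP; split; first by apply/asboolP; exact: tE.
  move: r1 sS; rewrite !SP => /eqP r1 /eqP ss.
  by rewrite permM -{1}r1 permK ss.
have [p pp [pQ dp]] : exists2 p, prime p & p %| #|Q| /\ d < p.
  apply: contrapT => np; suff : #|Q| <= d`! ^ n.
    move=> leQ; have : n.-1`! <= N * (d`! * d`!) ^ n.
      rewrite -cS; apply: leq_trans leS _; rewrite expnMn mulnA.
      apply: leq_mul => //; apply: leq_trans cT _; rewrite leq_mul2l leq_pexp2l ?orbT//.
      exact: fact_gt0.
    have -> : n = n.-1.+1 by rewrite prednK// (leq_trans _ mn).
    rewrite leqNgt n1P// -ltnS prednK; last exact: leq_trans mn.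
    by apply: leq_trans mn.
  apply: smooth_dvd_fact.
  - by rewrite (cardG_gt0 (Group gQ)).
  - have /cardSg : Group gQ \subset [set: {perm I}]%G by exact: finset.subsetT.
    have := card_perm [set: I]; rewrite cardsT cI => <-.
    suff -> : #|perm_on [set: I]| = #|[set: {perm I}]%G| by [].
    by rewrite cardsT; apply: eq_card => s; rewrite !inE; apply/fintype.subsetP.
  - move=> p pp pQ; rewrite leqNgt; apply/negP => dp; apply: np; exists p => //.
have [s sQ os] := @Cauchy _ p (Group gQ) pp pQ.
exists p, s; move: sQ; rewrite inE => /andP[/asboolP rs /eqP si].
by split.
Qed.

End Frames.

(** * From approximate to exact permutations *)

Section Exact.
Variables (d : nat) (hd : 1 < d) (I0 : finType).
Local Notation C := (stream d).
Local Notation P := (I0 * C)%type.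
Implicit Types (I J K : finType).
Variable HH : (P -> P) -> Prop.
Hypotheses (gH : homgroup HH) (cH : homclosed HH).

Lemma iter_pw I (s : {perm I}) (a : I -> C -> C) : (forall i, isom (a i)) ->
  forall n, exists2 b, (forall i, isom (b i)) & iter n (pw s a) =1 pw (s ^+ n)%g b.
Proof.
move=> ia; elim=> [|n [b ib e]].
  exists (fun=> id); first by move=> i; exact: isom_id.
  by move=> [i x]; rewrite /pw /= expg0 perm1.
exists (fun i => a ((s ^+ n)%g i) \o b i); first by move=> i; exact: isom_comp.
by move=> [i x]; rewrite iterS e /pw /= expgSr permM.
Qed.

Lemma iter_agree (b : C -> C) l n x : (forall x, agree l x (b x)) ->
  agree l x (iter n b x).
Proof. by move=> h; elim: n => [//|n IH]; exact: agree_trans IH (h _). Qed.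

(* The powers h^(d!^(l(p-1))) converge: they all permute the pieces as s does,
   and they become trivial on the pieces that s fixes. *)
Lemma exact_permutation I (f : I * C -> P) p (s : {perm I}) :
  hom f -> prime p -> d < p -> #[s]%g = p -> realized HH f s ->
  exists2 h, HH h & (forall i, moves h (chart f i) (chart f (s i))) /\
    forall i x, s i = i -> h (f (i, x)) = f (i, x).
Proof.
move=> hf pp dp os [h0 hh0 /moves_pw[a ia e0]].
(* By Fermat [E l] is 1 modulo p, so the power of [w] still permutes the pieces by [s]. It is also a
   multiple of d!^l, which makes this power trivial to depth [l] on the pieces that [s] fixes. *)
set w := pw s a in e0; pose A := d`!; pose E l := A ^ (l * p.-1).
have p1 : 0 < p.-1 by rewrite -subn1 subn_gt0 prime_gt1.
have pA : coprime A p.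
  rewrite coprime_sym prime_coprime// /A; apply/negP => pd.
  have := logn_gt0 p d`!; rewrite mem_primes pp fact_gt0 pd /=.
  rewrite logn_fact// big1_seq// => i /andP[_]; rewrite mem_index_iota => /andP[i1 _].
  by apply: divn_small; apply: leq_trans dp _; rewrite -{1}[p]expn1 leq_exp2l ?prime_gt1.
have Ap1 l : A ^ (l * p.-1) = 1 %[mod p].
  rewrite mulnC expnM -modnXm -totient_prime// Euler_exp_totient// modnXm.
  by rewrite exp1n.
have Edvd l : exists e, E l = A ^ l * e.
  by exists (A ^ (l * p.-1 - l)); rewrite -expnD subnKC// leq_pmulr.
have EsE l : (s ^+ E l = s)%g.
  by rewrite -(expg_mod _ (expg_order s)) os Ap1 modn_small ?prime_gt1// expg1.
(* Consecutive exponents differ by d!^l times a multiple [M] of p. The factor between the two powers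
   therefore keeps every piece and acts there as a d!^l-th power of an isometry, trivially to depth
   [l]. *)
have ES l : exists M, E l.+1 = E l + A ^ l * M /\ (s ^+ M = 1)%g.
  have [e Ee] := Edvd l.
  have /eqP : A ^ p.-1 = 1 %[mod p] by have := Ap1 1; rewrite mul1n.
  rewrite eqn_mod_dvd ?expn_gt0 ?fact_gt0// => /dvdnP[q Eq].
  exists (e * (q * p)); split; last by rewrite mulnA mulnC -{1}os expgM expg_order expg1n.
  rewrite mulnA -Ee -Eq mulnBr muln1 subnKC; last first.
    by rewrite leq_pmulr// expn_gt0 fact_gt0.
  by rewrite /E mulSn expnD mulnC.
have hw n i x : iter n h0 (f (i, x)) = f (iter n w (i, x)).
  by elim: n => //= n ->; have := congr1 (@^~ (iter n w (i, x))) e0.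
have /choice[c cP] l : exists c, (forall i, isom (c i)) /\ iter (E l) w =1 pw s c.
  have [c ic ec] := iter_pw s ia (E l); exists c; split=> // p0.
  by rewrite ec EsE.
have cc i l x : agree l (c l i x) (c l.+1 i x).
  have [M [EM sM]] := ES l; have [b ib bE] := iter_pw s ia M.
  have ipw n y : iter n (iter M w) (i, y) = (i, iter n (b i) y).
    by elim: n => //= n ->; rewrite bE /pw /= sM perm1.
  have : iter (E l.+1) w (i, x) = (s i, c l i (iter (A ^ l) (b i) x)).
    by rewrite EM iterD (iterM (A ^ l) M w) ipw; have [_ ->] := cP l.
  have [_ ->] := cP l.+1; rewrite /pw /= => -[->].
  by apply/(isom_agree _ _ _ ((cP l).1 i)); exact: isom_exponent.
have /choice[b bP] i : exists b, isom b /\ forall l x, agree l (c l i x) (b x).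
  by apply: isom_limit (cc i) => l; exact: (cP l).1.
have [f' [hf' ff' f'f]] := hom_inv hf.
have hb : hom (pw s b).
  by apply: (hom_pw hd); [exact: injF_bij perm_inj|move=> i; case: (bP i)].
pose g := f \o (pw s b \o f').
have gf : g \o f = f \o pw s b by apply/funext => q; rewrite /g /= ff'.
have hg : hom g by apply: (hom_comp hd _ hf); exact: hom_comp hf' hb.
exists g.
  apply: (homclosed_frame hd gH cH hf hg) => m; exists (iter (E m) h0).
    exact: hg_iter.
  have /choice[c' c'P] i : exists c', [/\ isom c', cancel (c m i) c' & cancel c' (c m i)].
    by apply: isom_inv; exact: (cP m).1.
  exists (fun i => c' i \o b i).
    move=> i; have [i1 i2 i3] := c'P i; have [i4 i5] := bP i.
    split; first exact: isom_comp.
    move=> x; rewrite -{1}(i2 x); apply/(isom_agree _ _ _ i1); exact: i5.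
  rewrite gf; apply/funext => -[i x]; rewrite /= hw; have [_ ->] := cP m.
  by rewrite /pw /=; have [_ _ ->] := c'P i.
split.
  by apply: pw_moves gf => i; case: (bP i).
move=> i x si; have -> : g (f (i, x)) = f (s i, b i x).
  by have := congr1 (@^~ (i, x)) gf.
rewrite si; congr (f (_, _)); apply: agree_all => l; apply: agree_sym.
apply: agree_trans ((bP i).2 l x).
have [e Ee] := Edvd l.
have -> : c l i x = iter e (iter (A ^ l) (a i)) x.
  have /= := (cP l).2 (i, x); rewrite /pw /= si => h.
  have : iter (E l) w (i, x) = (i, iter (E l) (a i) x).
    by elim: (E l) => //= n ->; rewrite /w /pw /= si.
  by rewrite h => -[->]; rewrite Ee mulnC iterM.
by apply: iter_agree => y; exact: isom_exponent.
Qed.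

End Exact.

(** * Realized 3-cycles *)

Section SumMap.
Variables (d : nat) (hd : 1 < d).
Local Notation C := (stream d).

Definition sum_map (A A' B B' : finType) (f : A * C -> A' * C) (g : B * C -> B' * C) :
    (A + B) * C -> (A' + B') * C :=
  fun p => match p.1 with
  | inl i => let q := f (i, p.2) in (inl q.1, q.2)
  | inr i => let q := g (i, p.2) in (inr q.1, q.2)
  end.

Lemma hom_sum (A A' B B' : finType) (f : A * C -> A' * C) (g : B * C -> B' * C) :
  hom f -> hom g -> hom (sum_map f g).
Proof.
have ls_sum (E E' F F' : finType) (u : E * C -> E' * C) (v : F * C -> F' * C) :
    ls u -> ls v -> ls (sum_map u v).
  move=> [m um] [n vn]; exists (maxn m n); apply: (lsm_eq hd) => -[i|i] w sw.
    have [|j [t [a [ia e]]]] := um i w; first by rewrite sw leq_maxl.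
    by exists (inl j), t, a; split=> // x; rewrite /sum_map /= e.
  have [|j [t [a [ia e]]]] := vn i w; first by rewrite sw leq_maxr.
  by exists (inr j), t, a; split=> // x; rewrite /sum_map /= e.
move=> [f' [h1 h2 h3 h4]] [g' [k1 k2 k3 k4]]; exists (sum_map f' g'); split.
- by move=> [[i|i] x]; rewrite /sum_map /= -surjective_pairing ?h1 ?k1.
- by move=> [[i|i] x]; rewrite /sum_map /= -surjective_pairing ?h2 ?k2.
- exact: ls_sum.
- exact: ls_sum.
Qed.

End SumMap.

Section Cycles.
Variables (d : nat) (hd : 1 < d) (I0 : finType) (I0pos : 0 < #|I0|).
Local Notation C := (stream d).
Local Notation P := (I0 * C)%type.
Implicit Types (I J K : finType).
Variable HH : (P -> P) -> Prop.
Hypotheses (gH : homgroup HH) (cH : homclosed HH) (fH : homcocompact HH).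

Definition frame I (f : I * C -> P) := hom f /\ #|I| = #|I0| %[mod d.-1].

Definition dis (b b' : C -> P) := forall p, img b p -> ~ img b' p.

Lemma hom_dis I (f : I * C -> P) i j : hom f -> i != j -> dis (chart f i) (chart f j).
Proof.
move=> hf ij p [x <-] [y]; rewrite /chart => /(hom_inj hf)[e _].
by rewrite e eqxx in ij.
Qed.

(* Merging all the pieces outside the s0 chosen ones into a single ball leaves a
   frame of the size to which [large_stabilizer] applies. *)
Lemma local_permutation : exists2 s0, 0 < s0 & forall I (f : I * C -> P)
  (u : 'I_s0 -> I), frame f -> injective u -> s0 < #|I| ->
  exists s : {perm 'I_s0}, (exists j, s j != j) /\ exists2 h, HH h &
    (forall j, moves h (chart f (u j)) (chart f (u (s j)))) /\
    forall i x, i \notin codom u -> h (f (i, x)) = f (i, x).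
Proof.
have [n [n1 nI0 nP]] := large_stabilizer hd gH fH I0pos.
exists n.-1; first by rewrite -subn1 subn_gt0.
move=> I f u [hf cI] u_inj ltI.
pose K : finType := {i : I | i \notin codom u}.
have cK : #|K| = #|I| - n.-1.
  have cc : #|codom u| = n.-1 by rewrite card_codom// card_ord.
  by rewrite card_sig -(cardC (mem (codom u))) cc addKn; exact: eq_card.
(* The count is right: #|I| and [n] are both congruent to #|I0| modulo d - 1, so #|I| - (n - 1) is
   congruent to 1. *)
have [||mu hmu] := @hom_merge d hd K; first by rewrite cK subn_gt0.
  rewrite cK; apply/eqP; rewrite -(eqn_modDr n.-1) subnK; last exact: ltnW.
  by rewrite add1n prednK; [rewrite cI nI0|exact: ltnW].
have [s [sK1 sK2 _]] : exists s : 'I_n.-1 + K -> I,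
    [/\ forall j, s (inl j) = u j, forall k, s (inr k) = val k & True].
  by exists (fun t => match t with inl j => u j | inr k => val k end).
have bs : bijective s.
  apply: inj_card_bij; last by rewrite card_sum card_ord cK subnKC//; exact: ltnW.
  move=> [j|[k kP]] [j'|[k' kP']]; rewrite ?sK1 ?sK2 /=.
  - by move=> /u_inj ->.
  - by move=> e; exfalso; have := kP'; rewrite -e codom_f.
  - by move=> e; exfalso; have := kP; rewrite e codom_f.
  - by move=> e; congr inr; exact/val_inj.
pose S := sum_map (@id ('I_n.-1 * C)) mu.
have hS : hom S by apply: (hom_sum hd) hmu; exact: (hom_id hd).
have [S' [hS' SS' S'S]] := hom_inv hS.
pose f1 := f \o relab s; have hf1 : hom f1 := hom_comp hd (hom_relab hd bs) hf.
have [|p [t [pp dp ot tu rt]]] := nP _ (f1 \o S') (hom_comp hd hS' hf1) _ (inr tt).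
  by rewrite card_sum card_ord card_unit addn1 prednK ?(ltnW n1).
have [h hh [hm hfix]] := exact_permutation hd gH cH (hom_comp hd hS' hf1) pp dp ot rt.
have /choice[g gP] (j : 'I_n.-1) : exists j', t (inl j) = inl j'.
  case E : (t (inl j)) => [j'|[]]; first by exists j'.
  by have := perm_inj (etrans E (esym tu)).
have g_inj : injective g.
  by move=> j j' e; have := gP j; rewrite e -gP => /perm_inj[].
exists (perm g_inj); split.
  apply: contrapT => no; have : t = 1%g.
    apply/permP => -[j|[]]; rewrite perm1 ?tu// gP; congr inl.
    by apply: contrapT => gj; apply: no; exists j; rewrite permE; apply/eqP.
  by move=> t1; rewrite t1 order1 in ot; rewrite -ot in pp.
have fE j : chart f (u j) = chart (f1 \o S') (inl j).
  apply/funext => x; rewrite /chart -sK1; have := SS' (inl j, x).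
  by rewrite /S /sum_map /= => ->.
exists h => //; split.
  by move=> j; rewrite permE !fE -gP.
move=> i x iu; pose k : K := exist _ i iu.
have -> : f (i, x) = (f1 \o S') (inr tt, (mu (k, x)).2).
  have := SS' (inr k, x); rewrite /S /sum_map /= => e.
  have -> : (inr tt : 'I_n.-1 + unit) = inr (mu (k, x)).1 by case: (mu _).1.
  by rewrite e /f1 /relab /= sK2.
exact: hfix.
Qed.

Definition cyc (b1 b2 b3 : C -> P) := exists2 h, HH h &
  [/\ moves h b1 b2, moves h b2 b3, moves h b3 b1 &
   forall p, ~ img b1 p -> ~ img b2 p -> ~ img b3 p -> h p = p].

Lemma cyc_rot b1 b2 b3 : cyc b1 b2 b3 -> cyc b2 b3 b1.
Proof. by move=> [h hh [? ? ? e]]; exists h => //; split=> // p ? ? ?; exact: e. Qed.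

Lemma cyc_inv b1 b2 b3 : cyc b1 b2 b3 -> cyc b1 b3 b2.
Proof.
move=> [h hh [m1 m2 m3 e]]; have [g hg [gh hg']] := hgV gH hh.
exists g => //; split; [exact: moves_inv m3|exact: moves_inv m2|exact: moves_inv m1|].
by move=> p ? ? ?; rewrite -{1}(e p)// gh.
Qed.

Lemma cyc_moves h b1 b2 b3 b1' b2' b3' : HH h ->
  moves h b1 b1' -> moves h b2 b2' -> moves h b3 b3' -> cyc b1 b2 b3 -> cyc b1' b2' b3'.
Proof.
move=> hh m1 m2 m3 [c hc [k1 k2 k3 e]]; have [g hg [gh hg']] := hgV gH hh.
have conj b b' a a' : moves h a a' -> moves h b b' -> moves c a b ->
    moves (h \o (c \o g)) a' b'.
  move=> ha hb hab; apply: moves_comp hb; apply: moves_comp hab.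
  exact: moves_inv ha.
exists (h \o (c \o g)); first by apply: (hgM gH) => //; exact: (hgM gH).
split; [exact: conj k1|exact: conj k2|exact: conj k3|].
move=> p n1 n2 n3; rewrite /= e ?hg'// => i.
- by apply: n1; rewrite -(hg' p); exact: moves_img i.
- by apply: n2; rewrite -(hg' p); exact: moves_img i.
- by apply: n3; rewrite -(hg' p); exact: moves_img i.
Qed.

Lemma cyc_sim b1 b2 b3 b1' b2' b3' : sim b1 b1' -> sim b2 b2' -> sim b3 b3' ->
  cyc b1 b2 b3 -> cyc b1' b2' b3'.
Proof. by move=> s1 s2 s3; exact: cyc_moves (hg1 gH) s1 s2 s3. Qed.

(** The classical fact that the commutator of two permutations whose supports share a single point
    is a 3-cycle. Here [A] and [A'] contain the supports and meet only inside the ball [x]; the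
    commutator sends w to x, x to y and y to w. *)
Lemma commutator_cyc h h' (A A' : P -> Prop) x y w : HH h -> HH h' ->
  (forall p, ~ A p -> h p = p) -> (forall p, ~ A' p -> h' p = p) ->
  (forall p, A p -> A' p -> img x p) ->
  moves h x y -> moves h' x w -> dis x y -> dis x w -> cyc x y w.
Proof.
move=> hh hh' hA hA' AA' mh mh' xy xw.
have [g hg [gh hg']] := hgV gH hh; have [g' hg1 [gh' hg1']] := hgV gH hh'.
have gA p : ~ A p -> g p = p by move=> /hA {1}<-; rewrite gh.
have gA' p : ~ A' p -> g' p = p by move=> /hA' {1}<-; rewrite gh'.
have AgA p : A (g p) <-> A p.
  split=> [Ag|Ap]; apply: contrapT => n; last by apply: (n); rewrite -(hA _ n) hg' .
  by move: (Ag); rewrite gA.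
have AgA' p : A' (g' p) <-> A' p.
  split=> [Ag|Ap]; apply: contrapT => n; last by apply: (n); rewrite -(hA' _ n) hg1'.
  by move: (Ag); rewrite gA'.
have yA p : img y p -> A p.
  move=> yp; apply: contrapT => /gA gp; have := moves_img (moves_inv gh mh) yp.
  by rewrite gp => /xy.
have wA p : img w p -> A' p.
  move=> wp; apply: contrapT => /gA' gp; have := moves_img (moves_inv gh' mh') wp.
  by rewrite gp => /xw.
have gx p : img x (g p) -> img y p by move=> /(moves_img mh); rewrite hg'.
have gx' p : img x (g' p) -> img w p by move=> /(moves_img mh'); rewrite hg1'.
pose c := h \o (h' \o (g \o g')).
suff : cyc w x y by move=> /cyc_rot.
exists c.
  by do 2![apply: (hgM gH) => //]; exact: (hgM gH).
split.
- apply: (moves_comp (g := h \o (h' \o g)) (moves_inv gh' mh')).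
  suff : h \o (h' \o g) \o x = x by rewrite /moves => ->; exact: sim_refl.
  apply/funext => t /=; rewrite hA' ?hg'// => A't.
  have xt : img x (x t) by exists t.
  have [At|nAt] := pselect (A (x t)).
    by have /gx/xy := AA' _ ((AgA _).2 At) A't.
  by have := gA _ nAt => e; rewrite e in A't *; have := moves_img mh xt; rewrite hA// => /xy.
- suff : c \o x = h \o x by rewrite /moves => ->.
  apply/funext => t; rewrite /c /=; congr h.
  have xt : img x (x t) by exists t.
  have [A't|nA't] := pselect (A' (x t)); last first.
    have := moves_img mh' xt; rewrite hA'// => /xw; by case.
  rewrite gA ?hg1'// => Ag.
  by have /gx'/xw := AA' _ Ag ((AgA' _).2 A't).
- have e1 : c \o y = h \o (h' \o (g \o y)).
    apply/funext => t; rewrite /c /= gA'// => A't.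
    have yt : img y (y t) by exists t.
    by have /xy := AA' _ (yA _ yt) A't.
  rewrite /moves e1; have m1 : moves (h' \o g) y w by apply: moves_comp mh'; exact: moves_inv mh.
  apply: sim_trans (sim_comp h m1) _.
  suff -> : h \o w = w by exact: sim_refl.
  apply/funext => t; rewrite /= hA// => At.
  have wt : img w (w t) by exists t.
  by have /xw := AA' _ At (wA _ wt).
- move=> p nw nx ny; rewrite /c /=.
  have [A'p|nA'p] := pselect (A' p).
    have nAp : ~ A p by move=> Ap; apply: nx; exact: AA'.
    rewrite gA ?hg1' ?hA// => Ag; apply: nw; apply: gx'; apply: AA' Ag _; exact/AgA'.
  rewrite gA'//; have [Ap|nAp] := pselect (A p); last by rewrite gA// hA'// hA.
  rewrite hA' ?hg'// => A'g; apply: ny; apply: gx; apply: AA' A'g; exact/AgA.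
Qed.

Definition cyc_bound s1 := forall I (f : I * C -> P) (U : finType) (z : U -> I),
  frame f -> injective z -> s1 < #|I| -> s1 <= #|U| ->
  exists i j l, [/\ i != j, j != l, l != i & cyc (chart f (z i)) (chart f (z j)) (chart f (z l))].

(** Arrange [s0 * s0] of the pieces in a square. Each row carries a realized permutation that moves
    some entry; one such entry per row gives a transversal, which carries a realized permutation
    too. A row and the transversal share exactly one piece, and [commutator_cyc] applies where both
    move it. *)
Lemma many_cyc : exists2 s1, 0 < s1 & cyc_bound s1.
Proof.
have [s0 s00 s0P] := local_permutation; exists (s0 * s0); first by rewrite muln_gt0 s00.
move=> I f U z ff z_inj ltI leU.
have [e e_inj] : exists e : 'I_s0 * 'I_s0 -> U, injective e.
  have le : #|{: 'I_s0 * 'I_s0}| <= #|U| by rewrite card_prod card_ord.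
  exists (fun p => enum_val (widen_ord le (enum_rank p))).
  by move=> p q /enum_val_inj/(congr1 val)/= /ord_inj/enum_rank_inj.
have s0I : s0 < #|I| by apply: leq_ltn_trans ltI; rewrite leq_pmulr.
have ze_inj := inj_comp z_inj e_inj.
have inj1 a : injective (fun j => z (e (a, j))) by move=> j j' /ze_inj[].
have /choice[s sP] a := s0P I f _ ff (inj1 a) s0I.
have /choice[j0 j0P] a : exists j, s a j != j by case: (sP a).
have inj2 : injective (fun a => z (e (a, j0 a))) by move=> a a' /ze_inj[].
have [s' [[a sa] [h' hh' [m' fix']]]] := s0P I f _ ff inj2 s0I.
have [_ [h hh [m fixh]]] := sP a.
exists (e (a, j0 a)), (e (a, s a (j0 a))), (e (s' a, j0 (s' a))).
have hf := ff.1.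
have ne1 : e (a, j0 a) != e (a, s a (j0 a)).
  by apply/eqP => /e_inj[/eqP]; rewrite eq_sym (negPf (j0P a)).
have ne2 : e (s' a, j0 (s' a)) != e (a, j0 a).
  by apply/eqP => /e_inj[/eqP]; rewrite (negPf sa).
split=> //.
  by apply/eqP => /e_inj[/esym/eqP]; rewrite (negPf sa).
have [f' [hf' ff' f'f]] := hom_inv hf.
have piece p : exists x, p = f ((f' p).1, x) by exists (f' p).2; rewrite -surjective_pairing f'f.
apply: (@commutator_cyc h h'
  (fun p => (f' p).1 \in codom (fun j => z (e (a, j))))
  (fun p => (f' p).1 \in codom (fun b => z (e (b, j0 b))))) => //.
- by move=> p np; have [x px] := piece p; rewrite px; apply: fixh; exact/negP.
- by move=> p np; have [x px] := piece p; rewrite px; apply: fix'; exact/negP.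
- move=> p /codomP[j ej] /codomP[b eb]; have [x ->] := piece p.
  have /ze_inj[eab _] := etrans (esym ej) eb.
  by exists x; rewrite /chart eb eab.
- by apply: hom_dis => //; rewrite (inj_eq z_inj).
- by apply: hom_dis => //; rewrite (inj_eq z_inj) eq_sym.
Qed.

End Cycles.

(** * The relation of being joined by a 3-cycle *)

Section Links.
Variables (d : nat) (hd : 1 < d) (I0 : finType).
Local Notation C := (stream d).
Local Notation P := (I0 * C)%type.
Implicit Types (I J K : finType).
Variable HH : (P -> P) -> Prop.
Hypotheses (gH : homgroup HH).
Variable s1 : nat.
Hypothesis s1pos : 0 < s1.
Hypothesis s1P : cyc_bound HH s1.

Definition cyc_at I (f : I * C -> P) i j l :=
  cyc HH (chart f i) (chart f j) (chart f l).

Definition linked I (f : I * C -> P) i j : bool :=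
  (i == j) || [exists l, [&& l != i, l != j & `[< cyc_at f i j l >]]].

Lemma linkedP I (f : I * C -> P) i j : reflect
  (i = j \/ exists l, [/\ l != i, l != j & cyc_at f i j l]) (linked f i j).
Proof.
apply: (iffP orP) => -[/eqP ?|]; first by left.
- by move=> /existsP[l /and3P[? ? /asboolP ?]]; right; exists l.
- by left.
- by move=> [l [? ? ?]]; right; apply/existsP; exists l; apply/and3P; split=> //; apply/asboolP.
Qed.

Lemma linked_refl I (f : I * C -> P) i : linked f i i.
Proof. by rewrite /linked eqxx. Qed.

Section Frame.
Variables (I : finType) (f : I * C -> P).
Hypothesis ff : hom f.

Lemma linked_sym i j : linked f i j = linked f j i.
Proof.
suff h i' j' : linked f i' j' -> linked f j' i' by apply/idP/idP; exact: h.
move=> /linkedP[->|[l [li lj c]]]; first exact: linked_refl.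
apply/linkedP; right; exists l; split=> //.
exact/cyc_rot/cyc_rot/(cyc_inv gH).
Qed.

Lemma fixed_chart h i (Q : I -> bool) : (forall p, (forall j, Q j -> ~ img (chart f j) p) -> h p = p) ->
  ~~ Q i -> h \o chart f i = chart f i.
Proof.
move=> hQ Qi; apply/funext => x /=; apply: hQ => j Qj.
have ij : i != j by apply: contraNneq Qi => ->.
by apply: (hom_dis ff ij); exists x.
Qed.

Lemma cyc_fixed h i j l q : q != i -> q != j -> q != l ->
  (forall p, ~ img (chart f i) p -> ~ img (chart f j) p -> ~ img (chart f l) p -> h p = p) ->
  h \o chart f q = chart f q.
Proof.
move=> qi qj ql e; apply: (@fixed_chart h q (pred3 i j l)).
  by move=> p n; apply: e; apply: n; rewrite /= eqxx ?orbT.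
by rewrite /= (negPf qi) (negPf qj) (negPf ql).
Qed.

Lemma moves_fixed h q : h \o chart f q = chart f q -> moves h (chart f q) (chart f q).
Proof. by rewrite /moves => ->; exact: sim_refl. Qed.

(** The inverse of the cycle (i j l) sends j to i and fixes q, so it conjugates a cycle through j
    and q into one through i and q. *)
Lemma linked_trans i j q : linked f i j -> linked f j q -> linked f i q.
Proof.
have [->//|ij] := eqVneq i j; have [->//|jq] := eqVneq j q.
move=> /linkedP[/eqP|[l [li lj c]]]; first by rewrite (negPf ij).
move=> /linkedP[/eqP|[r [rj rq c']]]; first by rewrite (negPf jq).
have [->|qi] := eqVneq q i; first exact: linked_refl.
have [->|ql] := eqVneq q l.
  apply/linkedP; right; exists j; rewrite eq_sym ij eq_sym lj; split=> //.
  exact: (cyc_inv gH).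
have [h hh [m1 m2 m3 e]] := c; have [g hg [gh hg']] := hgV gH hh.
have e' p : ~ img (chart f i) p -> ~ img (chart f j) p -> ~ img (chart f l) p -> g p = p.
  by move=> n1 n2 n3; rewrite -{1}(e p n1 n2 n3) gh.
have gq : moves g (chart f q) (chart f q).
  by apply/moves_fixed/(cyc_fixed qi _ ql e'); rewrite eq_sym.
have [r' [r'i r'q gr]] : exists r', [/\ r' != i, r' != q & moves g (chart f r) (chart f r')].
  have [->|ri] := eqVneq r i; first by exists l; rewrite li eq_sym ql; split=> //; exact: moves_inv m3.
  have [->|rl] := eqVneq r l.
    by exists j; rewrite eq_sym ij jq; split=> //; exact: moves_inv m2.
  by exists r; split=> //; exact/moves_fixed/(cyc_fixed ri rj rl e').
apply/linkedP; right; exists r'; split=> //.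
exact: (cyc_moves gH hg (moves_inv gh m1) gq gr c').
Qed.

(** The cycles (i j a) and (i l b) meet only in i when a, b, j, l are distinct, and their commutator
    is the cycle wanted. When a = b, conjugating the first by the second gives it. *)
Lemma linked_triple i j l : i != j -> j != l -> l != i ->
  linked f i j -> linked f i l -> cyc_at f i j l.
Proof.
move=> ij jl li /linkedP[/eqP|[a [ai aj c]]]; first by rewrite (negPf ij).
move=> /linkedP[/eqP|[b [bi bl c']]]; first by rewrite eq_sym (negPf li).
have [al|al] := eqVneq a l; first by rewrite -al.
have [bj|bj] := eqVneq b j; first by rewrite -bj; exact: (cyc_inv gH).
have [ba|ba] := eqVneq b a.
  subst b; have [h hh [m1 m2 m3 e]] := c'.
  have hj : moves h (chart f j) (chart f j).
    by apply/moves_fixed/(cyc_fixed _ jl _ e); rewrite eq_sym.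
  have := cyc_moves gH hh m1 hj m3 c.
  by move=> /cyc_rot/(cyc_inv gH)/cyc_rot/cyc_rot.
have [h hh [m1 m2 m3 e]] := c; have [h' hh' [m1' m2' m3' e']] := c'.
pose A (x y z : I) p := [\/ img (chart f x) p, img (chart f y) p | img (chart f z) p].
apply: (@commutator_cyc _ _ _ gH h h' (A i j a) (A i l b)) => //.
- by move=> p n; apply: e => q; apply: n; [constructor 1|constructor 2|constructor 3].
- by move=> p n; apply: e' => q; apply: n; [constructor 1|constructor 2|constructor 3].
- have D x y p : x != y -> img (chart f x) p -> img (chart f y) p -> img (chart f i) p.
    by move=> xy /(hom_dis ff xy).
  move=> p [//|jp|ap] [//|lp|bp].
  + exact: D jl _ _.
  + by apply: D jp bp; rewrite eq_sym.
  + exact: D al _ _.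
  + by apply: D ap bp; rewrite eq_sym.
- exact: hom_dis.
- by apply: hom_dis => //; rewrite eq_sym.
Qed.

Lemma linked_equiv : equivalence_rel (linked f).
Proof.
move=> i j l; split; first exact: linked_refl.
move=> ij; apply/idP/idP; last exact: linked_trans.
by apply: linked_trans; rewrite linked_sym.
Qed.

Hypothesis cI : #|I| = #|I0| %[mod d.-1].
Hypothesis ltI : s1 < #|I|.

Lemma linked_pair (U : finType) (z : U -> I) : s1 <= #|U| ->
  exists u v, u != v /\ linked f (z u) (z v).
Proof.
move=> sU; have [z_inj|nz] := pselect (injective z); last first.
  apply: contrapT => no; apply: nz => u v e; apply: contrapT => uv; apply: no.
  by exists u, v; rewrite e linked_refl; split=> //; exact/eqP.
have [i [j [l [ij jl li c]]]] := s1P (conj ff cI) z_inj ltI sU.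
exists i, j; split=> //; apply/linkedP; right; exists (z l).
by rewrite !(inj_eq z_inj) li eq_sym jl.
Qed.

(** One piece chosen from each class never gives two linked pieces, so by [linked_pair] fewer than
    [s1] classes meet [Z], and the pigeonhole principle makes one of them large. *)
Lemma linked_class (Z : {set I}) m : s1 * m <= #|Z| -> 0 < m ->
  exists2 i, i \in Z & m <= #|[set j in Z | linked f i j]|.
Proof.
move=> sZ m0; apply: contrapT => no.
pose PP := equivalence_partition (linked f) Z.
have eq3 : {in Z & &, equivalence_rel (linked f)}.
  by move=> i j l _ _ _; exact: linked_equiv.
have pP : finset.partition PP Z := equivalence_partitionP eq3.
have small B : B \in PP -> #|B| <= m.-1.
  move=> /imsetP[i iZ ->]; rewrite -ltnS prednK// ltnNge; apply/negP => mB.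
  by apply: no; exists i.
have cP : #|PP| < s1.
  rewrite ltnNge; apply/negP => sP.
  have /choice[rep repP] (B : {B : {set I} | B \in PP}) : exists i, i \in val B.
    have /and3P[_ _ n0] := pP; apply/set0Pn; apply: contraNneq n0 => <-; exact: valP.
  have [|B [B' [BB' l]]] := linked_pair rep; first by rewrite card_sig.
  have /and3P[_ tr _] := pP; move/eqP: BB'; apply; apply/val_inj.
  have BZ B1 : rep B1 \in Z.
    by rewrite -(cover_partition pP); apply/bigcupP; exists (val B1) => //; exact: valP.
  rewrite -(def_pblock tr (valP B) (repP B)) -(def_pblock tr (valP B') (repP B')).
  apply/eqP; rewrite eq_pblock ?(cover_partition pP)//.
  by rewrite (pblock_equivalence_partition eq3).
have : #|Z| <= #|PP| * m.-1.
  rewrite (card_partition pP) -sum_nat_const; exact: leq_sum.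
rewrite leqNgt => /negP; apply; apply: leq_trans sZ.
apply: (@leq_ltn_trans (#|PP| * m)); first by rewrite leq_mul2l leq_pred orbT.
by rewrite ltn_mul2r m0.
Qed.

End Frame.
End Links.

(** * Linked pieces of a refined frame *)

Section Refine.
Variables (d : nat) (hd : 1 < d) (I0 : finType).
Local Notation C := (stream d).
Local Notation P := (I0 * C)%type.
Implicit Types (I J K : finType).
Variable HH : (P -> P) -> Prop.
Hypotheses (gH : homgroup HH).
Variable s1 : nat.
Hypothesis s1pos : 0 < s1.
Hypothesis s1P : cyc_bound HH s1.
Local Notation linked := (linked HH).

Lemma chart_rmp I (f : I * C -> P) (l : I -> nat) (t : ref_idx d l) :
  chart (f \o rmp (l := l)) t = sub (chart f (tag t)) (tagged t).
Proof. by []. Qed.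

Lemma chart_mkt I (f : I * C -> P) (l : I -> nat) i x :
  chart (f \o rmp (l := l)) (mkt l i x) = sub (chart f i) (mkseq x (l i)).
Proof. by []. Qed.

Lemma mkt_inj I (l : I -> nat) i j x y : mkt (d := d) l i x = mkt l j y -> i = j.
Proof. by move=> /(congr1 tag). Qed.

Lemma frame_ref I (f : I * C -> P) (l : I -> nat) : frame f -> frame (f \o rmp (l := l)).
Proof.
move=> [hf cI]; split; first exact: (hom_comp hd (hom_rmp hd l) hf).
by rewrite (card_ref_mod hd).
Qed.

Lemma card_ref_le I (l : I -> nat) : #|I| <= #|ref_idx d l|.
Proof.
rewrite -[#|I|](card_codom (f := fun i => mkt l i (stream0 hd))); first exact: max_card.
by move=> i j /mkt_inj.
Qed.

(** The last clause is for the pieces on which [h] is the identity: their sub-pieces are kept one by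
    one, not merely permuted. *)
Lemma moves_rmp I (f : I * C -> P) (l : I -> nat) h (r : I -> I) : hom f ->
  (forall i, moves h (chart f i) (chart f (r i)) /\ l (r i) = l i \/
     r i = i /\ h \o chart f i = chart f i) ->
  exists s : ref_idx d l -> ref_idx d l, forall t,
    [/\ moves h (chart (f \o rmp (l := l)) t) (chart (f \o rmp (l := l)) (s t)),
      tag (s t) = r (tag t) &
      h \o chart f (tag t) = chart f (tag t) -> r (tag t) = tag t -> s t = t].
Proof.
move=> hf hr.
suff /choice[s sP] : forall t : ref_idx d l, exists t' : ref_idx d l,
    [/\ moves h (chart (f \o rmp (l := l)) t) (chart (f \o rmp (l := l)) t'),
      tag t' = r (tag t) &
      h \o chart f (tag t) = chart f (tag t) -> r (tag t) = tag t -> t' = t].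
  by exists s.
move=> t; have [[e1 e2]|ne] := pselect (h \o chart f (tag t) = chart f (tag t) /\ r (tag t) = tag t).
  exists t; split=> //; rewrite /moves chart_rmp.
  have -> : h \o sub (chart f (tag t)) (tagged t) = sub (h \o chart f (tag t)) (tagged t) by [].
  by rewrite e1; exact: sim_refl.
have [[m lr]|[e1 e2]] := hr (tag t); last by case: ne.
have [u su su'] := sim_sub hd (tagged t) m.
have eu : mkseq (scat u (stream0 hd)) (l (r (tag t))) = u.
  by rewrite lr -(size_tuple (tagged t)) -su scatK.
exists (mkt l (r (tag t)) (scat u (stream0 hd))); split=> // [|e1 e2].
  by rewrite chart_mkt eu.
by case: ne.
Qed.

Lemma moves_piece_inj I (f : I * C -> P) h i j k : hom f -> HH h ->
  moves h (chart f i) (chart f k) -> moves h (chart f j) (chart f k) -> i = j.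
Proof.
move=> hf hh mi mj; apply/eqP; apply: contrapT => /negP ij.
have ih := hom_inj (hg_hom gH hh).
have [a ia e] := mi; have [a' /isom_inv[b [ib a'b ba']] e'] := mj.
have := congr1 (@^~ (stream0 hd)) e; have := congr1 (@^~ (b (a (stream0 hd)))) e'.
rewrite /= ba' => <- /ih ee.
by apply: (hom_dis hf ij); [exists (stream0 hd); exact: ee | eexists].
Qed.

Lemma linked_moves I (f : I * C -> P) h (s : I -> I) i j : hom f -> HH h ->
  (forall i, moves h (chart f i) (chart f (s i))) -> linked f i j -> linked f (s i) (s j).
Proof.
move=> hf hh hs /linkedP[->|[l [li lj c]]]; first exact: linked_refl.
have s_inj i' j' : s i' = s j' -> i' = j'.
  by move=> e; apply: (moves_piece_inj hf hh (hs i')); rewrite e.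
apply/linkedP; right; exists (s l); split; last exact: (cyc_moves gH hh (hs i) (hs j) (hs l) c).
  by apply: contraNneq li => /s_inj ->.
by apply: contraNneq lj => /s_inj ->.
Qed.

(** The 3-cycles of pieces of [Y] act on the refined pieces and preserve the relation [linked]. If
    the class of [t0] has a member in a piece of [Y] other than i and j, a cycle that sends i to j
    and fixes this member preserves the class, so it injects the part of the class inside i into the
    part inside j. *)
Lemma refine_count I (f : I * C -> P) (l : I -> nat) n (Y : {set I}) t0 i j :
  frame f -> s1 < #|I| -> (forall i, i \in Y -> l i = n) ->
  {in Y &, forall i j, linked f i j} -> s1 <= #|Y| -> 4 < #|Y| -> i \in Y -> j \in Y ->
  #|[set t | (tag t == i) && linked (f \o rmp (l := l)) t0 t]| =
  #|[set t | (tag t == j) && linked (f \o rmp (l := l)) t0 t]|.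
Proof.
move=> ff ltI lY YY sY cY.
set F := f \o rmp (l := l).
have hf := ff.1; have fF : frame F := frame_ref l ff; have hF := fF.1.
have ltF : s1 < #|ref_idx d l| := leq_trans ltI (card_ref_le l).
have lsym := linked_sym gH F.
have ltr := @linked_trans _ _ _ gH _ _ hF.
have pick4 (q : seq I) : size q <= 4 -> exists2 b, b \in Y & b \notin q.
  move=> sq; apply: contrapT => no; move: cY; rewrite ltnNge => /negP; apply.
  apply: leq_trans sq; apply: leq_trans (card_size q); apply: subset_leq_card.
  by apply/fintype.subsetP => b bY; apply: contrapT => /negP bq; apply: no; exists b.
have act a b c : a \in Y -> b \in Y -> c \in Y -> a != b -> b != c -> c != a ->
  exists s : ref_idx d l -> ref_idx d l, [/\ injective s,
    forall t t', linked F (s t) (s t') = linked F t t',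
    forall t, tag t = a -> tag (s t) = b,
    forall t, tag t \notin [:: a; b; c] -> s t = t &
    forall t, tag t \in [:: a; b; c] -> tag (s t) \in [:: a; b; c]].
  move=> aY bY cY' ab bc ca.
  have [h hh [m1 m2 m3 e]] := linked_triple gH hf ab bc ca (YY _ _ aY bY) (YY _ _ aY cY').
  pose r x := if x == a then b else if x == b then c else if x == c then a else x.
  have ef x : x \notin [:: a; b; c] -> h \o chart f x = chart f x.
    by rewrite !inE !negb_or => /and3P[n1 n2 n3]; exact: (cyc_fixed hf n1 n2 n3 e).
  have [|s sP] := @moves_rmp I f l h r hf.
    move=> x; rewrite /r; case: (eqVneq x a) => [->|xa]; first by left; rewrite !lY.
    case: (eqVneq x b) => [->|xb]; first by left; rewrite !lY.
    case: (eqVneq x c) => [->|xc]; first by left; rewrite !lY.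
    by right; split=> //; apply: ef; rewrite !inE !negb_or xa xb.
  have sm t : moves h (chart F t) (chart F (s t)) by case: (sP t).
  have s_inj : injective s.
    by move=> t t' e'; apply: (moves_piece_inj hF hh (sm t)); rewrite e'.
  have [s' ss' s's] := injF_bij s_inj.
  have [g hg [gh _]] := hgV gH hh.
  exists s; split=> // [t t'|t ta|t nt|t tabc].
  - apply/idP/idP; last exact: linked_moves hh sm.
    have sm' u : moves g (chart F u) (chart F (s' u)).
      by rewrite -{1}(s's u); exact: moves_inv (sm _).
    by move=> /(linked_moves hF hg sm'); rewrite !ss'.
  - by have [_ -> _] := sP t; rewrite ta /r eqxx.
  - have [_ _ e2] := sP t; apply: e2; first exact: ef.
    by move: nt; rewrite !inE !negb_or /r => /and3P[/negPf -> /negPf -> /negPf ->].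
  - have [_ -> _] := sP t; move: tabc; rewrite !inE /r.
    by case: eqP => [_|_]; rewrite ?eqxx ?orbT//; case: eqP => [_|_];
      rewrite ?eqxx ?orbT//= => ->; rewrite eqxx.
suff le i' j' : i' \in Y -> j' \in Y -> i' != j' ->
    #|[set t | (tag t == i') && linked F t0 t]| <= #|[set t | (tag t == j') && linked F t0 t]|.
  move=> iY jY; have [->//|ij] := eqVneq i j.
  by apply/eqP; rewrite eqn_leq !le// eq_sym.
clear i j; rename i' into i, j' into j; move=> iY jY ij.
set Ti := [set t | _]; have [->|[t1]] := set_0Vmem Ti; first by rewrite cards0.
rewrite inE => /andP[/eqP ti lt1].
have lE t : linked F t0 t = linked F t1 t.
  by apply/idP/idP; apply: ltr => //; rewrite lsym.
(* otherwise the images of this class under the cycles moving i would be too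
   many distinct classes *)
have [t2 [lt2 t2Y t2i]] : exists t2, [/\ linked F t1 t2, tag t2 \in Y & tag t2 != i].
  apply: contrapT => no.
  have no' t : linked F t1 t -> tag t \in Y -> tag t = i.
    by move=> lt tY; apply: contrapT => /eqP ne; apply: no; exists t.
  have /choice[z zP] (x : {x | x \in Y}) : exists t, [/\ tag t = val x,
      val x = i -> t = t1 &
      forall t', linked F t t' -> tag t' \in Y -> tag t' != val x -> tag t' = i].
    case: x => x xY /=; have [->|xi] := eqVneq x i.
      by exists t1; split=> // t' lt' t'Y _; exact: no'.
    have [b bY] := pick4 [:: x; i] isT; rewrite !inE negb_or => /andP[bx bi].
    have [s [s_inj sl s1' s2' s3']] := act i x b iY xY bY
      ltac:(by rewrite eq_sym) ltac:(by rewrite eq_sym) bi.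
    have [s' ss' s's] := injF_bij s_inj.
    exists (s t1); split; [exact: s1'|by move=> e; rewrite e eqxx in xi|].
    move=> t'; rewrite -(s's t') sl; set t'' := s' t' => lt' t'Y t'x.
    have e : tag t'' = i.
      apply: no' => //; apply: contrapT => /negP nY.
      have t''n : tag t'' \notin [:: i; x; b].
        by apply: contra nY; rewrite !inE => /or3P[]/eqP ->.
      by rewrite (s2' _ t''n) in t'Y; rewrite t'Y in nY.
    by rewrite (s1' _ e) eqxx in t'x.
  have [|u [v [uv luv]]] := linked_pair s1P hF fF.2 ltF z.
    by rewrite card_sig.
  have [u1 u2 u3] := zP u; have [v1 v2 v3] := zP v.
  have uv' : val u != val v by rewrite (inj_eq val_inj).
  have vi : val v = i by rewrite -v1; apply: (u3 _ luv); rewrite v1 ?(valP v)// eq_sym.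
  have ui : val u = i.
    by rewrite -u1; apply: (v3 (z u)); rewrite ?u1 ?(valP u)// lsym.
  by rewrite ui vi eqxx in uv'.
have {t2 lt2 t2Y t2i} [t2 [lt2 t2Y t2i t2j]] : exists t2,
    [/\ linked F t1 t2, tag t2 \in Y, tag t2 != i & tag t2 != j].
  have [t2j|t2j] := eqVneq (tag t2) j; last by exists t2.
  have [c cY'] := pick4 [:: i; j] isT; rewrite !inE negb_or => /andP[ci cj].
  have [b bY] := pick4 [:: i; j; c] isT; rewrite !inE !negb_or => /and3P[bi bj bc].
  have [s [s_inj sl s1' s2' _]] := act i c b iY cY' bY
    ltac:(by rewrite eq_sym) ltac:(by rewrite eq_sym) bi.
  exists (s t1); rewrite (s1' _ ti); split=> //.
  have st2 : s t2 = t2.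
    by apply: s2'; rewrite t2j !inE !negb_or eq_sym ij eq_sym cj eq_sym bj.
  by apply: (ltr _ _ _ lt2); rewrite -st2 sl lsym.
have [b bY] := pick4 [:: i; j; tag t2] isT; rewrite !inE !negb_or => /and3P[bi bj bt].
have [s [s_inj sl s1' s2' _]] := act i j b iY jY bY ij ltac:(by rewrite eq_sym) bi.
have st2 : s t2 = t2 by rewrite s2'// !inE !negb_or t2i t2j eq_sym.
rewrite -(card_imset _ s_inj); apply: subset_leq_card; apply/fintype.subsetP => t' /imsetP[t].
rewrite !inE => /andP[/eqP tti ltt] ->; rewrite (s1' _ tti) eqxx /= lE.
apply: (ltr _ _ _ lt2); rewrite -{1}st2 sl; apply: (ltr _ t1); first by rewrite lsym.
by rewrite -lE.
Qed.

End Refine.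

(** * Uniqueness of the large class *)

Section BigClass.
Variables (d : nat) (hd : 1 < d) (I0 : finType).
Local Notation C := (stream d).
Local Notation P := (I0 * C)%type.
Implicit Types (I J K : finType).
Variable HH : (P -> P) -> Prop.
Hypotheses (gH : homgroup HH).
Variable s1 : nat.
Hypothesis s1pos : 0 < s1.
Hypothesis s1P : cyc_bound HH s1.
Local Notation linked := (linked HH).

Lemma linked_relab I J (f : I * C -> P) (s : J -> I) i j : bijective s ->
  linked (f \o relab s) i j = linked f (s i) (s j).
Proof.
move=> [s' ss' s's]; have s_inj := can_inj ss'.
apply/linkedP/linkedP => -[e|[l [li lj c]]].
- by left; rewrite e.
- by right; exists (s l); rewrite !(inj_eq s_inj).
- by left; exact: s_inj.
- right; exists (s' l); split; last by rewrite /cyc_at -{1}(s's l) in c.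
    by apply: contraNneq li => <-; rewrite s's.
  by apply: contraNneq lj => <-; rewrite s's.
Qed.

Definition lclass I (f : I * C -> P) i := [set j | linked f i j].

(* If two classes were big, balls containing different numbers of pieces of the
   first one (the rest being taken from the second one) could not be linked. *)
Lemma one_big_class : exists2 M, 4 < M & forall I (f : I * C -> P) i0 i1,
  frame f -> s1 < #|I| -> M <= #|lclass f i0| -> M <= #|lclass f i1| -> linked f i0 i1.
Proof.
(* Among [s2] pieces [linked_class] finds [m5] linked ones, as many as [refine_count] demands. Balls
   cut to depth [L] have D >= s2 sub-balls, enough to give [s2] balls different counts, and s2 * D
   pieces of each class suffice to fill them all. *)
pose m5 := maxn s1 5; pose s2 := s1 * m5; pose L := s2; pose D := d ^ L.
have s2_5 : 5 <= s2 by apply: leq_trans (leq_maxr s1 5) _; rewrite leq_pmull.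
have s2D : s2 <= D by apply: ltnW; exact: ltn_expl.
have D0 : 0 < D by apply: leq_trans s2D; exact: leq_trans s2_5.
have s1s2 : s1 < s2.
  by rewrite /s2 -{1}[s1]muln1 ltn_mul2l s1pos /= leq_max orbT.
exists (s2 * D); first by apply: leq_trans s2_5 _; rewrite leq_pmulr.
move=> I f i0 i1 ff ltI big0 big1; apply: contrapT => /negP n01.
have hf := ff.1.
pose words := map val (enum {: L.-tuple 'I_d}) : seq (seq 'I_d).
have uw : uniq words by rewrite map_inj_uniq ?enum_uniq//; exact: val_inj.
have sw : size words = D by rewrite size_map -cardE card_tuple card_ord.
have wP (w : seq 'I_d) : (w \in words) = (size w == L).
  apply/mapP/idP => [[t _ ->]|e]; first by rewrite size_tuple.
  by exists (Tuple e) => //; rewrite mem_enum.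
pose r (w : seq 'I_d) := index w words.
have rD (w : seq 'I_d) : size w = L -> r w < D by move=> e; rewrite -sw index_mem wP e.
have r_inj (w v : seq 'I_d) : size w = L -> size v = L -> r w = r v -> w = v.
  move=> e e' rr; rewrite -(nth_index [::] (_ : w \in words)) ?wP ?e//.
  by rewrite -/(r w) rr nth_index// wP e'.
pose E (b : bool) := enum (lclass f (if b then i0 else i1)).
have sE b n : n < s2 * D -> n < size (E b).
  by move=> h; apply: leq_trans h _; rewrite -cardE; case: b.
pose q (a : 'I_s2) (w : seq 'I_d) := a * D + r w.
have qM (a : 'I_s2) (w : seq 'I_d) : size w = L -> q a w < s2 * D.
  move=> e; apply: (@leq_trans (a.+1 * D)); last by rewrite leq_mul2r ltn_ord orbT.
  by rewrite mulSn /q addnC ltn_add2r rD.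
(* The sub-ball [w] of the merged ball [a] is taken from the class of [i0] if the rank of [w] is
   below [a], and from the class of [i1] otherwise. So the ball [a] contains exactly [a] pieces of
   the first class. *)
pose u (a : 'I_s2) (w : seq 'I_d) := nth i0 (E (r w < a)) (q a w).
have uE (a : 'I_s2) (w : seq 'I_d) : size w = L -> linked f (if r w < a then i0 else i1) (u a w).
  move=> e; have := mem_nth i0 (sE (r w < a) _ (qM a w e)).
  by rewrite mem_enum inE.
have u0 (a : 'I_s2) (w : seq 'I_d) : size w = L -> linked f i0 (u a w) = (r w < a).
  move=> e; have := uE a w e; case: ifP => // _ l1; apply: contraNF n01 => l0.
  by apply: (linked_trans gH hf l0); rewrite (linked_sym gH).
have u_inj (a b : 'I_s2) (w v : seq 'I_d) : size w = L -> size v = L -> u a w = u b v -> a = b /\ w = v.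
  move=> e e' uu; have /eqP := congr1 (linked f i0) uu; rewrite !u0// => /eqP rr.
  move: uu; rewrite /u rr => /eqP; rewrite nth_uniq ?enum_uniq ?sE ?qM// => /eqP.
  move=> /(congr1 (edivn^~ D)); rewrite !edivn_eq ?rD// => -[/val_inj ab rwv].
  by split=> //; exact: r_inj.
pose U (p : 'I_s2 * L.-tuple 'I_d) := u p.1 p.2.
pose A : finType := {i : I | i \notin codom U}.
pose I' : finType := ('I_s2 + A)%type.
pose l (x : I') : nat := match x with inl _ => L | inr _ => 0 end.
pose s (t : ref_idx d l) : I :=
  match tag t with inl a => u a (tagged t) | inr k => val k end.
have s_inj : injective s.
  have UU a (w : L.-tuple 'I_d) : u a w \in codom U by apply/codomP; exists (a, w).
  move=> [[a|k] w] [[b|k'] v]; rewrite /s /=.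
  - by move=> /u_inj[]; rewrite ?size_tuple// => ab /val_inj wv; subst b; rewrite wv.
  - by move=> e; exfalso; have := valP k'; rewrite /= -e UU.
  - by move=> e; exfalso; have := valP k; rewrite /= e UU.
  - by move=> /val_inj e; subst k'; rewrite (tuple0 w) (tuple0 v).
have /choice[g gP] (i : I) : exists t, s t = i.
  have [/codomP[[a w] ->]|iU] := boolP (i \in codom U).
    by exists (Tagged (fun x => (l x).-tuple 'I_d) (w : (l (inl a)).-tuple 'I_d)).
  pose k : A := exist _ i iU.
  by exists (mkt l (inr k) (stream0 hd)).
have bs : bijective s by exists g => // t; apply: s_inj; rewrite gP.
have [q' [hq rq qr]] := hom_inv (hom_rmp hd l).
have hs := hom_comp hd (hom_relab hd bs) hf.
pose f' := (f \o relab s) \o q'.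
have cr : #|ref_idx d l| = #|I| := bij_eq_card bs.
have ff' : frame f'.
  split; first exact: (hom_comp hd hq hs).
  by rewrite -(card_ref_mod hd l) cr ff.2.
have F'E : f' \o rmp (l := l) = f \o relab s.
  by apply/funext => p; rewrite /f' /= rq.
have ltI' : s1 < #|I'|.
  by rewrite card_sum card_ord (leq_trans s1s2) ?leq_addr.
pose Z := [set (inl a : I') | a in [set: 'I_s2]].
have cZ : #|Z| = s2 by rewrite card_imset ?cardsT ?card_ord// => a b [].
have [||x0 x0Z] := @linked_class _ _ _ gH _ s1P _ _ ff'.1 ff'.2 ltI' Z m5.
- by rewrite cZ.
- by rewrite leq_max orbT.
set Y := [set j in Z | _] => cY.
have YY : {in Y &, forall i j, linked f' i j}.
  move=> i j; rewrite !inE => /andP[_ xi] /andP[_ xj].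
  by apply: (linked_trans gH ff'.1 _ xj); rewrite (linked_sym gH).
have Yl i : i \in Y -> l i = L by rewrite inE => /andP[/imsetP[a _ ->]].
have /card_gt1P[x [y [xY yY xy]]] : 1 < #|Y|.
  by apply: leq_trans cY; rewrite leq_max orbT.
have Yinl i : i \in Y -> exists a, i = inl a.
  by rewrite inE => /andP[/imsetP[a _ ->] _]; exists a.
have [a xa] := Yinl _ xY; have [b yb] := Yinl _ yY; subst x y.
have := refine_count hd gH s1P (g i0) ff' ltI' Yl YY _ _ xY yY.
have cnt (c : 'I_s2) :
    #|[set t | (tag t == inl c) && linked (f' \o rmp (l := l)) (g i0) t]| = c.
  pose gc (n : 'I_c) := mkt l (inl c) (scat (nth [::] words n) (stream0 hd)).
  have nD (n : 'I_c) : n < D by apply: leq_trans s2D; exact: ltn_trans (ltn_ord n) (ltn_ord c).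
  have nL (n : 'I_c) : size (nth [::] words n) = L.
    by apply/eqP; rewrite -wP mem_nth// sw nD.
  have gcw n : (tagged (gc n) : seq _) = nth [::] words n.
    by rewrite /= -[X in mkseq _ X](nL n) scatK.
  have gc_inj : injective gc.
    move=> n m /(congr1 (fun t : ref_idx d l => (tagged t : seq 'I_d))).
    by rewrite !gcw => /eqP; rewrite nth_uniq ?sw ?nD// => /eqP/ord_inj.
  rewrite -[RHS]card_ord -[RHS](card_imset _ gc_inj) -[RHS]/(#|[set gc n | n in predT]|).
  apply: eq_card => t; rewrite inE F'E linked_relab// gP; apply/andP/imsetP.
    move=> [/eqP tc]; case: t tc => t w /= tc; subst t; rewrite /s /= u0 ?size_tuple// => rc.
    exists (Ordinal rc) => //; rewrite /gc /= nth_index; last by rewrite wP size_tuple.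
    have := mkt_eq hd (Tagged (fun x => (l x).-tuple 'I_d) (w : (l (inl c)).-tuple 'I_d)) (stream0 hd).
    by move=> /= ->.
  move=> [n _ ->]; split; first by [].
  rewrite /s gcw /= u0// /r index_uniq// sw; exact: nD.
rewrite !cnt => e; move/eqP: xy; apply; congr inl; apply/ord_inj; apply: e.
  by apply: leq_trans cY; exact: leq_maxl.
by apply: leq_trans cY; exact: leq_maxr.
Qed.

End BigClass.

(** * Good balls and the exceptional point *)

Section Good.
Variables (d : nat) (hd : 1 < d) (I0 : finType).
Local Notation C := (stream d).
Local Notation P := (I0 * C)%type.
Implicit Types (I J K : finType) (b : C -> P).
Variable HH : (P -> P) -> Prop.
Hypotheses (gH : homgroup HH).
Variables s1 M : nat.
Hypothesis s1pos : 0 < s1.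
Hypothesis s1P : cyc_bound HH s1.
Hypothesis M4 : 4 < M.
Hypothesis oneP : forall I (f : I * C -> P) i0 i1, frame f -> s1 < #|I| ->
  M <= #|lclass HH f i0| -> M <= #|lclass HH f i1| -> linked HH f i0 i1.
Local Notation linked := (linked HH).
Local Notation lclass := (lclass HH).
Local Notation cyc := (cyc HH).

(** Strictly more than [M], because [attach] removes one piece from a large class and still wants
    [M] pieces. *)
Definition big := (maxn s1 M).+1.

Lemma bigM : M < big. Proof. by rewrite ltnS leq_maxr. Qed.

(* Up to isometry, b is a piece of a frame in which more than s1 and M pieces are
   permuted by all 3-cycles with b. *)
Definition good b := exists I (f : I * C -> P) i,
  [/\ frame f, s1 < #|I|, big <= #|lclass f i| & sim b (chart f i)].

Lemma good_sim b b' : sim b b' -> good b -> good b'.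
Proof.
move=> bb' [I [f [i [h1 h2 h3 h4]]]]; exists I, f, i; split=> //.
exact: sim_trans (sim_sym bb') h4.
Qed.

Lemma linked_same I (f : I * C -> P) i j : hom f -> linked f i j -> lclass f i = lclass f j.
Proof.
move=> hf ij; apply/setP => l; rewrite !inE; apply/idP/idP.
  by apply: (linked_trans gH hf); rewrite (linked_sym gH).
exact: (linked_trans gH hf).
Qed.

Lemma good_moves h b b' : HH h -> moves h b b' -> good b -> good b'.
Proof.
move=> hh m [I [f [i [[hf cI] ltI bi sb]]]]; exists I, (h \o f), i.
have hhf : hom (h \o f) := hom_comp hd hf (hg_hom gH hh).
split=> //.
  apply: leq_trans bi _; apply: subset_leq_card; apply/fintype.subsetP => j.
  rewrite !inE => /linkedP[->|[l [li lj c]]]; first exact: linked_refl.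
  apply/linkedP; right; exists l; split=> //.
  by apply: (cyc_moves gH hh _ _ _ c); exact: sim_refl.
apply: sim_trans (sim_sym m) _; exact: sim_comp.
Qed.

(** Cut every piece of the frame to the depth of [w]. By [refine_count] the class of the new piece
    meets every piece of the old class, so it is at least as large. *)
Lemma good_sub b w : good b -> good (sub b w).
Proof.
move=> [I [f [i [ff ltI bi sb]]]].
have [u su s'] := sim_sub hd w sb.
pose l (x : I) := size w; have fF := frame_ref hd l ff.
pose t0 := mkt l i (scat u (stream0 hd)).
have ct0 : chart (f \o rmp (l := l)) t0 = sub (chart f i) u.
  by rewrite chart_mkt /l -su scatK.
exists (ref_idx d l), (f \o rmp (l := l)), t0; split=> //; last by rewrite ct0.
  exact: leq_trans ltI (card_ref_le hd l).
have iY : i \in lclass f i by rewrite inE linked_refl.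
have /choice[z zP] (j : {j | j \in lclass f i}) : exists t : ref_idx d l,
    tag t = val j /\ linked (f \o rmp (l := l)) t0 t.
  case: j => j jY /=.
  have YY : {in lclass f i &, forall x y, linked f x y}.
    move=> x y; rewrite !inE => ix iy; apply: (linked_trans gH ff.1 _ iy).
    by rewrite (linked_sym gH).
  have sY : s1 <= #|lclass f i| by apply: leq_trans bi; rewrite ltnW// ltnS leq_maxl.
  have cY : 4 < #|lclass f i| by apply: leq_trans bi; apply: ltn_trans bigM.
  have lY (x : I) : x \in lclass f i -> l x = size w by [].
  have := refine_count hd gH s1P t0 ff ltI lY YY sY cY iY jY.
  set Ti := [set t | _]; set Tj := [set t | _] => cij.
  have : 0 < #|Ti| by apply/card_gt0P; exists t0; rewrite inE eqxx linked_refl.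
  by rewrite cij => /card_gt0P[t]; rewrite inE => /andP[/eqP <- ?]; exists t.
have z_inj : injective z.
  by move=> j j' e; apply/val_inj; case: (zP j) => <- _; case: (zP j') => <- _; rewrite e.
apply: leq_trans bi _; rewrite -[leqLHS]card_sig -(card_codom z_inj).
apply: subset_leq_card; apply/fintype.subsetP => t /codomP[j ->]; rewrite inE.
by case: (zP j).
Qed.

(** The change of frame is a local similarity, so it carries the small balls around the common point
    to balls. *)
Lemma sub_compare I J (f : I * C -> P) (g : J * C -> P) i j x y : hom f -> hom g ->
  f (i, x) = g (j, y) -> exists N, forall n, N <= n ->
  exists v, sim (sub (chart f i) (mkseq x n)) (sub (chart g j) v).
Proof.
move=> hf hg e; have [g' [hg' gg' g'g]] := hom_inv hg.
have [N NP] := hom_ls (hom_comp hd hf hg'); exists N => n Nn.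
have [|j' [v [a [ia E]]]] := NP i (mkseq x n); first by rewrite size_mkseq.
have ej : j' = j.
  have := E (sdrop n x); rewrite (scat_mkseq hd) /= e gg' => -[-> _]; by [].
exists v, a => //; apply/funext => z.
by have := congr1 g (E z); rewrite /= g'g ej.
Qed.

Lemma sim_dis b1 b2 b1' b2' : sim b1 b1' -> sim b2 b2' -> dis b1 b2 -> dis b1' b2'.
Proof.
by move=> s1' s2' D p /(sim_img _ s1') h /(sim_img _ s2'); exact: D.
Qed.

Lemma clique_class K (F : K * C -> P) (U : finType) (z : U -> K) (Z : {set U}) :
  injective z -> 2 < #|Z| ->
  (forall u v w, u \in Z -> v \in Z -> w \in Z -> u != v -> v != w -> w != u ->
    cyc (chart F (z u)) (chart F (z v)) (chart F (z w))) ->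
  forall u, u \in Z -> #|Z| <= #|lclass F (z u)|.
Proof.
move=> z_inj Z2 cZ u uZ; rewrite -(card_imset _ z_inj); apply: subset_leq_card.
apply/fintype.subsetP => k /imsetP[v vZ ->]; rewrite inE.
have [->|vu] := eqVneq v u; first exact: linked_refl.
have [w [wZ wu wv]] : exists w, [/\ w \in Z, w != u & w != v].
  apply: contrapT => no; move: Z2; rewrite ltnNge => /negP; apply.
  apply: (@leq_trans #|[set u; v]|); last by rewrite cards2; case: (u != v).
  apply: subset_leq_card; apply/fintype.subsetP => w wZ; rewrite !inE.
  apply: contrapT => /negP; rewrite negb_or => /andP[? ?]; apply: no; by exists w.
apply/linkedP; right; exists (z w); rewrite !(inj_eq z_inj); split=> //.
by apply: cZ => //; rewrite eq_sym.
Qed.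

Definition depth := s1 * big.

Lemma depth_le : s1 * big <= d ^ depth.
Proof. by apply: ltnW; exact: ltn_expl. Qed.

Definition dig I (u : I) n (x : I) := if x == u then n + depth else 0.

(** The ball of depth [n] around [x] in the piece [u] has at least s1 * big sub-balls [depth] levels
    further down, among which [linked_class] selects linked ones. *)
Lemma tiny_clique I (f : I * C -> P) u n (x : C) : frame f -> s1 < #|I| ->
  exists Z : {set ref_idx d (dig u n)}, [/\ big <= #|Z|,
    {in Z &, forall t t', linked (f \o rmp (l := dig u n)) t t'} &
    forall t, t \in Z -> tag t = u /\
      exists2 w, size w = depth & (tagged t : seq _) = mkseq x n ++ w].
Proof.
move=> ff ltI; set l := dig u n; have fF := frame_ref hd l ff.
have ltF := leq_trans ltI (card_ref_le hd l).
have lu : l u = n + depth by rewrite /l /dig eqxx.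
pose z (w : depth.-tuple 'I_d) := mkt l u (scat (mkseq x n ++ w) (stream0 hd)).
have zw w : (tagged (z w) : seq _) = mkseq x n ++ w.
  have e : size (mkseq x n ++ w) = l u by rewrite size_cat size_mkseq size_tuple.
  by rewrite /= -e scatK.
have z_inj : injective z.
  move=> w w' /(congr1 (fun t : ref_idx d l => (tagged t : seq 'I_d))).
  by rewrite !zw => /eqP; rewrite eqseq_cat// eqxx /= => /eqP/val_inj.
pose Z0 := z @: [set: depth.-tuple 'I_d].
have [||t0 t0Z bt0] := linked_class gH s1P fF.1 fF.2 ltF (Z := Z0) (m := big).
- by rewrite card_imset// cardsT card_tuple card_ord depth_le.
- by [].
exists [set t in Z0 | linked (f \o rmp (l := l)) t0 t]; split=> //.
- move=> t t'; rewrite !inE => /andP[_ h] /andP[_ h'].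
  by apply: (linked_trans gH fF.1 _ h'); rewrite (linked_sym gH).
- move=> t; rewrite inE => /andP[/imsetP[w _ ->] _]; split=> //.
  by exists w; [rewrite size_tuple|rewrite zw].
Qed.

(** A 3-cycle of balls does not depend on a frame. Close to [x] the family [Z] also consists of
    pieces of a refinement of the frame [g] that witnesses that the ball is good. There the class of
    [Z] and the class of the good piece are both large, hence equal by [oneP]. *)
Lemma attach I (f : I * C -> P) i u x : frame f -> s1 < #|I| -> good (chart f i) -> i != u ->
  exists N, forall n, N <= n -> forall Z : {set ref_idx d (dig u n)}, big <= #|Z| ->
    {in Z &, forall t t', linked (f \o rmp (l := dig u n)) t t'} ->
    (forall t, t \in Z -> tag t = u /\
      exists2 w, size w = depth & (tagged t : seq _) = mkseq x n ++ w) ->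
    forall t t', t \in Z -> t' \in Z -> t != t' ->
    cyc (chart f i) (chart (f \o rmp (l := dig u n)) t) (chart (f \o rmp (l := dig u n)) t').
Proof.
move=> ff ltI [J [g [a [fg ltJ ba sia]]]] iu.
have [g' [hg' gg' g'g]] := hom_inv fg.1.
pose q := g' (f (u, x)); have eq : f (u, x) = g (q.1, q.2) by rewrite -surjective_pairing g'g.
have qa : q.1 != a.
  apply/eqP => qa; apply: (hom_dis ff.1 iu) (_ : img (chart f u) (f (u, x))); last by exists x.
  by apply/(sim_img _ sia); exists q.2; rewrite /chart -qa -eq.
have [N NP] := sub_compare ff.1 fg.1 eq; exists N => n Nn Z bZ ZZ Zw.
set l := dig u n in Z bZ ZZ Zw *; set F := f \o rmp (l := l) in ZZ Zw *.
have fF : frame F := frame_ref hd l ff.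
have [v vs] := NP n Nn.
pose lg := dig q.1 (size v); pose G := g \o rmp (l := lg).
have fG : frame G := frame_ref hd lg fg.
have ltG := leq_trans ltJ (card_ref_le hd lg).
have lgq : lg q.1 = size v + depth by rewrite /lg /dig eqxx.
have /choice[z zP] (t : {t | t \in Z}) : exists t' : ref_idx d lg,
    tag t' = q.1 /\ sim (chart F (val t)) (chart G t').
  case: t => t tZ /=; have [tu [w sw tw]] := Zw t tZ.
  have [w' sw' s'] := sim_sub hd w vs.
  exists (mkt lg q.1 (scat (v ++ w') (stream0 hd))); split=> //.
  rewrite chart_mkt chart_rmp tw tu sub_cat.
  have e : size (v ++ w') = lg q.1 by rewrite size_cat sw' sw.
  by rewrite -e scatK// sub_cat.
have ncyc_z t t' t'' : t \in Z -> t' \in Z -> t'' \in Z -> t != t' -> t' != t'' -> t'' != t ->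
    cyc (chart F t) (chart F t') (chart F t'').
  by move=> tZ t'Z t''Z n1 n2 n3; apply: (linked_triple gH fF.1 n1 n2 n3); exact: ZZ.
have z_inj : injective z.
  move=> t t' e; apply/val_inj; apply: contrapT => /eqP tt'.
  have [_ e1] := zP t; have [_ e2] := zP t'; rewrite -e in e2.
  have := hom_dis fF.1 tt'; move/(sim_dis e1 e2) => D.
  by apply: (D (chart G (z t) (stream0 hd))); exists (stream0 hd).
have Z3 : 2 < #|Z| by apply: leq_trans bZ; apply: ltn_trans bigM; exact: ltn_trans M4.
have bigz t : M <= #|lclass G (z t)|.
  have cS : #|{: {t | t \in Z}}| = #|Z| by rewrite card_sig.
  apply: (@leq_trans #|[set: {t | t \in Z}]|); first by rewrite cardsT cS (leq_trans _ bZ)// ltnW// bigM.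
  apply: clique_class => //; first by rewrite cardsT cS.
  move=> t1 t2 t3 _ _ _ n1 n2 n3.
  apply: (cyc_sim gH (zP t1).2 (zP t2).2 (zP t3).2).
  by apply: ncyc_z; rewrite ?(valP t1) ?(valP t2) ?(valP t3) ?(inj_eq val_inj).
pose y (j : J) := mkt lg j (stream0 hd).
have y_inj : injective y by move=> j j' /mkt_inj.
have chy j : j != q.1 -> chart G (y j) = chart g j.
  by move=> jq; rewrite chart_mkt /lg /dig (negPf jq) sub0.
pose A := lclass g a :\ q.1.
have aA : a \in A by rewrite !inE eq_sym qa linked_refl.
have cA : M <= #|A|.
  rewrite -ltnS; apply: leq_trans bigM _; apply: leq_trans ba _.
  by rewrite (cardsD1 q.1) -/A -addn1 addnC leq_add2l leq_b1.
have biga : M <= #|lclass G (y a)|.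
  apply: (leq_trans cA); apply: clique_class => //.
    by apply: leq_trans cA; exact: ltn_trans M4.
  move=> j1 j2 j3; rewrite !inE => /andP[q1 a1] /andP[q2 a2] /andP[q3 a3] n1 n2 n3.
  rewrite !chy//; apply: (linked_triple gH fg.1 n1 n2 n3).
    by apply: (linked_trans gH fg.1 _ a2); rewrite (linked_sym gH).
  by apply: (linked_trans gH fg.1 _ a3); rewrite (linked_sym gH).
move=> t t' tZ t'Z tt'.
pose st := exist _ t tZ : {t | t \in Z}; pose st' := exist _ t' t'Z : {t | t \in Z}.
have sia' : sim (chart G (y a)) (chart f i) by rewrite chy 1?eq_sym//; exact: sim_sym.
apply: (cyc_sim gH sia' (sim_sym (zP st).2) (sim_sym (zP st').2)).
have tagy : tag (y a) = a by [].
apply: (linked_triple gH fG.1).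
- apply/eqP => e; have [e1 _] := zP st; rewrite -e tagy in e1.
  by rewrite e1 eqxx in qa.
- by rewrite (inj_eq z_inj); apply: contraNneq tt' => /(congr1 val) /= ->.
- apply/eqP => e; have [e1 _] := zP st'; rewrite e tagy in e1.
  by rewrite e1 eqxx in qa.
- exact: oneP.
- exact: oneP.
Qed.

(** The three good pieces are attached to one and the same tiny family inside the spare piece [u],
    hence linked to each other. *)
Lemma good_cyc I (f : I * C -> P) i j l u : frame f -> s1 < #|I| ->
  good (chart f i) -> good (chart f j) -> good (chart f l) ->
  i != j -> j != l -> l != i -> i != u -> j != u -> l != u ->
  cyc (chart f i) (chart f j) (chart f l).
Proof.
move=> ff ltI gi gj gl ij jl li iu ju lu.
have [Ni NiP] := attach (stream0 hd) ff ltI gi iu.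
have [Nj NjP] := attach (stream0 hd) ff ltI gj ju.
have [Nl NlP] := attach (stream0 hd) ff ltI gl lu.
pose n := maxn Ni (maxn Nj Nl).
have [Z [bZ ZZ Zw]] := tiny_clique u n (stream0 hd) ff ltI.
have fF := frame_ref hd (dig u n) ff; set F := f \o _ in fF ZZ.
have /card_gt1P[t [t' [tZ t'Z tt']]] : 1 < #|Z|.
  by apply: leq_trans bZ; apply: ltn_trans bigM; apply: ltn_trans M4.
pose y (j : I) := mkt (dig u n) j (stream0 hd).
have chy k : k != u -> chart F (y k) = chart f k.
  by move=> ku; rewrite chart_mkt /dig (negPf ku) sub0.
have tagn s k : s \in Z -> k != u -> s != y k.
  move=> sZ ku; have [su _] := Zw s sZ; apply: contraNneq ku => e.
  by rewrite -su e.
have lk k N : k != u -> N <= n -> (forall n, N <= n -> forall Z : {set ref_idx d (dig u n)}, big <= #|Z| ->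
    {in Z &, forall t t', linked (f \o rmp (l := dig u n)) t t'} ->
    (forall t, t \in Z -> tag t = u /\
      exists2 w, size w = depth & (tagged t : seq _) = mkseq (stream0 hd) n ++ w) ->
    forall t t', t \in Z -> t' \in Z -> t != t' ->
    cyc (chart f k) (chart (f \o rmp (l := dig u n)) t) (chart (f \o rmp (l := dig u n)) t')) ->
    linked F (y k) t.
  move=> ku Nn /(_ n Nn Z bZ ZZ Zw t t' tZ t'Z tt') c.
  apply/linkedP; right; exists t'; split; [exact: tagn|by rewrite eq_sym|].
  by rewrite /cyc_at chy.
have li' := lk i Ni iu (leq_maxl _ _) NiP.
have lj' := lk j Nj ju ltac:(by rewrite leq_max leq_maxl orbT) NjP.
have ll' := lk l Nl lu ltac:(by rewrite leq_max leq_maxr orbT) NlP.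
rewrite -(chy i)// -(chy j)// -(chy l)//.
have y_inj : injective y by move=> k k' /mkt_inj.
apply: (linked_triple gH fF.1); rewrite ?(inj_eq y_inj)//.
  by apply: (linked_trans gH fF.1 li'); rewrite (linked_sym gH).
by apply: (linked_trans gH fF.1 li'); rewrite (linked_sym gH).
Qed.

End Good.

(** * Points without a good neighbourhood *)

Section Bad.
Variables (d : nat) (hd : 1 < d) (I0 : finType).
Local Notation C := (stream d).
Local Notation P := (I0 * C)%type.
Implicit Types (I J K : finType) (b : C -> P).
Variable HH : (P -> P) -> Prop.
Hypotheses (gH : homgroup HH).
Variables s1 M : nat.
Hypothesis s1pos : 0 < s1.
Hypothesis s1P : cyc_bound HH s1.
Hypothesis M4 : 4 < M.
Hypothesis oneP : forall I (f : I * C -> P) i0 i1, frame f -> s1 < #|I| ->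
  M <= #|lclass HH f i0| -> M <= #|lclass HH f i1| -> linked HH f i0 i1.
Local Notation linked := (linked HH).
Local Notation lclass := (lclass HH).
Local Notation cyc := (cyc HH).
Local Notation good := (good HH s1 M).
Local Notation big := (big s1 M).

Lemma sim_glue T (b b' : C -> T) :
  (forall a : 'I_d, sim (sub b [:: a]) (sub b' [:: a])) -> sim b b'.
Proof.
move=> s; have /choice[e eP] (a : 'I_d) : exists e, isom e /\ sub b [:: a] = sub b' [:: a] \o e.
  by have [e ? ?] := s a; exists e.
have /choice[e' e'P] (a : 'I_d) : exists e', [/\ isom e', cancel (e a) e' & cancel e' (e a)].
  by apply: isom_inv; case: (eP a).
pose glue (c : 'I_d -> C -> C) x := scat [:: x 0] (c (x 0) (sdrop 1 x)).
have ne c : (forall a, isom (c a)) -> nonexp (glue c).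
  move=> ic [//|n] x y xy; rewrite /glue (xy 0)//; apply/(@agree_scat _ hd [:: y 0] n).
  by apply: (isom_nonexp (ic _)) => i iN; rewrite /sdrop xy.
have gK c c' : (forall a, cancel (c a) (c' a)) -> cancel (glue c) (glue c').
  move=> cc' x; rewrite /glue -[1]/(size [:: x 0]) sdrop_scat cc'.
  by rewrite -[in RHS](scat_mkseq hd 1 x).
exists (glue e).
  by exists (glue e'); split; [apply: gK => a; case: (e'P a)|apply: gK => a; case: (e'P a)|
    apply: ne => a; case: (eP a)|apply: ne => a; case: (e'P a)].
apply/funext => x /=; rewrite /glue -{1}(scat_mkseq hd 1 x).
by have [_ /(congr1 (@^~ (sdrop 1 x)))] := eP (x 0).
Qed.

(** Let y and y' belong to a tiny linked family inside another piece. For each letter a, [good_cyc]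
    gives a 3-cycle of the a-th children of the ball, of y and of y'. These cycles have disjoint
    supports, and their product is a 3-cycle of the three balls themselves, which joins the ball to
    a large class. *)
Lemma good_of_children I (f : I * C -> P) i : frame f -> s1 < #|I| ->
  (forall a : 'I_d, good (sub (chart f i) [:: a])) -> good (chart f i).
Proof.
move=> ff ltI gi.
have [u ui] : exists u, u != i.
  have /card_gt1P[x [y [_ _ xy]]] : 1 < #|I| by exact: leq_ltn_trans s1pos ltI.
  by have [xi|xi] := eqVneq x i; [exists y; rewrite -xi eq_sym|exists x].
have [Y [bY YY Yu]] := tiny_clique hd gH M s1P u 0 (stream0 hd) ff ltI.
set l := dig s1 M u 0 in Y bY YY Yu; set F := f \o rmp (l := l) in YY.
have fF : frame F := frame_ref hd l ff; have ltF := leq_trans ltI (card_ref_le hd l).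
pose i' := mkt l i (stream0 hd).
have chi : chart F i' = chart f i.
  by rewrite chart_mkt /l /dig eq_sym (negPf ui) sub0.
have i'Y t : t \in Y -> i' != t.
  by move=> tY; have [tu _] := Yu t tY; apply: contraNneq ui => e; rewrite -tu -e.
have lY t : t \in Y -> big <= #|lclass F t|.
  move=> tY; apply: leq_trans bY _; apply: subset_leq_card; apply/fintype.subsetP => t' t'Y.
  by rewrite inE; exact: YY.
have gY t : t \in Y -> good (chart F t).
  move=> tY; exists (ref_idx d l), F, t; split=> //; [exact: lY|exact: sim_refl].
have cY y y' : y \in Y -> y' \in Y -> y != y' -> cyc (chart F i') (chart F y) (chart F y').
  move=> yY y'Y yy'.
  pose l1 (x : ref_idx d l) := 1; pose F1 := F \o rmp (l := l1).
  have fF1 : frame F1 := frame_ref hd l1 fF; have ltF1 := leq_trans ltF (card_ref_le hd l1).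
  pose z x a := mkt l1 x (scat [:: a] (stream0 hd)).
  have cz x a : chart F1 (z x a) = sub (chart F x) [:: a] by [].
  have z_inj x x' a a' : z x a = z x' a' -> x = x' /\ a = a'.
    move=> e; split; first exact: mkt_inj e.
    by have := congr1 (fun t : ref_idx d l1 => (tagged t : seq 'I_d)) e => -[].
  have gz a : good (chart F1 (z i' a)) by rewrite cz chi.
  have gzY t a : t \in Y -> good (chart F1 (z t a)).
    by move=> tY; rewrite cz; apply: good_sub => //; exact: gY.
  have cz3 a : cyc (chart F1 (z i' a)) (chart F1 (z y a)) (chart F1 (z y' a)).
    (* A second child of [i'] serves as the spare piece for [good_cyc]. *)
    have [a' aa'] : exists a', a' != a.
      by have [e|e] := eqVneq (letter0 hd) a; [exists (letter1 hd); rewrite -e|exists (letter0 hd)].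
    apply: (good_cyc hd gH s1P M4 oneP (u := z i' a') fF1 ltF1) => //; [exact: gzY|exact: gzY|..];
      apply/eqP => /z_inj[]; try by move=> e; rewrite ?e eqxx in yy'.
    - by move/eqP: (i'Y _ yY).
    - by move=> e; have := i'Y _ y'Y; rewrite e eqxx.
    - by move=> _ e; rewrite e eqxx in aa'.
    - by move=> e; have := i'Y _ yY; rewrite e eqxx.
    - by move=> e; have := i'Y _ y'Y; rewrite e eqxx.
  suff [h hh [hm hfix]] : exists2 h, HH h &
      (forall a, a \in enum 'I_d -> [/\ moves h (chart F1 (z i' a)) (chart F1 (z y a)),
        moves h (chart F1 (z y a)) (chart F1 (z y' a)) &
        moves h (chart F1 (z y' a)) (chart F1 (z i' a))]) /\
      forall t, (forall a, a \in enum 'I_d -> t \notin [:: z i' a; z y a; z y' a]) ->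
        h \o chart F1 t = chart F1 t.
    have mg x x' : (forall a, moves h (chart F1 (z x a)) (chart F1 (z x' a))) ->
        moves h (chart F x) (chart F x').
      by move=> m; apply: sim_glue => a; exact: m.
    exists h => //; split.
    - by apply: mg => a; case: (hm a); rewrite ?mem_enum.
    - by apply: mg => a; case: (hm a); rewrite ?mem_enum.
    - by apply: mg => a; case: (hm a); rewrite ?mem_enum.
    - move=> p n1 n2 n3.
      have [g [_ _ gF]] := hom_inv fF.1.
      set x := (g p).1; have px : p = sub (chart F x) [:: (g p).2 0] (sdrop 1 (g p).2).
        have e := scat_mkseq hd 1 (g p).2; rewrite /sub /chart.
        rewrite -[scat _ _]/(scat (mkseq (g p).2 1) (sdrop 1 (g p).2)) e.
        by rewrite -surjective_pairing gF.
      have nx q : ~ img (chart F q) p -> x <> q.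
        by move=> n e; apply: n; rewrite -e px; eexists.
      have := hfix (z x ((g p).2 0)) _; rewrite cz => /(_ _)/(congr1 (@^~ (sdrop 1 (g p).2))).
      rewrite /= -px; apply => a _; rewrite !inE !negb_or; apply/and3P; split;
        by apply/eqP => /z_inj[/nx].
  have : uniq (enum 'I_d) by exact: enum_uniq.
  elim: (enum 'I_d) => [|a s IH] /=.
    by move=> _; exists id; [exact: (hg1 gH)|split].
  move=> /andP[as_ /IH[h hh [hm hfix]]].
  have [c hc [c1 c2 c3 ce]] := cz3 a.
  have cfix t : t \notin [:: z i' a; z y a; z y' a] -> c \o chart F1 t = chart F1 t.
    rewrite !inE !negb_or => /and3P[n1 n2 n3]; exact: (cyc_fixed fF1.1 n1 n2 n3 ce).
  have ha x a' : x \in [:: i'; y; y'] -> a' \notin s -> h \o chart F1 (z x a') = chart F1 (z x a').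
    move=> _ a's; apply: hfix => a1 a1s; rewrite !inE !negb_or; apply/and3P; split;
      by apply/eqP => /z_inj[_ e]; rewrite e a1s in a's.
  have ca x a' : a' != a -> c \o chart F1 (z x a') = chart F1 (z x a').
    move=> a'a; apply: cfix; rewrite !inE !negb_or; apply/and3P; split;
      by apply/eqP => /z_inj[_ e]; rewrite e eqxx in a'a.
  exists (c \o h); first exact: (hgM gH).
  have step x x' a' : x \in [:: i'; y; y'] -> a' \in a :: s ->
      moves c (chart F1 (z x a)) (chart F1 (z x' a)) ->
      (a' \in s -> moves h (chart F1 (z x a')) (chart F1 (z x' a'))) ->
      moves (c \o h) (chart F1 (z x a')) (chart F1 (z x' a')).
    move=> xx; rewrite inE => /predU1P[->|a's] mc mh.
      by apply: moves_comp mc; rewrite /moves ha//; exact: sim_refl.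
    apply: (moves_comp (mh a's)); rewrite /moves ca; first exact: sim_refl.
    by apply: contraNneq as_ => <-.
  split.
  - move=> a' a's; split; apply: step => //; rewrite ?inE ?eqxx ?orbT// => h';
      by case: (hm _ h').
  - move=> t tn; rewrite -[LHS]/(c \o (h \o chart F1 t)) hfix; last first.
      by move=> a' a's; apply: tn; rewrite inE a's orbT.
    by apply: cfix; apply: tn; rewrite inE eqxx.
have [y yY] : exists y, y \in Y by apply/card_gt0P; exact: leq_trans bY.
have [y' [y'Y yy']] : exists y', y' \in Y /\ y != y'.
  have /card_gt1P[p [q [pY qY pq]]] : 1 < #|Y|.
    by apply: leq_trans bY; apply: ltn_trans (bigM s1 M); exact: ltn_trans M4.
  by have [e|e] := eqVneq y p; [exists q; rewrite e|exists p].
exists (ref_idx d l), F, i'; split=> //; last by rewrite chi; exact: sim_refl.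
have -> : lclass F i' = lclass F y.
  apply: (linked_same gH fF.1); apply/linkedP; right; exists y'; split.
  - by rewrite eq_sym i'Y.
  - by rewrite eq_sym.
  - exact: cY.
exact: lY.
Qed.

(* It will turn out that there is at most one such point, fixed by HH. *)
Definition bad p := forall b, good b -> ~ img b p.

Lemma bad_moves h p : HH h -> bad p -> bad (h p).
Proof.
move=> hh bp b gb hb; have [g hg [gh _]] := hgV gH hh.
apply: (bp (g \o b)); last by rewrite -(gh p); case: hb => x <-; exists x.
by apply: (good_moves hd gH hg _ gb); exact: sim_refl.
Qed.

Lemma bad_not_good I (f : I * C -> P) i x : bad (f (i, x)) -> ~ good (chart f i).
Proof. by move=> bf /bf; apply; exists x. Qed.

(** By [good_of_children] a piece that is not good has a child that is not good, and so on down to a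
    point. A good ball around this point would contain one of these nested balls, which would be
    good by [good_sub]. *)
Lemma good_or_bad I (f : I * C -> P) i : frame f -> s1 < #|I| ->
  good (chart f i) \/ exists x, bad (f (i, x)).
Proof.
move=> ff ltI; have [|ng] := pselect (good (chart f i)); [by left|right].
have /choice[e eP] (w : seq 'I_d) : exists a, ~ good (sub (chart f i) w) ->
    ~ good (sub (chart f i) (rcons w a)).
  have [gw|gw] := pselect (good (sub (chart f i) w)); first by exists (letter0 hd).
  apply: contrapT => no; apply: gw.
  pose l (x : I) := size w; have fF := frame_ref hd l ff.
  have ltF := leq_trans ltI (card_ref_le hd l).
  have chw : sub (chart f i) w = chart (f \o rmp (l := l)) (mkt l i (scat w (stream0 hd))).
    by rewrite chart_mkt /l scatK.
  rewrite chw; apply: good_of_children => // a; rewrite -chw -sub_cat cats1.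
  by apply: contrapT => na; apply: no; exists a.
pose w := fix w n := if n is m.+1 then rcons (w m) (e (w m)) else [::].
have sw n : size (w n) = n by elim: n => //= n IH; rewrite size_rcons IH.
pose x : C := fun n => e (w n).
have wE n : w n = mkseq x n by elim: n => // n IH; rewrite mkseqS -IH.
have ngw n : ~ good (sub (chart f i) (mkseq x n)).
  rewrite -wE; elim: n => [|n IH]; first by rewrite sub0.
  exact: eP.
exists x => b [J [g [j [fg ltJ bj sb]]]] bx.
have [y ey] : img (chart g j) (f (i, x)) by exact/(sim_img _ sb).
have [N NP] := sub_compare hd ff.1 fg.1 (esym ey).
have [v sv] := NP N (leqnn N); apply: (ngw N); apply: (good_sim (sim_sym sv)).
by apply: good_sub => //; exists J, g, j; split=> //; exact: sim_refl.
Qed.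

(** By [linked_class] one of s1 * big pieces would have a large class, hence be good. *)
Lemma few_bad_pieces I (f : I * C -> P) (Z : {set I}) : frame f -> s1 < #|I| ->
  (forall i, i \in Z -> exists x, bad (f (i, x))) -> #|Z| < s1 * big.
Proof.
move=> ff ltI bZ; rewrite ltnNge; apply/negP => sZ.
have [//|i iZ bi] := linked_class gH s1P ff.1 ff.2 ltI sZ.
have [x /bad_not_good] := bZ i iZ; apply; exists I, f, i; split=> //; last exact: sim_refl.
apply: leq_trans bi _; apply: subset_leq_card; apply/fintype.subsetP => j.
by rewrite !inE => /andP[].
Qed.

Lemma few_bad (z : 'I_(s1 * big) -> P) : injective z -> (forall j, bad (z j)) -> False.
Proof.
move=> z_inj bz.
have /choice[N NP] (ij : 'I_(s1 * big) * 'I_(s1 * big)) : exists N, forall n, N <= n ->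
    ij.1 != ij.2 -> mkt (fun=> n) (z ij.1).1 (z ij.1).2 != mkt (fun=> n) (z ij.2).1 (z ij.2).2.
  case: ij => i j /=; apply: contrapT => no.
  have all n : (z i).1 = (z j).1 /\ agree n (z i).2 (z j).2 /\ i != j.
    apply: contrapT => nn; apply: no; exists n => m nm ij; apply/eqP => e; apply: nn.
    split; first exact: (mkt_inj e).
    split=> //; apply: (agree_le nm); apply/(agreeP hd).
    exact: (congr1 (fun t : ref_idx d (fun=> m) => (tagged t : seq 'I_d)) e).
  have [e1 [_ /eqP]] := all 0; apply; apply: z_inj.
  rewrite (surjective_pairing (z i)) (surjective_pairing (z j)) e1; congr (_, _).
  by apply: agree_all => n; case: (all n) => _ [].
(* Deep enough to separate the given points and, because of the summand [s1], to have more than [s1]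
   pieces. *)
pose n := s1 + \max_ij N ij.
have card0 : 0 < s1 * big by rewrite muln_gt0 s1pos.
pose l (x : I0) := n; pose F := @id P \o rmp (l := l).
have fid : frame (@id P) by split=> //; exact: hom_id.
have fF : frame F := frame_ref hd l fid.
have ltF : s1 < #|ref_idx d l|.
  apply: (leq_trans _ (@card_ref_ge d I0 l (z (Ordinal card0)).1)).
  by apply: (@leq_ltn_trans n); [exact: leq_addr|exact: ltn_expl].
pose t j := mkt l (z j).1 (z j).2.
have t_inj : injective t.
  move=> i j e; apply: contrapT => /eqP ij.
  have hN : N (i, j) <= n.
    by apply: leq_trans (leq_addl _ _); exact: (leq_bigmax (i, j)).
  by have := NP (i, j) n hN ij; rewrite /= -/(t i) -/(t j) e eqxx.
have badZ i : i \in t @: [set: 'I_(s1 * big)] -> exists x, bad (F (i, x)).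
  move=> /imsetP[j _ ->]; exists (sdrop n (z j).2).
  by rewrite /F /rmp /cmap /= (scat_mkseq hd) -surjective_pairing; exact: bz.
by have := few_bad_pieces fF ltF badZ; rewrite card_imset// cardsT card_ord ltnn.
Qed.

End Bad.

Lemma codom_split (U K : finType) (z : U -> K) : injective z ->
  exists s : U + {k : K | k \notin codom z} -> K, bijective s /\ forall u, s (inl u) = z u.
Proof.
move=> z_inj; pose s (t : U + {k : K | k \notin codom z}) :=
  match t with inl u => z u | inr k => val k end.
exists s; split=> //; apply: inj_card_bij.
  move=> [u|k] [u'|k'] /=.
  - by move=> /z_inj ->.
  - by move=> e; exfalso; have := valP k'; rewrite /= -e codom_f.
  - by move=> e; exfalso; have := valP k; rewrite /= e codom_f.
  - by move=> e; congr inr; exact: val_inj.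
rewrite card_sum card_sig -(cardC (mem (codom z))) card_codom// leq_add2l.
Qed.

Lemma perm_extend (U K : finType) (z z' : U -> K) : injective z -> injective z' ->
  exists s : {perm K}, forall u, s (z u) = z' u.
Proof.
move=> zi z'i; have [t [[t' tt' t't] tz]] := codom_split zi.
have [v [[v' vv' v'v] vz]] := codom_split z'i.
have e (w : U -> K) : injective w -> #|{: {k | k \notin codom w}}| = #|K| - #|U|.
  move=> wi; rewrite card_sig -(cardC (mem (codom w))) card_codom// addKn.
  exact: eq_card.
have [b bb] : exists b : {k | k \notin codom z} -> {k | k \notin codom z'}, bijective b.
  by apply: hom_eq_card; rewrite !e.
pose c k := v (match t' k with inl u => inl u | inr y => inr (b y) end).
have c_inj : injective c.
  move=> k k' /(can_inj vv'); rewrite -{2}(t't k) -{2}(t't k').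
  case: (t' k) => [u|y]; case: (t' k') => [u'|y'] //; first by move=> [->].
  by move=> [/(bij_inj bb) ->].
by exists (perm c_inj) => u; rewrite permE /c -tz tt' vz.
Qed.

(** * Generation by piecewise isometries *)

Section Generate.
Variables (d : nat) (hd : 1 < d) (I0 : finType).
Local Notation C := (stream d).
Local Notation P := (I0 * C)%type.
Implicit Types (I J K : finType).
Variable HH : (P -> P) -> Prop.
Hypotheses (gH : homgroup HH).
Variables (B : P -> Prop) (n1 : nat).
Hypothesis BH : forall h p, HH h -> B p -> B (h p).
Hypothesis WH : forall J (F : J * C -> P) (s : J -> J) phi, frame F -> n1 <= #|J| ->
  hom phi -> (forall j, moves phi (chart F j) (chart F (s j))) ->
  (forall p, B p -> B (phi p)) -> HH phi.

Variables (I : finType) (f : I * C -> P).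
Hypotheses (ff : frame f) (cI : n1 <= #|I|).

Definition tainted (i : I) := exists x, B (f (i, x)).

(* the codes of the frames obtained from f by cutting the pieces that are not tainted *)
Definition gcode J (c : J -> I * seq 'I_d) := [/\ bijective (cmap c),
  forall j, tainted (c j).1 -> (c j).2 = [::] & #|J| = #|I0| %[mod d.-1]].

Lemma gcode_hom J (c : J -> I * seq 'I_d) : gcode c -> hom (f \o cmap c).
Proof. by move=> [/(hom_cmap hd) hc _ _]; exact: (hom_comp hd hc ff.1). Qed.

Lemma gcode_card J (c : J -> I * seq 'I_d) : gcode c -> #|I| <= #|J|.
Proof.
move=> [[c' _ c'c] _ _].
pose z (i : I) := (c' (i, stream0 hd)).1.
have z_inj : injective z.
  have e i : (c (z i)).1 = i by have := c'c (i, stream0 hd); rewrite /cmap => -[].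
  exact: (@can_inj _ _ z (fun j => (c j).1) e).
by rewrite -(card_codom z_inj) max_card.
Qed.

(* the piece with the longest word has all its siblings *)
Lemma caret J (c : J -> I * seq 'I_d) : gcode c -> (exists j, (c j).2 <> [::]) ->
  exists K (t : 'I_d + K -> J) i u, [/\ bijective t,
    forall a, c (t (inl a)) = (i, rcons u a), ~ tainted i &
    gcode (fun x : unit + K => match x with inl _ => (i, u) | inr k => c (t (inr k)) end)].
Proof.
move=> [bc tc mc] [j0 /eqP j0n].
have [c' cc' c'c] := bc.
case: (@arg_maxnP J j0 predT (fun j => size (c j).2) isT) => j _ jmax.
case E : (c j) => [i w]; case/lastP: w E => [|u a0] E.
  by have := jmax j0 isT; rewrite E /= leqn0 size_eq0 (negPf j0n).
have nt : ~ tainted i by have := tc j; rewrite E /= => h /h; case: (u).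
have /choice[z zP] a : exists j', c j' = (i, rcons u a).
  case Eq : (c' (i, scat (rcons u a) (stream0 hd))) => [j' y].
  have := c'c (i, scat (rcons u a) (stream0 hd)); rewrite Eq /cmap /= => -[e1 e2].
  exists j'; case Ev : (c j') => [i' v] in e1 e2 *; rewrite /= in e1 e2; subst i'.
  congr (_, _).
  have sv : size v <= size (rcons u a).
    by rewrite size_rcons; have := jmax j' isT; rewrite Ev E /= size_rcons.
  have [v' [ev ey]] := scat_prefix hd sv e2.
  case/lastP: v' ev ey => [|v' b]; first by rewrite cats0.
  rewrite -rcons_cat => /rcons_inj[eu _] _; exfalso.
  have : cmap c (j', scat (rcons v' a0) (stream0 hd)) = cmap c (j, stream0 hd).
    by rewrite /cmap /= Ev E /= -scat_cat -rcons_cat -eu.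
  move=> /(can_inj cc')[jj _]; rewrite jj E in Ev; case: Ev => /(congr1 size).
  by rewrite size_rcons eu size_cat => /eqP; rewrite -addnS -{2}[size v]addn0 eqn_add2l.
have z_inj : injective z.
  by move=> a b e; have := zP a; rewrite e zP => -[/rcons_inj[]].
have [t [bt tz]] := codom_split z_inj.
have ctl a : c (t (inl a)) = (i, rcons u a) by rewrite tz zP.
exists {k : J | k \notin codom z}, t, i, u; split=> //; split.
- set ch := (X in cmap X).
  have e : cmap ch \o split_map (d := d) (A := _) = cmap c \o relab t.
    apply/funext => -[[a|k] x]; rewrite /split_map /cmap /relab /= ?ctl ?scat0//.
    by rewrite -scat_cat cats1.
  have [q [_ sq qs]] := hom_inv (hom_split hd {k : J | k \notin codom z}).
  have [t' tt' t't] := bt.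
  exists (split_map (A := _) \o (relab (d := d) t' \o c')) => [[x y]|p].
    have := congr1 (@^~ (q (x, y))) e; rewrite /= qs => ->.
    by rewrite cc' /relab /= tt' -surjective_pairing qs.
  have := congr1 (@^~ (relab (d := d) t' (c' p))) e; rewrite /= => ->.
  by rewrite /relab /= t't -surjective_pairing c'c.
- by move=> [[]|k] //= /tc.
- have := bij_eq_card bt; rewrite !card_sum card_ord card_unit => e.
  have dE X : 1 + X = d + X %[mod d.-1].
    have -> : d + X = d.-1 + (1 + X) by rewrite addnA addn1 (ltn_predK hd).
    by rewrite modnDl.
  by rewrite -mc -e dE.
Qed.

Lemma swap_pieces J (F : J * C -> P) j j' : frame F -> n1 <= #|J| ->
  (forall x, ~ B (F (j, x))) -> (forall x, ~ B (F (j', x))) ->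
  exists2 h, HH h & forall i, moves h (chart F i) (chart F (tperm j j' i)).
Proof.
move=> fF cJ nj nj'; have [q [hq Fq qF]] := hom_inv fF.1.
have br : bijective (tperm j j') by exact: injF_bij perm_inj.
have hr := hom_relab hd br.
pose phi := F \o (relab (tperm j j') \o q).
have phiF i x : phi (F (i, x)) = F (tperm j j' i, x) by rewrite /phi /= Fq.
have m i : moves phi (chart F i) (chart F (tperm j j' i)).
  exists id; first exact: isom_id.
  by apply/funext => x; exact: phiF.
exists phi => //; apply: (WH fF cJ _ m).
  by apply: (hom_comp hd _ fF.1); exact: (hom_comp hd hq hr).
move=> p; rewrite -(qF p); case: (q p) => i x; rewrite phiF.
by case: tpermP => [->/nj|->/nj'|].
Qed.

(** Induction on the number of pieces. Undoing one cut in each frame reduces it, and a swap makes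
    the two merged balls correspond, so that their children correspond too. The swapped balls avoid
    [B], because only untainted pieces are cut and [HH] preserves [B]. *)
Lemma gcode_trans n J J' (c : J -> I * seq 'I_d) (c' : J' -> I * seq 'I_d) :
  #|J| = n -> #|J'| = n -> gcode c -> gcode c' ->
  exists2 h, HH h & exists s : J -> J', forall j,
    moves h (chart (f \o cmap c) j) (chart (f \o cmap c') (s j)).
Proof.
elim/ltn_ind: n J J' c c' => n IH J J' c c' cJ cJ' gc gc'.
have small (L : finType) (e : L -> I * seq 'I_d) : gcode e -> (exists j, (e j).2 <> [::]) -> #|I| < #|L|.
  move=> ge ne; have [K [t [i [u [bt _ _ /gcode_card le]]]]] := caret ge ne.
  apply: leq_ltn_trans le _; rewrite -(bij_eq_card bt) !card_sum card_ord card_unit.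
  by rewrite ltn_add2r.
have surj (L : finType) (e : L -> I * seq 'I_d) : gcode e -> ~ (exists j, (e j).2 <> [::]) ->
    (forall j, (e j).2 = [::]) /\ #|L| <= #|I|.
  move=> [be _ _] no; have e0 j : (e j).2 = [::].
    by apply: contrapT => nj; apply: no; exists j.
  split=> //; have z_inj : injective (fun j => (e j).1).
    move=> j j' ee; have : cmap e (j, stream0 hd) = cmap e (j', stream0 hd).
      by rewrite /cmap /= ee !e0.
    by move=> /(bij_inj be)[].
  by rewrite -(card_codom z_inj) max_card.
have [nc|nc] := pselect (exists j, (c j).2 <> [::]); last first.
  have [c0 leJ] := surj _ _ gc nc.
  have nc' : ~ exists j, (c' j).2 <> [::].
    by move=> /(small _ _ gc'); rewrite cJ' -cJ ltnNge leJ.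
  have [c'0 _] := surj _ _ gc' nc'.
  exists id; first exact: (hg1 gH).
  have [[v _ vc] _ _] := gc'; exists (fun j => (v ((c j).1, stream0 hd)).1) => j.
  exists id; first exact: isom_id.
  apply/funext => x; rewrite /chart /= /cmap /= c0 c'0 scat0.
  have := vc ((c j).1, stream0 hd).
  by rewrite /cmap => -[-> _].
have nc' : exists j, (c' j).2 <> [::].
  apply: contrapT => no; have [_] := surj _ _ gc' no.
  by rewrite cJ' -cJ leqNgt (small _ _ gc nc).
have [K [t [i [u [bt ct nti gh]]]]] := caret gc nc.
have [K' [t' [i' [u' [bt' ct' nti' gh']]]]] := caret gc' nc'.
set ch := (X in gcode X) in gh; set ch' := (X in gcode X) in gh'.
have eK : d + #|K| = n by rewrite -cJ -(bij_eq_card bt) card_sum card_ord.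
have eK' : d + #|K'| = n by rewrite -cJ' -(bij_eq_card bt') card_sum card_ord.
have ltn1 : #|{: unit + K}| < n by rewrite card_sum card_unit -eK ltn_add2r.
have eKK : #|{: unit + K'}| = #|{: unit + K}|.
  rewrite !card_sum card_unit; congr (_ + _).
  by apply/eqP; rewrite -(eqn_add2l d) eK eK'.
have [h hh [s hs]] := IH _ ltn1 _ _ ch ch' erefl eKK gh gh'.
pose F := f \o cmap ch; pose F' := f \o cmap ch'.
have hF : hom F := gcode_hom gh; have hF' : hom F' := gcode_hom gh'.
have fF' : frame F' by split=> //; case: gh'.
have [g hg [gh_ hg_]] := hgV gH hh.
have nB' x : ~ B (F' (inl tt, x)).
  by move=> b; apply: nti'; eexists; exact: b.
have nBs x : ~ B (F' (s (inl tt), x)).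
  move=> b; have [y ey] := moves_img (moves_inv gh_ (hs (inl tt))) (ex_intro _ x erefl).
  apply: nti; exists (scat u y); have := BH hg b.
  by rewrite -[g _]ey.
have cK' : n1 <= #|{: unit + K'}| := leq_trans cI (gcode_card gh').
have [k hk ks] := swap_pieces fF' cK' nBs nB'.
pose h1 := k \o h; pose s' x := tperm (s (inl tt)) (inl tt) (s x).
have hh1 : HH h1 by exact: (hgM gH).
have hs1 x : moves h1 (chart F x) (chart F' (s' x)) := moves_comp (hs x) (ks _).
have s1tt : s' (inl tt) = inl tt by rewrite /s' tpermL.
have s'_inj x y : s' x = s' y -> x = y.
  move=> e; have [g1 hg1 [gh1 _]] := hgV gH hh1.
  apply/eqP; apply: contrapT => /negP xy.
  have m1 := moves_inv gh1 (hs1 x); have m2 := moves_inv gh1 (hs1 y); rewrite -e in m2.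
  have sxy := sim_trans (sim_sym m1) m2.
  apply: (hom_dis hF xy) (_ : img (chart F y) (chart F x (stream0 hd))); first by exists (stream0 hd).
  by apply/(sim_img _ sxy); exists (stream0 hd).
exists h1 => //.
suff /choice[r0 r0P] : forall j, exists j', moves h1 (chart (f \o cmap c) j) (chart (f \o cmap c') j') by exists r0.
have [r rt tr] := bt => j; rewrite -(tr j); case: (r j) => [a|y].
  have := hs1 (inl tt); rewrite s1tt => /(sim_sub hd [:: a])[[|a' []]]//= _ sa.
  exists (t' (inl a')).
  have -> : chart (f \o cmap c) (t (inl a)) = sub (chart F (inl tt)) [:: a].
    by apply/funext => x; rewrite /chart /sub /= /F /= /cmap /= ct /= -scat_cat cats1.
  have -> // : chart (f \o cmap c') (t' (inl a')) = sub (chart F' (inl tt)) [:: a'].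
  by apply/funext => x; rewrite /chart /sub /= /F' /= /cmap /= ct' /= -scat_cat cats1.
have := hs1 (inr y); case E : (s' (inr y)) => [[]|y'].
  by move: E; rewrite -s1tt => /s'_inj.
by exists (t' (inr y')).
Qed.

(** Cut the untainted pieces of [f] until [g] is a similarity on each; the images form a second such
    frame with equally many pieces. By [gcode_trans] some h in [HH] matches the two, and g^-1 h
    permutes the pieces of the first frame, so it is in [HH] by [WH]. *)
Lemma generate g : hom g -> (forall p, B p <-> B (g p)) ->
  (forall i, tainted i -> moves g (chart f i) (chart f i)) -> HH g.
Proof.
move=> hg Bg tg; have [v [hv fv vf]] := hom_inv ff.1.
have [m mP] := hom_ls (hom_comp hd ff.1 (hom_comp hd hg hv)).
pose l i := if `[< tainted i >] then 0 else m.
pose J := ref_idx d l; pose F := f \o rmp (l := l).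
have fF : frame F := frame_ref hd l ff.
have l0 i : tainted i -> l i = 0 by rewrite /l => /asboolT ->.
have /choice[c' c'P] (t : J) : exists ju, (tainted (tag t) -> ju = (tag t, [::])) /\
    exists2 a, isom a & forall x, g (F (t, x)) = f (ju.1, scat ju.2 (a x)).
  have [tt|nt] := pselect (tainted (tag t)).
    exists (tag t, [::]); split=> //; have [a ia e] := tg _ tt; exists a => // x.
    have w0 : (tagged t : seq 'I_d) = [::] by apply: size0nil; rewrite size_tuple l0.
    rewrite /F /rmp /= /cmap /= w0 !scat0; exact: (congr1 (@^~ x) e).
  have [|j [u [a [ia e]]]] := mP (tag t) (tagged t).
    by rewrite size_tuple /l; case: asboolP.
  exists (j, u); split=> //; exists a => // x.
  by have := congr1 f (e x); rewrite /= vf.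
have gc : gcode (@ref_code d I l).
  split; [|move=> t tt|by rewrite (card_ref_mod hd) ff.2].
    by have [q [_ ? ?]] := hom_inv (hom_rmp hd l); exists q.
  by apply: size0nil; rewrite size_tuple l0.
have /choice[a aP] (t : J) : exists a, isom a /\
    forall x, g (F (t, x)) = f ((c' t).1, scat (c' t).2 (a x)).
  by have [_ [a ? ?]] := c'P t; exists a.
have gF : g \o F = (f \o cmap c') \o pw id a.
  by apply/funext => -[t x]; case: (aP t) => _; exact.
have [w [hw gw wg]] := hom_inv hg.
have gc' : gcode c'.
  split; last by rewrite (card_ref_mod hd) ff.2.
  - have ha : hom (pw id a) by apply: (hom_pw hd); [exists id|move=> t; case: (aP t)].
    have [b [hb ab ba]] := hom_inv ha.
    have e : cmap c' = v \o (g \o (F \o b)).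
      apply/funext => p; have := congr1 (@^~ (b p)) gF; rewrite /= ba => ->.
      by rewrite fv.
    have := hom_inv (hom_comp hd hb fF.1).
    have h1 := hom_comp hd (hom_comp hd (hom_comp hd hb fF.1) hg) hv.
    by rewrite e; have [q [_ ? ?]] := hom_inv h1; exists q.
  - move=> t tt; have [t1 [a' ia' e]] := c'P t.
    have [tt'|nt] := pselect (tainted (tag t)); first by rewrite t1.
    exfalso; apply: nt; have [b /isom_inv[b' [ib' bb' b'b]] eb] := tg _ tt.
    set j := (c' t).1 in tt eb e *.
    have := congr1 (@^~ (b' (scat (c' t).2 (a' (stream0 hd))))) eb.
    rewrite /= b'b /chart -e => /(can_inj gw)/(can_inj fv).
    by move=> /(congr1 fst) /= <-.
have [h hh [s hs]] := gcode_trans erefl erefl gc gc'.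
pose phi := w \o h.
have hphi : HH phi.
  apply: (WH (F := F) (s := s) fF).
  - exact: leq_trans cI (card_ref_le hd l).
  - exact: (hom_comp hd (hg_hom gH hh) hw).
  - move=> t; apply: (moves_comp (hs t)); apply: (moves_inv gw).
    exists (a (s t)); first by case: (aP (s t)).
    by apply/funext => x; exact: (aP (s t)).2.
  - by move=> p bp; apply/Bg; rewrite /phi /= wg; exact: BH.
have [q hq [_ phiq]] := hgV gH hphi.
have -> : g = h \o q.
  by apply/funext => p; rewrite /= -[LHS](wg) -[in LHS](phiq p) /phi /= gw wg.
exact: (hgM gH).
Qed.

End Generate.

(** * Isometries and permutations on deeper levels *)

Section Deep.
Variables (d : nat) (hd : 1 < d) (I0 : finType).
Local Notation C := (stream d).
Local Notation P := (I0 * C)%type.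
Implicit Types (I J K : finType) (b : C -> P).

Lemma isom_glue m (c : seq 'I_d -> C -> C) : (forall w, isom (c w)) ->
  isom (fun x => scat (mkseq x m) (c (mkseq x m) (sdrop m x))).
Proof.
move=> ic; have /choice[c' c'P] w : exists e, [/\ isom e, cancel (c w) e & cancel e (c w)].
  by apply: isom_inv.
pose gl (e : seq 'I_d -> C -> C) x := scat (mkseq x m) (e (mkseq x m) (sdrop m x)).
have mk e x : mkseq (gl e x) m = mkseq x m.
  by have := scatK hd (mkseq x m) (e (mkseq x m) (sdrop m x)); rewrite size_mkseq.
have sd e x : sdrop m (gl e x) = e (mkseq x m) (sdrop m x).
  by have := sdrop_scat (mkseq x m) (e (mkseq x m) (sdrop m x)); rewrite size_mkseq.
have gK e e' : (forall w, cancel (e w) (e' w)) -> cancel (gl e) (gl e').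
  by move=> ee x; rewrite {1}/gl mk sd ee (scat_mkseq hd).
have ne e : (forall w, isom (e w)) -> nonexp (gl e).
  move=> ie n x y xy; have [mn|nm] := leqP m n.
    have /(agreeP hd) exy := agree_le mn xy.
    suff : agree (size (mkseq y m) + (n - m)) (gl e x) (gl e y) by rewrite size_mkseq subnKC.
    rewrite /gl exy; apply/(agree_scat hd).
    apply: (isom_nonexp (ie _)) => i iN; rewrite /sdrop xy//.
    by rewrite -(subnKC mn) ltn_add2l.
  have ag z : agree n z (gl e z).
    by apply: (agree_le (ltnW nm)); exact: (agree_mkseq hd).
  exact: agree_trans (agree_sym (ag x)) (agree_trans xy (ag y)).
exists (gl c'); split.
- by apply: gK => w; case: (c'P w).
- by apply: (gK c' c) => w; case: (c'P w).
- exact: ne.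
- by apply: ne => w; case: (c'P w).
Qed.

Lemma rmp_piso K r (a : ref_idx d (fun _ : K => r) -> C -> C) : (forall t, isom (a t)) ->
  exists2 b, piso r b & rmp (l := fun _ : K => r) \o pw id a = pw id b \o rmp (l := fun _ : K => r).
Proof.
move=> ia; pose ix k w := mkt (fun _ : K => r) k (scat w (stream0 hd)).
exists (fun k x => scat (mkseq x r) (a (ix k (mkseq x r)) (sdrop r x))).
  move=> k; split; last by move=> x; exact: (agree_mkseq hd).
  exact: (isom_glue r (c := fun w => a (ix k w))).
apply/funext => -[[k w] x]; rewrite /rmp /cmap /pw /=.
have -> : mkseq (scat w x) r = w by rewrite -[X in mkseq _ X](size_tuple w) (scatK hd).
rewrite -[X in sdrop X](size_tuple w) sdrop_scat /ix.
by rewrite -[k in mkt _ k]/(tag (Tagged (fun=> r.-tuple 'I_d) w)) (mkt_eq hd).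
Qed.

Definition lift_fun K r (s : K -> K) (t : ref_idx d (fun _ : K => r)) :
    ref_idx d (fun _ : K => r) :=
  existT (fun=> r.-tuple 'I_d) (s (tag t)) (tagged t).

Lemma lift_fun_inj K r (s : {perm K}) : injective (lift_fun (r := r) s).
Proof.
move=> [k w] [k' w']; rewrite /lift_fun /= => e.
have ek : k = k' by apply: (@perm_inj _ s); exact: (congr1 tag e).
by subst k'; congr existT; apply/val_inj; exact: (congr1 (fun t : ref_idx d (fun=> r) => (tagged t : seq 'I_d)) e).
Qed.

Definition lift_perm K r (s : {perm K}) : {perm ref_idx d (fun _ : K => r)} :=
  perm (@lift_fun_inj K r s).

Lemma lift_permE K r (s : {perm K}) t : lift_perm r s t = lift_fun (r := r) s t.
Proof. by rewrite permE. Qed.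

Lemma lift_permM K r (s s' : {perm K}) :
  lift_perm r (s * s')%g = (lift_perm r s * lift_perm r s')%g.
Proof. by apply/permP => t; rewrite permM !lift_permE /lift_fun /= permM. Qed.

Lemma lift_permV K r (s : {perm K}) : lift_perm r s^-1%g = (lift_perm r s)^-1%g.
Proof.
apply/eqP; rewrite eq_sym eq_invg_mul -lift_permM mulgV; apply/eqP/permP => -[k w].
by rewrite lift_permE /lift_fun /= !perm1.
Qed.

Lemma relab_lift K r (s : {perm K}) :
  rmp (l := fun _ : K => r) \o relab (lift_perm r s) = relab s \o rmp (l := fun _ : K => r).
Proof. by apply/funext => -[t x]; rewrite /rmp /cmap /relab /= lift_permE. Qed.

Lemma tail_isom : exists2 T : ('I_d -> 'I_d) -> C -> C,
  forall s, injective s -> isom (T s) & forall s a x, T s (scat [:: a] x) = scat [:: s a] x.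
Proof.
exists (fun s x => scat [:: s (x 0)] (sdrop 1 x)); last first.
  by move=> s a x; rewrite -[1]/(size [:: a]) sdrop_scat.
have ne (s : 'I_d -> 'I_d) : nonexp (fun x : C => scat [:: s (x 0)] (sdrop 1 x)).
  move=> [//|n] x y xy; rewrite (xy 0)//; apply/(@agree_scat _ hd [:: s (y 0)] n).
  by move=> i iN; rewrite /sdrop xy.
have K (s s' : 'I_d -> 'I_d) : cancel s s' -> cancel (fun x : C => scat [:: s (x 0)] (sdrop 1 x))
    (fun x : C => scat [:: s' (x 0)] (sdrop 1 x)).
  move=> ss' x; rewrite -[1]/(size [:: s (x 0)]) sdrop_scat /= -[in RHS](scat_mkseq hd 1 x).
  by rewrite {1}/scat /= ss'.
move=> s s_inj; have [s' ss' s's] := injF_bij s_inj.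
by exists (fun x => scat [:: s' (x 0)] (sdrop 1 x)); split; [exact: K|exact: K|exact: ne|exact: ne].
Qed.

Lemma sim_glue_perm T (b b' : C -> T) (s : 'I_d -> 'I_d) : injective s ->
  (forall a : 'I_d, sim (sub b [:: a]) (sub b' [:: s a])) -> sim b b'.
Proof.
have [tl tli tlE] := tail_isom => s_inj h.
apply: (@sim_trans _ _ _ (b' \o tl s)); last by exists (tl s) => //; exact: tli.
apply: (sim_glue hd) => a; suff -> : sub (b' \o tl s) [:: a] = sub b' [:: s a] by [].
by apply/funext => x; rewrite /sub /= tlE.
Qed.

End Deep.

Section Realized.
Variables (d : nat) (hd : 1 < d) (I0 : finType).
Local Notation C := (stream d).
Local Notation P := (I0 * C)%type.
Implicit Types (I J K : finType) (b : C -> P).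
Variable HH : (P -> P) -> Prop.
Hypotheses (gH : homgroup HH) (cH : homclosed HH).

Lemma realizedM I (f : I * C -> P) (s s' : {perm I}) :
  realized HH f s -> realized HH f s' -> realized HH f (s * s')%g.
Proof.
move=> [h hh hm] [h' hh' hm']; exists (h' \o h); first exact: (hgM gH).
by move=> i; rewrite permM; apply: moves_comp (hm i) (hm' _).
Qed.

Lemma realized1 I (f : I * C -> P) : realized HH f (1%g : {perm I}).
Proof. by exists id; [exact: (hg1 gH)|move=> i; rewrite perm1; exact: sim_refl]. Qed.

Lemma realized_cyc I (f : I * C -> P) x y z : hom f -> x != y -> y != z -> z != x ->
  cyc_at HH f x y z -> realized HH f (tperm y z * tperm x y)%g.
Proof.
move=> hf xy yz zx [h hh [m1 m2 m3 e]]; exists h => // i; rewrite permM.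
have [->|iy] := eqVneq i y; first by rewrite tpermL tpermD// eq_sym.
have [->|iz] := eqVneq i z; first by rewrite tpermR tpermR.
rewrite [tperm y z i]tpermD 1?eq_sym//.
have [->|ix] := eqVneq i x; first by rewrite tpermL.
by rewrite tpermD 1?eq_sym//; apply: moves_fixed; exact: (cyc_fixed hf ix iy iz e).
Qed.

(** Composing [s] with the inverse of a 3-cycle that agrees with it at x shrinks the support. The
    third piece z exists because an even permutation is not a transposition. *)
Lemma realized_even I (f : I * C -> P) (G : I -> Prop) (s : {perm I}) : hom f ->
  (forall x y z, G x -> G y -> G z -> x != y -> y != z -> z != x -> cyc_at HH f x y z) ->
  (forall i, s i != i -> G i) -> odd_perm s = false -> realized HH f s.
Proof.
move=> hf Gc; have [n] := ubnP #|[set i | s i != i]|.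
elim: n s => // n IH s /ltnSE sn sG odd_s.
have [->|s1] := eqVneq s 1%g; first exact: realized1.
have [x sx] : exists x, s x != x.
  apply: contrapT => no; move/eqP: s1; apply; apply/permP => i; rewrite perm1.
  by apply: contrapT => /eqP si; apply: no; exists i.
set y := s x in sx; have sy : s y != y by rewrite (inj_eq perm_inj).
have [z [sz zx zy]] : exists z, [/\ s z != z, z != x & z != y].
  apply: contrapT => no.
  have no' i : i != x -> i != y -> s i = i.
    by move=> ix iy; apply: contrapT => /eqP si; apply: no; exists i.
  have syx : s y = x.
    apply: contrapT => /eqP syx; have := no' (s y) syx sy => /perm_inj e.
    by rewrite e eqxx in sy.
  have st : s = tperm x y.
    by apply/permP => i; case: tpermP => [->|->|/eqP ix /eqP iy] //; exact: no'.
  by rewrite st odd_tperm eq_sym sx in odd_s.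
have xy : x != y by rewrite eq_sym.
have yz : y != z by rewrite eq_sym.
set c := (tperm y z * tperm x y)%g.
have rc : realized HH f c.
  by apply: realized_cyc => //; apply: Gc => //; exact: sG.
have -> : s = (s * c^-1 * c)%g by rewrite mulgKV.
apply: realizedM rc.
have cx : c x = y by rewrite /c permM [tperm y z x]tpermD ?tpermL// eq_sym.
have ci i : i != x -> i != y -> i != z -> c i = i.
  by move=> ix iy iz; rewrite /c permM !tpermD// eq_sym.
have cVi i : i != x -> i != y -> i != z -> (c^-1)%g i = i.
  by move=> ix iy iz; apply: (@perm_inj _ c); rewrite permKV ci.
have sub i : (s * c^-1)%g i != i -> s i != i /\ i != x.
  rewrite permM; have [->|ix] := eqVneq i x.
    by rewrite -/y -cx permK eqxx.
  have [si|//] := eqVneq (s i) i; rewrite si.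
  have iy : i != y by apply: contraNneq sy => <-; rewrite si.
  have iz : i != z by apply: contraNneq sz => <-; rewrite si.
  by rewrite cVi// eqxx.
apply: IH.
- apply: leq_trans sn; apply: proper_card; apply/fintype.properP; split.
    by apply/fintype.subsetP => i; rewrite !inE => /sub[].
  by exists x; rewrite !inE ?sx//; apply/negP => /sub[_]; rewrite eqxx.
- by move=> i /sub[/sG].
- by rewrite odd_permM odd_permV odd_s /c odd_permM !odd_tperm xy yz.
Qed.

(** An element of [HH] that induces the same permutation as [g] on the pieces of depth [r] differs
    from [g] by isometries inside these pieces, so [g] is a limit of such elements. *)
Lemma homclosed_pieces K (F : K * C -> P) g : hom F -> hom g ->
  (forall r, exists s : ref_idx d (fun _ : K => r) -> ref_idx d (fun _ : K => r),
    realized HH (F \o rmp (l := fun _ : K => r)) s /\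
    forall t, moves g (chart (F \o rmp (l := fun _ : K => r)) t)
       (chart (F \o rmp (l := fun _ : K => r)) (s t))) -> HH g.
Proof.
move=> hF hg gr; apply: (homclosed_frame hd gH cH hF hg) => r.
have [s [[h hh hs] gs]] := gr r; exists h => //.
set R := rmp (l := fun _ : K => r) in hs gs.
have /choice[a aP] t : exists a, isom a /\ g \o chart (F \o R) t = h \o chart (F \o R) t \o a.
  have [a [a' [ia' aa' a'a]] e'] : exists2 a : C -> C,
      exists e : C -> C, [/\ isom e, cancel a e & cancel e a] &
      h \o chart (F \o R) t = chart (F \o R) (s t) \o a.
    by have [a /isom_inv[e eP] e'] := hs t; exists a => //; exists e.
  have [b ib eb] := gs t; exists (a' \o b); split; first exact: isom_comp.
  rewrite eb; apply/funext => x; have := congr1 (@^~ (a' (b x))) e'.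
  by rewrite /= a'a => ->.
have [|b bp eb] := rmp_piso hd (a := a); first by move=> t; case: (aP t).
exists b => //; have [q [hq Rq qR]] := hom_inv (hom_rmp hd (fun _ : K => r)).
apply/funext => p; rewrite -[p]qR; case: (q p) => t x.
have [_ /(congr1 (@^~ x))/= e] := aP t.
by rewrite /= [LHS]e; have := congr1 (@^~ (t, x)) eb; rewrite /= => <-.
Qed.

End Realized.

Lemma finite_or_inject (T : Type) (Q : T -> Prop) m :
  (forall z : 'I_m -> T, injective z -> (forall j, Q (z j)) -> False) ->
  exists n (z : 'I_n -> T), forall p, Q p -> exists j, z j = p.
Proof.
move=> no.
pose Z n := `[< exists z : 'I_n -> T, injective z /\ forall j, Q (z j) >].
have Z0 : exists n, Z n.
  by exists 0; apply/asboolP; exists (fun j : 'I_0 => match notF (ltn_ord j) with end); split=> -[].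
have Zm n : Z n -> n <= m.
  move=> /asboolP[z [zi zQ]]; rewrite leqNgt; apply/negP => /ltnW mn.
  apply: (no (fun j => z (widen_ord mn j))) => // i j /zi e.
  by apply/val_inj; exact: (congr1 val e).
have [n /asboolP[z [zi zQ]] nmax] := ex_maxnP Z0 Zm.
exists n, z => p Qp; apply: contrapT => np.
suff /nmax : Z n.+1 by rewrite ltnn.
apply/asboolP; exists (fun j => oapp z p (unlift ord_max j)); split; last first.
  by move=> j; case: (unliftP ord_max j) => [i|] _ /=.
move=> i j; case: (unliftP ord_max i) => [i'|] ->; case: (unliftP ord_max j) => [j'|] -> //=.
- by move=> /zi ->.
- by move=> e; case: np; exists i'.
- by move=> e; case: np; exists j'.
Qed.

(** * Finite invariant sets of points *)

Section Unique.
Variables (d : nat) (hd : 1 < d) (I0 : finType).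
Local Notation C := (stream d).
Local Notation P := (I0 * C)%type.

Lemma separate (p q : P) : p <> q -> exists N, forall n, N <= n ->
  ~ (p.1 = q.1 /\ agree n p.2 q.2).
Proof.
move=> pq; apply: contrapT => no.
have all n : p.1 = q.1 /\ agree n p.2 q.2.
  apply: contrapT => nn; apply: no; exists n => m nm [e a]; apply: nn.
  by split=> //; exact: (agree_le nm).
apply: pq; rewrite (surjective_pairing p) (surjective_pairing q); case: (all 0) => -> _.
by congr (_, _); apply: agree_all => n; case: (all n).
Qed.

Lemma gather (p q : P) R : p <> q -> exists g : P -> P,
  hom g /\ (g p).1 = (g q).1 /\ agree R (g p).2 (g q).2.
Proof.
move=> pq; have [N NP] := separate pq; pose S := maxn N R.+1.
have nS := NP S (leq_maxl _ _); have RS : R < S := leq_maxr _ _.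
pose l (x : I0) := S; pose rm := rmp (d := d) (l := l).
have [rv [hrv rmK rvK]] := hom_inv (hom_rmp hd l).
(* The two targets agree on [R] letters and differ at the position R < S, so they lie in distinct
   pieces of depth [S]. *)
pose w1 : C := fun n => if n == R then letter1 hd else letter0 hd.
pose z (b : bool) := if b then mkt l p.1 p.2 else mkt l q.1 q.2.
pose z' (b : bool) := if b then mkt l p.1 (stream0 hd) else mkt l p.1 w1.
have mk i (x : C) j (y : C) : mkt l i x = mkt l j y -> i = j /\ agree S x y.
  move=> e; split; first exact: mkt_inj e.
  apply/(agreeP hd); exact: (congr1 (fun t : ref_idx d l => (tagged t : seq 'I_d)) e).
have z_inj : injective z.
  by move=> [] [] // /mk[e1 e2]; case: nS; split=> //; apply: agree_sym.
have z'_inj : injective z'.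
  by move=> [] [] // /mk[_ /(_ R RS)]; rewrite /w1 eqxx.
have [s sz] := perm_extend z_inj z'_inj.
exists (rm \o (relab s \o rv)); split.
  apply: (hom_comp hd _ (hom_rmp hd l)); apply: (hom_comp hd hrv); apply: (hom_relab hd).
  by exists (s^-1)%g; [exact: permK|exact: permKV].
have rvE x : rv x = (mkt l x.1 x.2, sdrop S x.2).
  apply: (hom_inj (hom_rmp hd l)); rewrite rvK /rmp /cmap /= (scat_mkseq hd).
  exact: surjective_pairing.
have ep : rm (relab s (rv p)) = (p.1, scat (mkseq (stream0 hd) S) (sdrop S p.2)).
  by rewrite rvE /relab /= -[mkt l _ _]/(z true) sz.
have eq_ : rm (relab s (rv q)) = (p.1, scat (mkseq w1 S) (sdrop S q.2)).
  by rewrite rvE /relab /= -[mkt l _ _]/(z false) sz.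
rewrite -[(_ \o _) p]/(rm (relab s (rv p))) -[(_ \o _) q]/(rm (relab s (rv q))) ep eq_.
split=> // i iR.
have iS : i < S by exact: ltn_trans RS.
rewrite /= /scat; do 2 rewrite (set_nth_default (letter0 hd)) ?size_mkseq// nth_mkseq//.
by rewrite /w1 (ltn_eqF iR).
Qed.

Variable HH : (P -> P) -> Prop.
Hypotheses (gH : homgroup HH) (fH : homcocompact HH).

Lemma finite_invariant_unique (Q : P -> Prop) m :
  (forall z : 'I_m -> P, injective z -> (forall j, Q (z j)) -> False) ->
  (forall h p, HH h -> Q p -> Q (h p)) -> forall p q, Q p -> Q q -> p = q.
Proof.
move=> /finite_or_inject[n [z zP]] QH p q Qp Qq; apply: contrapT => pq.
have [N [r [hr rP]]] := fH.
have /choice[ri riP] i : exists g, [/\ hom g, cancel (r i) g & cancel g (r i)].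
  exact: hom_inv (hr i).
have /choice[S SP] (t : 'I_N * ('I_n * 'I_n)) : exists S, z t.2.1 <> z t.2.2 ->
    forall n, S <= n ->
    ~ ((ri t.1 (z t.2.1)).1 = (ri t.1 (z t.2.2)).1 /\
       agree n (ri t.1 (z t.2.1)).2 (ri t.1 (z t.2.2)).2).
  have [e|ne] := pselect (z t.2.1 = z t.2.2); first by exists 0.
  have [|S SP] := @separate (ri t.1 (z t.2.1)) (ri t.1 (z t.2.2)); last by exists S => _.
  by move=> /(congr1 (r t.1)); case: (riP t.1) => _ _ K; rewrite !K.
pose R := \max_t S t.
have [g [hg [e1 eR]]] := gather R pq.
have [phi [hphi phiK gK]] := hom_inv hg.
(* Decomposing the inverse of [g] makes [g], up to an isometry, the composite of [ri i] after the
   inverse of h, which preserves [Q]. So [g p] and [g q] agree exactly as far as the images under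
   [ri i] of two points of [Q], which cannot agree on [R] letters in one piece. *)
have [i [h [a [hh ia e]]]] := rP phi hphi.
have [hi hhi [hK hiK]] := hgV gH hh.
have [j ej] := zP _ (QH _ _ hhi Qp); have [j' ej'] := zP _ (QH _ _ hhi Qq).
have [_ rK _] := riP i.
have E x : ri i (hi x) = pw id a (g x).
  by have := congr1 (@^~ (g x)) e; rewrite /= phiK => ex; rewrite {1}ex hK rK.
apply: (SP (i, (j, j')) _ R) => /=.
- by rewrite ej ej' => /(congr1 h); rewrite !hiK.
- exact: leq_bigmax.
- rewrite ej ej' !E /pw /= e1; split=> //; apply/isom_agree => //.
  by case: (ia (g q).1).
Qed.

End Unique.

Lemma avoid (I : finType) (s : seq I) : size s < #|I| -> exists u, u \notin s.
Proof.
move=> sI; apply: contrapT => no; move: sI; rewrite ltnNge => /negP; apply.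
apply: leq_trans (card_size s); apply/subset_leq_card/fintype.subsetP => u _.
by apply: contrapT => /negP us; apply: no; exists u.
Qed.

Lemma moves_injective d (hd : 1 < d) (I0 I : finType) (f : I * stream d -> I0 * stream d)
    phi (s : I -> I) : hom f -> hom phi ->
  (forall i, moves phi (chart f i) (chart f (s i))) -> injective s.
Proof.
move=> hf hphi ms i j e; have mi := ms i; have := ms j; rewrite -e => /sim_sym mj.
have /(sim_img _ (sim_trans mi mj)) : img (phi \o chart f i) (phi (f (i, stream0 hd))).
  by exists (stream0 hd).
by move=> [x /(hom_inj hphi)/(hom_inj hf)[->]].
Qed.

(** * All permutations of good pieces *)

Section Transpositions.
Variables (d : nat) (hd : 1 < d) (I0 : finType).
Local Notation C := (stream d).
Local Notation P := (I0 * C)%type.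
Implicit Types (I J K : finType).
Variable HH : (P -> P) -> Prop.
Hypotheses (gH : homgroup HH) (cH : homclosed HH) (fH : homcocompact HH).
Variables s1 M : nat.
Hypothesis s1pos : 0 < s1.
Hypothesis s1P : cyc_bound HH s1.
Hypothesis M4 : 4 < M.
Hypothesis oneP : forall I (f : I * C -> P) i0 i1, frame f -> s1 < #|I| ->
  M <= #|lclass HH f i0| -> M <= #|lclass HH f i1| -> linked HH f i0 i1.
Local Notation good := (good HH s1 M).
Local Notation bad := (bad HH s1 M).

Lemma bad_unique p q : bad p -> bad q -> p = q.
Proof.
move=> bp bq; apply: (finite_invariant_unique hd gH fH _ _ bp bq).
  exact: (few_bad hd gH s1pos s1P).
by move=> h x hh; exact: (bad_moves hd gH hh).
Qed.

Lemma not_good_unique I (f : I * C -> P) i j : frame f -> s1 < #|I| ->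
  ~ good (chart f i) -> ~ good (chart f j) -> i = j.
Proof.
move=> ff ltI ni nj.
have [//|[x bx]] := good_or_bad hd gH s1pos s1P M4 oneP i ff ltI.
have [//|[y by_]] := good_or_bad hd gH s1pos s1P M4 oneP j ff ltI.
by have /(hom_inj ff.1)[-> _] := bad_unique bx by_.
Qed.

Lemma good_cyc_at I (f : I * C -> P) i j l : frame f -> s1 < #|I| -> 3 < #|I| ->
  good (chart f i) -> good (chart f j) -> good (chart f l) ->
  i != j -> j != l -> l != i -> cyc_at HH f i j l.
Proof.
move=> ff ltI I3 gi gj gl ij jl li.
have [u] := avoid (s := [:: i; j; l]) I3.
rewrite !inE !negb_or => /and3P[ui uj ul].
by apply: (good_cyc hd gH s1P M4 oneP (u := u)) => //; rewrite eq_sym.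
Qed.

(** Let [u] be the transposition of i and j seen on the children. Its conjugate [u ^ q] exchanges
    the children 0 and 1 of each of d other good pieces: an isometry of these pieces, invisible on
    the level of [f]. On every deeper level u * u ^ q induces an even permutation, the product of a
    permutation and a conjugate of it. *)
Lemma realized_tperm I (f : I * C -> P) i j : frame f -> s1 < #|I| -> d + 3 < #|I| ->
  good (chart f i) -> good (chart f j) -> i != j -> realized HH f (tperm i j).
Proof.
move=> ff ltI dI gi gj ij.
have [z [z_inj zij gz]] : exists z : 'I_d -> I, [/\ injective z,
    forall a, z a != i /\ z a != j & forall a, good (chart f (z a))].
  (* At most one piece is not good; discarding it together with i and j leaves at least d good
     pieces. *)
  pose A := [set x | [&& x != i, x != j & `[< good (chart f x) >]]].
  have dA : d <= #|A|.
    have [y ny] : exists y, forall x, ~ good (chart f x) -> x = y.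
      have [[y ny]|no] := pselect (exists y, ~ good (chart f y)).
        by exists y => x nx; exact: (not_good_unique ff).
      by exists i => x nx; case: no; exists x.
    rewrite -(leq_add2r 3).
    apply: leq_trans (ltnW dI) _; rewrite -(cardsC A) leq_add2l.
    apply: leq_trans (card_size [:: i; j; y]); apply/subset_leq_card/fintype.subsetP => x.
    rewrite finset.in_setC finset.in_set; have [->|xi] := eqVneq x i; first by rewrite inE eqxx.
    have [->|xj] := eqVneq x j; first by rewrite !inE eqxx orbT.
    move=> /negP nx; rewrite !inE.
    by rewrite (ny x) ?eqxx ?orbT// => gx; apply: nx; exact/asboolP.
  have le : #|{: 'I_d}| <= #|A| by rewrite card_ord.
  exists (fun a => enum_val (widen_ord le (enum_rank a))).
  have zA a : enum_val (widen_ord le (enum_rank a)) \in A by exact: enum_valP.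
  split.
  - move=> a b /enum_val_inj/(congr1 val)/= e; exact/enum_rank_inj/val_inj.
  - by move=> a; have := zA a; rewrite !inE => /and3P[].
  - by move=> a; have := zA a; rewrite !inE => /and3P[_ _ /asboolP].
pose l1 (x : I) := 1.
pose mk x a : ref_idx d l1 := existT (fun=> 1.-tuple 'I_d) x [tuple a].
have mkP t : exists a, t = mk (tag t) a.
  case: t => x w; exists (thead w) => /=; rewrite /mk; congr existT.
  by apply/val_inj; rewrite [w]tuple_eta; case: w => -[//|a [|]].
have mk_inj x y a b : mk x a = mk y b -> x = y /\ a = b.
  move=> e; split; first exact: (congr1 tag e).
  by have := congr1 (fun t : ref_idx d l1 => (tagged t : seq 'I_d)) e => -[].
pose F := f \o rmp (l := l1).
have fF : frame F := frame_ref hd l1 ff.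
have chF x a : chart F (mk x a) = sub (chart f x) [:: a] by rewrite /F chart_rmp.
pose zA (p : bool * 'I_d) := mk (if p.1 then j else i) p.2.
pose zB (p : bool * 'I_d) := mk (z p.2) (if p.1 then letter1 hd else letter0 hd).
have zA_inj : injective zA.
  move=> [x a] [y b] /mk_inj/= [e ->]; congr (_, _).
  by case: x y e => -[] // e; move: ij; rewrite e eqxx.
have zB_inj : injective zB.
  move=> [x a] [y b] /mk_inj/= [/z_inj -> e]; congr (_, _).
  by case: x y e => -[].
have [q qP] := perm_extend zA_inj zB_inj.
pose u : {perm ref_idx d l1} := lift_perm d 1 (tperm i j); pose G := (u * u ^ q)%g.
have uE x a : u (mk x a) = mk (tperm i j x) a by rewrite /u lift_permE.
have uA b a : u (zA (b, a)) = zA (~~ b, a).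
  by rewrite /zA uE /=; case: b; rewrite ?tpermL ?tpermR.
have uqB b a : (u ^ q)%g (zB (b, a)) = zB (~~ b, a) by rewrite -!qP permJ uA.
have ufix x a : x != i -> x != j -> u (mk x a) = mk x a.
  by move=> xi xj; rewrite uE tpermD 1?eq_sym.
have uqfix t : (forall p, t <> zB p) -> (u ^ q)%g t = t.
  move=> nt; rewrite -[t in RHS](permKV q) -[t in LHS](permKV q) permJ; congr (q _).
  have [b eb] := mkP ((q^-1)%g t); set y := tag _ in eb.
  have nA p : (q^-1)%g t != zA p.
    by apply/eqP => /(congr1 q); rewrite permKV qP; exact: nt.
  rewrite eb; apply: ufix.
    by apply: contraNneq (nA (false, b)) => e; rewrite eb e.
  by apply: contraNneq (nA (true, b)) => e; rewrite eb e.
have uqfix' x a : (forall b, x != z b) -> (u ^ q)%g (mk x a) = mk x a.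
  by move=> xz; apply: uqfix => p /mk_inj[e _]; have := xz p.2; rewrite e eqxx.
have [sg [sg_inj GE]] : exists sg : I -> 'I_d -> 'I_d, (forall x, injective (sg x)) /\
    forall x a, G (mk x a) = mk (tperm i j x) (sg x a).
  have iz b : i != z b /\ j != z b by case: (zij b) => ? ?; split; rewrite eq_sym.
  pose sg (x : I) := if [exists b, z b == x] then tperm (letter0 hd) (letter1 hd) else 1%g.
  exists (fun x => sg x); split=> [x|x a]; first exact: perm_inj.
  rewrite /G permM; have [->|xi] := eqVneq x i.
    rewrite uE tpermL uqfix'; last by move=> b; case: (iz b).
    by rewrite /sg ifF ?perm1//; apply/negbTE/existsPn => b; case: (zij b).
  have [->|xj] := eqVneq x j.
    rewrite uE tpermR uqfix'; last by move=> b; case: (iz b).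
    by rewrite /sg ifF ?perm1//; apply/negbTE/existsPn => b; case: (zij b).
  rewrite ufix// tpermD 1?eq_sym// /sg.
  have [/existsP[b /eqP <-]|/existsPn nb] := ifP; last first.
    by rewrite perm1 uqfix'// => b; rewrite eq_sym.
  case: tpermP => [->|->|a0 a1]; [exact: (uqB false)|exact: (uqB true)|].
  by apply: uqfix => -[[] b'] /mk_inj[_ e]; [apply: a1|apply: a0].
have Ggood x a : G (mk x a) != mk x a -> good (chart f x).
  move=> Gx; have [[b ->]|no] := pselect (exists b, x = z b); first exact: gz.
  have [->//|xi] := eqVneq x i; have [->//|xj] := eqVneq x j.
  move: Gx; rewrite /G permM ufix// uqfix' ?eqxx// => b.
  by apply/eqP => e; apply: no; exists b.
have [Fi [hFi FK KF]] := hom_inv fF.1.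
pose phi := F \o (relab G \o Fi).
have hphi : hom phi.
  apply: (hom_comp hd _ fF.1); apply: (hom_comp hd hFi); apply: (hom_relab hd).
  by exists (G^-1)%g; [exact: permK|exact: permKV].
have phiF : phi \o F = F \o relab G by apply/funext => p; rewrite /phi /= FK.
exists phi; last first.
  move=> x; apply: (sim_glue_perm hd (sg_inj x)) => a.
  rewrite -!chF -GE; suff -> : sub (phi \o chart f x) [:: a] = chart F (G (mk x a)).
    exact: sim_refl.
  rewrite -[LHS]/(phi \o sub (chart f x) [:: a]) -chF; apply/funext => y.
  exact: (congr1 (@^~ (mk x a, y)) phiF).
apply: (homclosed_pieces hd gH cH fF.1 hphi) => r; exists (lift_perm d r G).
set R := rmp (l := fun=> r); have fR : frame (F \o R) := frame_ref hd (fun=> r) fF.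
split; last first.
  move=> t; suff -> : chart (F \o R) (lift_perm d r G t) = phi \o chart (F \o R) t.
    exact: sim_refl.
  apply/funext => x; have := congr1 (@^~ (R (t, x))) phiF; rewrite /= => ->.
  exact: (congr1 F (congr1 (@^~ (t, x)) (@relab_lift d _ r G))).
have cR : #|I| <= #|ref_idx d (fun _ : ref_idx d l1 => r)|.
  exact: leq_trans (card_ref_le hd l1) (card_ref_le hd _).
apply: (realized_even gH (G := fun t => good (chart (F \o R) t)) fR.1).
- move=> x y w gx gy gw; apply: good_cyc_at => //; first exact: leq_trans cR.
  by apply: leq_trans cR; apply: leq_ltn_trans dI; exact: leq_addl.
- case=> t w; rewrite lift_permE /lift_fun /= => ne.
  rewrite /R chart_rmp /=; apply: (good_sub hd gH s1P M4).
  have [a ta] := mkP t; rewrite ta chF; apply: (good_sub hd gH s1P M4).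
  by apply: (Ggood _ a); rewrite -ta; apply: contraNneq ne => ->.
- by rewrite /G lift_permM conjgE !lift_permM lift_permV !odd_permM odd_permV; do 2 case: odd_perm.
Qed.

Lemma realized_perm I (f : I * C -> P) (s : {perm I}) : frame f -> s1 < #|I| ->
  d + 3 < #|I| -> (forall i, s i != i -> good (chart f i)) -> realized HH f s.
Proof.
move=> ff ltI dI; have [n] := ubnP #|[set i | s i != i]|.
elim: n s => // n IH s /ltnSE sn sG.
have [->|s1'] := eqVneq s 1%g; first exact: realized1.
have [x sx] : exists x, s x != x.
  apply: contrapT => no; move/eqP: s1'; apply; apply/permP => i; rewrite perm1.
  by apply: contrapT => /eqP si; apply: no; exists i.
have sy : s (s x) != s x by rewrite (inj_eq perm_inj).
rewrite -(mulgK (tperm x (s x)) s) tpermV; apply: realizedM => //; last first.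
  by apply: realized_tperm; [..|rewrite eq_sym]; rewrite //; exact: sG.
have supp i : (s * tperm x (s x))%g i != i -> s i != i /\ i != x.
  rewrite permM; have [->|ix] := eqVneq i x; first by rewrite tpermR eqxx.
  have [si|//] := eqVneq (s i) i; rewrite si; have [e|isx] := eqVneq i (s x).
    by move: sy; rewrite -e si eqxx.
  by rewrite tpermD ?eqxx// eq_sym.
apply: IH; last by move=> i /supp[/sG].
apply: leq_trans sn; apply: proper_card; apply/fintype.properP; split.
  by apply/fintype.subsetP => i; rewrite !finset.in_set => /supp[].
by exists x; rewrite !finset.in_set ?sx//; apply/negP => /supp[_]; rewrite eqxx.
Qed.

(** On every level a moved piece is good: a piece that contains the bad point is kept, since [phi]
    fixes this point by uniqueness. So [realized_perm] applies to all the induced permutations. *)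
Lemma moves_perm_closed J (F : J * C -> P) (s : J -> J) phi : frame F ->
  maxn s1.+1 (d + 4) <= #|J| -> hom phi ->
  (forall j, moves phi (chart F j) (chart F (s j))) ->
  (forall p, bad p -> bad (phi p)) -> HH phi.
Proof.
rewrite geq_max addnS => fF /andP[ltJ dJ] hphi ms bphi.
apply: (homclosed_pieces hd gH cH fF.1 hphi) => r.
have fR := frame_ref hd (fun=> r) fF; set R := F \o _ in fR *.
have [s' s'P] : exists s' : ref_idx d (fun _ : J => r) -> ref_idx d (fun _ : J => r),
    forall t, moves phi (chart R t) (chart R (s' t)).
  have [|s' s'P] := moves_rmp hd (l := fun=> r) (h := phi) (r := s) fF.1.
    by move=> j; left.
  by exists s' => t; case: (s'P t).
exists s'; split=> //.
have s'_inj : injective s' := moves_injective hd fR.1 hphi s'P.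
have cJ : #|J| <= #|ref_idx d (fun _ : J => r)| := card_ref_le hd _.
have [||||h hh hs] := @realized_perm _ R (perm s'_inj) => //.
- exact: leq_trans cJ.
- exact: leq_trans cJ.
- move=> t; rewrite permE => st; apply: contrapT => ng.
  have [//|[x bx]] := good_or_bad hd gH s1pos s1P M4 oneP t fR (leq_trans ltJ cJ).
  have px := bad_unique bx (bphi _ bx).
  have : img (chart R (s' t)) (R (t, x)).
    by rewrite px; apply: (moves_img (s'P t)); exists x.
  by move=> [y /(hom_inj fR.1)[e _]]; rewrite e eqxx in st.
- by exists h => // t; have := hs t; rewrite permE.
Qed.

End Transpositions.

(** * Rigidity of closed cocompact subgroups *)

Section Rigidity.
Variables (d : nat) (hd : 1 < d) (I0 : finType) (I0pos : 0 < #|I0|).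
Local Notation C := (stream d).
Local Notation P := (I0 * C)%type.
Implicit Types (I J K : finType).

Lemma large_frame n : exists I (f : I * C -> P), frame f /\ n <= #|I|.
Proof.
have /card_gt0P[i _] := I0pos.
have fid : frame (@id P) by split=> //; exact: hom_id.
exists (ref_idx d (fun _ : I0 => n)), (id \o rmp (l := fun=> n)).
split; first exact: (frame_ref hd _ fid).
by apply: leq_trans (card_ref_ge d (fun=> n) i); exact/ltnW/ltn_expl.
Qed.

Variable HH : (P -> P) -> Prop.
Hypotheses (gH : homgroup HH) (cH : homclosed HH) (fH : homcocompact HH).

Theorem rigidity : (forall g, hom g -> HH g) \/
  exists xi n1, (forall h, HH h -> h xi = xi) /\
    forall I (f : I * C -> P) e g, frame f -> n1 <= #|I| -> img (chart f e) xi ->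
      hom g -> g xi = xi -> moves g (chart f e) (chart f e) -> HH g.
Proof.
have [s1 s1pos s1P] := many_cyc hd I0pos gH cH fH.
have [M M4 oneP] := one_big_class hd gH s1pos s1P.
pose bad := bad HH s1 M.
have bH h p : HH h -> bad p -> bad (h p) by move=> hh; exact: (bad_moves hd gH hh).
have bU p q : bad p -> bad q -> p = q := bad_unique hd gH fH s1pos s1P (p := p) (q := q).
have W := moves_perm_closed hd gH cH fH s1pos s1P M4 oneP.
pose n1 := maxn s1.+1 (d + 4).
have [[xi bxi]|nb] := pselect (exists p, bad p); [right|left=> g hg].
  exists xi, n1; split=> [h hh|I f e g ff cI xe hg gx me]; first exact: bU (bH _ _ hh bxi) bxi.
  have be p : bad p <-> p = xi by split=> [bp|->//]; exact: bU.
  apply: (generate hd gH (B := bad) bH W ff cI hg) => [p|i [x /be ix]].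
    rewrite !be -{2}gx; split=> [->//|]; exact: (hom_inj hg).
  suff -> : i = e by [].
  by case: xe => y; rewrite -ix => /(hom_inj ff.1)[].
have [I [f [ff cI]]] := large_frame n1.
apply: (generate hd gH (B := bad) bH W ff cI hg) => [p|i [x bx]].
  by split=> bp; case: nb; eexists; exact: bp.
by case: nb; eexists; exact: bx.
Qed.

End Rigidity.

Section Letters.
Variables (d : nat) (hd : 1 < d).
Local Notation C := (stream d).
Local Notation l0 := (letter0 hd).

Lemma isom_transitive (x y : C) : exists2 a, isom a & a x = y.
Proof.
exists (fun z n => tperm (x n) (y n) (z n)); last by apply/funext => n; exact: tpermL.
have K : involutive (fun (z : C) n => tperm (x n) (y n) (z n)).
  by move=> z; apply/funext => n; exact: tpermK.
have ne : nonexp (fun (z : C) n => tperm (x n) (y n) (z n)).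
  by move=> n z z' zz' i /zz' ->.
by exists (fun z n => tperm (x n) (y n) (z n)).
Qed.

(** Conjugating an isometry by [shift] gives such a map on the piece [i1]: [shift] expands the ball
    0 of [i1] to [i1] and sends its other balls into [e]. *)
Definition zero_part (a e : C -> C) (x : C) :=
  if x 0 == l0 then scat [:: l0] (a (sdrop 1 x)) else e x.

Lemma zero_part0 a e x : x 0 = l0 -> zero_part a e x = scat [:: l0] (a (sdrop 1 x)).
Proof. by move=> x0; rewrite /zero_part x0 eqxx. Qed.

Lemma zero_partN a e x : x 0 != l0 -> zero_part a e x = e x.
Proof. by rewrite /zero_part => /negbTE ->. Qed.

Lemma isom_zero_part a e : isom a -> isom e -> (forall x, (e x 0 == l0) = (x 0 == l0)) ->
  isom (zero_part a e).
Proof.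
move=> [a' [aK a'K na na']] [e' [eK e'K ne ne']] e0.
have e'0 x : (e' x 0 == l0) = (x 0 == l0) by rewrite -e0 e'K.
have K (b b' c c' : C -> C) : cancel b b' -> cancel c c' -> (forall x, (c x 0 == l0) = (x 0 == l0)) ->
    cancel (zero_part b c) (zero_part b' c').
  move=> bK cK c0 x; have [x0|x0] := eqVneq (x 0) l0; last first.
    by rewrite (zero_partN b)// zero_partN ?cK// c0.
  rewrite (zero_part0 b)// zero_part0// -[1]/(size [:: l0]) sdrop_scat bK.
  by rewrite -x0; exact: (scat_mkseq hd 1 x).
have N (b c : C -> C) : nonexp b -> nonexp c -> nonexp (zero_part b c).
  move=> nb nc [//|n] x y xy; rewrite /zero_part (xy 0)//; case: ifP => _; last exact: nc.
  by apply/(@agree_scat _ hd [:: l0] n)/nb => i iN; rewrite /sdrop xy.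
by exists (zero_part a' e'); split; [exact: K|exact: K|exact: N|exact: N].
Qed.

End Letters.

Section LevelFrames.
Variables (d : nat) (hd : 1 < d) (I0 : finType).
Local Notation C := (stream d).
Local Notation P := (I0 * C)%type.
Implicit Types (I J K : finType).

Lemma pw_comp I (a b : I -> C -> C) : pw id a \o pw id b = pw id (fun i => a i \o b i).
Proof. by []. Qed.

Lemma pw_inv I (a : I -> C -> C) : (forall i, isom (a i)) -> exists2 b,
  forall i, isom (b i) & cancel (pw id a) (pw id b) /\ cancel (pw id b) (pw id a).
Proof.
move=> ia; have /choice[b bP] i : exists b, [/\ isom b, cancel (a i) b & cancel b (a i)].
  exact: isom_inv.
exists b; first by move=> i; case: (bP i).
by split=> -[i x]; rewrite /pw /=; case: (bP i) => _ h1 h2; rewrite ?h1 ?h2.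
Qed.

Lemma piso_rmp K r (b : K -> C -> C) : piso r b -> exists2 a, forall t, isom (a t) &
  pw id b \o rmp (l := fun _ : K => r) = rmp (l := fun _ : K => r) \o pw id a.
Proof.
move=> br; have /choice[a aP] (t : ref_idx d (fun _ : K => r)) :
    exists a, isom a /\ forall x, b (tag t) (scat (tagged t) x) = scat (tagged t) (a x).
  have [ib ab] := br (tag t).
  have [|a ia aE] := agree_isom_scat hd (w := tagged t) ib.
    by rewrite size_tuple.
  by exists a.
exists a; first by move=> t; case: (aP t).
by apply/funext => -[t x]; rewrite /rmp /cmap /pw /=; case: (aP t) => _ ->.
Qed.

Lemma moves_sub_fixed (T : Type) (g : T -> T) (b : C -> T) n (x : C) : injective b -> moves g b b ->
  g (b x) = b x -> moves g (sub b (mkseq x n)) (sub b (mkseq x n)).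
Proof.
move=> b_inj [a ia e] gx.
have ax : a x = x by apply: b_inj; rewrite -gx -[LHS]/((b \o a) x) -e.
have [u [a' [su ia' aE]]] := isom_scat hd (mkseq x n) ia.
exists a' => //; apply/funext => y; have := congr1 (@^~ (scat (mkseq x n) y)) e.
rewrite /= aE => ge; rewrite /sub /= ge; congr (b (scat _ _)).
have := aE (sdrop n x); rewrite (scat_mkseq hd) ax -{1}(scat_mkseq hd n x).
by move=> /(scat_inj hd (esym su))[].
Qed.

(* Level r of the tree, with coordinates in which xi is the constant end 0. *)
Lemma level_frame r (xi : P) : exists I (f : I * C -> P) e,
  [/\ frame f, d ^ r <= #|I|, f (e, stream0 hd) = xi &
    [/\ forall b, piso r b -> exists2 a, forall i, isom (a i) & pw id b \o f = f \o pw id a,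
      forall a, (forall i, isom (a i)) -> exists2 b, piso r b & f \o pw id a = pw id b \o f &
      forall b, (forall i, isom (b i)) -> pw id b xi = xi ->
        moves (pw id b) (chart f e) (chart f e)]].
Proof.
pose l (_ : I0) := r; pose R := rmp (d := d) (l := l); pose e := mkt l xi.1 xi.2.
have [a ia a0] := isom_transitive (stream0 hd) (sdrop r xi.2).
pose c (_ : ref_idx d l) := a.
have ic i : isom (c i) by [].
have [c' ic' [cK c'K]] := pw_inv ic.
have fid : frame (@id P) by split=> //; exact: hom_id.
have fR : frame R := frame_ref hd l fid.
exists (ref_idx d l), (R \o pw id c), e; split.
- split; last exact: fR.2.
  by apply: (hom_comp hd _ fR.1); apply: (hom_pw hd _ ic); exists id.
- exact: (card_ref_ge d l xi.1).
- by rewrite /= /pw /= /c a0 /R /rmp /cmap /= (scat_mkseq hd) -surjective_pairing.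
split.
- move=> b /piso_rmp[b' ib' bE].
  exists (fun i => c' i \o (b' i \o c i)).
    by move=> i; apply: isom_comp => //; exact: isom_comp.
  rewrite -pw_comp -pw_comp; apply/funext => p.
  have := congr1 (@^~ (pw id c p)) bE; rewrite /= => ->.
  by rewrite c'K.
- move=> b ib; have [|b' pb' bE] := rmp_piso hd (K := I0) (r := r) (a := fun i => c i \o (b i \o c' i)).
    by move=> i; apply: isom_comp => //; exact: isom_comp.
  exists b' => //; apply/funext => p; have := congr1 (@^~ (pw id c p)) bE.
  rewrite -pw_comp -pw_comp /= cK => e1; exact: e1.
- move=> b ib bx; have [u [b' [su ib' bE]]] := isom_scat hd (mkseq xi.2 r) (ib xi.1).
  have bb : b xi.1 xi.2 = xi.2 by have /(congr1 snd) := bx.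
  have eu : u = mkseq xi.2 r.
    have := bE (sdrop r xi.2); rewrite (scat_mkseq hd) bb -{1}(scat_mkseq hd r xi.2).
    by move=> /(scat_inj hd (esym su))[].
  have [a' [ia' aK a'K]] := isom_inv ia.
  exists (a' \o (b' \o a)); first by apply: isom_comp => //; exact: isom_comp.
  apply/funext => x; rewrite /chart /R /rmp /cmap /pw /= /c bE eu a'K.
  by [].
Qed.

End LevelFrames.

(** * The stabilizer of an end *)

Section Shift.
Variables (d : nat) (hd : 1 < d) (I : finType) (e i1 : I).
Hypothesis i1e : i1 != e.
Local Notation C := (stream d).
Local Notation l0 := (letter0 hd).

(* The piece e contracts to its ball 0 and the ball 0 of i1 expands to i1; the other
   balls of i1 fill the gap in e. *)
Definition shift (p : I * C) : I * C :=
  if p.1 == e then (e, scat [:: l0] p.2)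
  else if p.1 == i1 then (if p.2 0 == l0 then (i1, sdrop 1 p.2) else (e, p.2)) else p.

Definition unshift (p : I * C) : I * C :=
  if p.1 == e then (if p.2 0 == l0 then (e, sdrop 1 p.2) else (i1, p.2))
  else if p.1 == i1 then (i1, scat [:: l0] p.2) else p.

Lemma scat_sdrop1 (x : C) : x 0 = l0 -> scat [:: l0] (sdrop 1 x) = x.
Proof. by move=> <-; exact: (scat_mkseq hd 1 x). Qed.

Lemma shiftK : cancel shift unshift.
Proof.
move=> [i x]; rewrite /shift /=; have [->|ie] := eqVneq i e.
  by rewrite /unshift /= !eqxx -[1]/(size [:: l0]) sdrop_scat.
have [->|ii] := eqVneq i i1; last by rewrite /unshift /= (negPf ie) (negPf ii).
have [x0|x0] := eqVneq (x 0) l0.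
  by rewrite /unshift /= (negPf i1e) eqxx scat_sdrop1.
by rewrite /unshift /= eqxx (negPf x0).
Qed.

Lemma unshiftK : cancel unshift shift.
Proof.
move=> [i x]; rewrite /unshift /=; have [->|ie] := eqVneq i e.
  have [x0|x0] := eqVneq (x 0) l0; first by rewrite /shift /= eqxx scat_sdrop1.
  by rewrite /shift /= (negPf i1e) eqxx (negPf x0).
have [->|ii] := eqVneq i i1; last by rewrite /shift /= (negPf ie) (negPf ii).
by rewrite /shift /= (negPf i1e) !eqxx -[1]/(size [:: l0]) sdrop_scat.
Qed.

Lemma hom_shift : hom shift.
Proof.
exists unshift; split; [exact: shiftK|exact: unshiftK| |]; exists 1;
  apply: (lsm_eq hd) => i [|u [|]] // _.
- rewrite /shift /=; have [_|_] := eqVneq i e.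
    by exists e, [:: l0; u], id; split; [exact: isom_id|move=> x; rewrite -scat_cat].
  have [_|_] := eqVneq i i1; last by exists i, [:: u], id; split; [exact: isom_id|].
  have [u0|u0] := eqVneq u l0.
    exists i1, [::], id; split=> [|x]; first exact: isom_id.
    by rewrite -[1]/(size [:: u]) sdrop_scat scat0.
  by exists e, [:: u], id; split=> [|x]; first exact: isom_id.
- rewrite /unshift /=; have [_|_] := eqVneq i e; last first.
    have [_|_] := eqVneq i i1; last by exists i, [:: u], id; split; [exact: isom_id|].
    by exists i1, [:: l0; u], id; split; [exact: isom_id|move=> x; rewrite -scat_cat].
  have [u0|u0] := eqVneq u l0.
    exists e, [::], id; split=> [|x]; first exact: isom_id.
    by rewrite -[1]/(size [:: u]) sdrop_scat scat0.
  by exists i1, [:: u], id; split=> [|x]; first exact: isom_id.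
Qed.

(** As [a e] fixes the zero stream, it preserves the ball 0 of [e] and its complement, the two parts
    of [e] that [unshift] sends to different pieces. *)
Lemma unshift_pw (a : I -> C -> C) : (forall i, isom (a i)) ->
  a e (stream0 hd) = stream0 hd -> exists2 b, forall i, isom (b i) &
  unshift \o (pw id a \o shift) = pw id b.
Proof.
move=> ia ae; have a0 x : (a e x 0 == l0) = (x 0 == l0).
  have h1 : agree 1 (a e x) (a e (stream0 hd)) <-> agree 1 x (stream0 hd).
    exact: isom_agree (ia e).
  rewrite ae in h1; apply/eqP/eqP => h.
    by have /(_ 0) -> // : agree 1 x (stream0 hd) by apply/h1 => -[].
  by have /(_ 0) -> // : agree 1 (a e x) (stream0 hd) by apply/h1 => -[].
have [u [b [su ib bE]]] := isom_scat hd [:: l0] (ia e).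
have eu : u = [:: l0].
  have := bE (stream0 hd); rewrite -[stream0 hd in LHS](scat_sdrop1 (x := stream0 hd))// in ae *.
  move=> h; have : mkseq (a e (scat [:: l0] (stream0 hd))) 1 = u.
    by rewrite h -[1]/(size [:: l0]) -su (scatK hd).
  move=> <-; rewrite /mkseq /=; congr [:: _]; apply/eqP; rewrite a0; exact: eqxx.
exists (fun i => if i == e then b else if i == i1 then zero_part hd (a i1) (a e) else a i).
  move=> i; case: ifP => // _; case: ifP => // _; exact: isom_zero_part.
apply/funext => -[i x]; rewrite /= /shift /pw /=.
have [->|ie] := eqVneq i e.
  by rewrite /= bE eu; have := shiftK (e, b x); rewrite {1}/shift /= eqxx.
have [->|ii] := eqVneq i i1; last by rewrite /unshift /= (negPf ie) (negPf ii).
have [x0|x0] := eqVneq (x 0) l0.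
  by rewrite zero_part0// /unshift /= (negPf i1e) eqxx.
by rewrite zero_partN// /unshift /= eqxx a0 (negPf x0).
Qed.

End Shift.

Section Stabilizer.
Variables (d : nat) (hd : 1 < d) (I0 : finType).
Local Notation C := (stream d).
Local Notation P := (I0 * C)%type.
Local Notation l0 := (letter0 hd).
Implicit Types (I J K : finType).
Variable HH : (P -> P) -> Prop.
Hypotheses (gH : homgroup HH) (fH : homcocompact HH).
Variables (xi : P) (n1 : nat).
Hypothesis fixH : forall h, HH h -> h xi = xi.
Hypothesis rigid : forall I (f : I * C -> P) e g, frame f -> n1 <= #|I| ->
  img (chart f e) xi -> hom g -> g xi = xi -> moves g (chart f e) (chart f e) -> HH g.

Section Coordinates.
Variables (r : nat) (I : finType) (f : I * C -> P) (e i1 : I).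
Hypotheses (ff : frame f) (cI : n1 <= #|I|) (fe : f (e, stream0 hd) = xi).
Hypothesis stdl : forall b, piso r b -> exists2 a, forall i, isom (a i) & pw id b \o f = f \o pw id a.
Hypothesis stdr : forall a, (forall i, isom (a i)) -> exists2 b, piso r b & f \o pw id a = pw id b \o f.
Hypothesis stde : forall b, (forall i, isom (b i)) -> pw id b xi = xi ->
  moves (pw id b) (chart f e) (chart f e).
Hypothesis i1e : i1 != e.

Definition zeros n : seq 'I_d := mkseq (stream0 hd) n.
Definition ball n : C -> P := sub (chart f e) (zeros n).

Lemma zerosS n x : scat (zeros n.+1) x = scat [:: l0] (scat (zeros n) x).
Proof.
by rewrite -scat_cat; congr (scat _ _); exact: (mkseqDr hd (stream0 hd) 1 n).
Qed.

Lemma chart_e_inj : injective (chart f e).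
Proof. by move=> x y /(hom_inj ff.1)[]. Qed.

(** The difference n - m is the value at [g] of the contraction homomorphism to the integers; it is
    kept as a pair of depths. *)
Lemma degree_ex g : hom g -> g xi = xi -> exists m n, moves g (ball m) (ball n).
Proof.
move=> hg gx; have [fi [hfi fK fiK]] := hom_inv ff.1.
have hG : hom (fi \o (g \o f)) by apply: (hom_comp hd _ hfi); exact: (hom_comp hd ff.1 hg).
have [m mP] := hom_ls hG.
have [|j [v [a [ia aE]]]] := mP e (zeros m); first by rewrite size_mkseq.
have := aE (sdrop m (stream0 hd)); rewrite (scat_mkseq hd) /= fe gx -fe fK => -[je ev].
exists m, (size v); exists a => //; apply/funext => x.
have := congr1 f (aE x); rewrite /= fiK => ex.
rewrite -[LHS]/(g (f (e, scat (zeros m) x))) ex -je.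
rewrite -[RHS]/(f (e, scat (zeros (size v)) (a x))); congr (f (_, scat _ _)).
by have := scatK hd v (a (sdrop m (stream0 hd))); rewrite -ev.
Qed.

(** Cutting only the piece [e] to depth [n] gives a frame that has [ball n] among its pieces, and
    [rigid] applies to it. *)
Lemma degree0 n g : hom g -> g xi = xi -> moves g (ball n) (ball n) -> HH g.
Proof.
move=> hg gx mg; pose l i := if i == e then n else 0.
have chE : chart (f \o rmp (l := l)) (mkt l e (stream0 hd)) = ball n.
  by rewrite chart_mkt /l eqxx.
apply: (rigid (f := f \o rmp (l := l)) (e := mkt l e (stream0 hd))) => //.
- exact: frame_ref.
- exact: leq_trans (card_ref_le hd l).
- rewrite chE; exists (sdrop n (stream0 hd)).
  by rewrite /ball /sub /zeros (scat_mkseq hd).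
- by rewrite chE.
Qed.

Lemma degree_isom b n : (forall i, isom (b i)) -> pw id b xi = xi ->
  moves (pw id b) (ball n) (ball n).
Proof.
move=> ib bx; apply: (moves_sub_fixed hd n chart_e_inj (stde ib bx)).
by rewrite /chart fe.
Qed.

Let fi := projT1 (cid (hom_inv ff.1)).
Let hfi : hom fi. Proof. by case: (projT2 (cid (hom_inv ff.1))). Qed.
Let fK : cancel f fi. Proof. by case: (projT2 (cid (hom_inv ff.1))). Qed.
Let fiK : cancel fi f. Proof. by case: (projT2 (cid (hom_inv ff.1))). Qed.

Definition tau : P -> P := f \o (shift hd e i1 \o fi).
Definition sig : P -> P := f \o (unshift hd e i1 \o fi).

Lemma tauK : cancel tau sig.
Proof. by move=> p; rewrite /tau /sig /= fK shiftK// fiK. Qed.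

Lemma sigK : cancel sig tau.
Proof. by move=> p; rewrite /tau /sig /= fK unshiftK// fiK. Qed.

Lemma hom_tau : hom tau.
Proof.
apply: (hom_comp hd _ ff.1); apply: (hom_comp hd hfi); exact: hom_shift.
Qed.

Lemma hom_sig : hom sig.
Proof.
have [g [hg tg gt]] := hom_inv hom_tau.
suff -> : sig = g by []; apply/funext => p.
by rewrite -{1}(gt p) tauK.
Qed.

Lemma tau_xi : tau xi = xi.
Proof.
rewrite /tau /= -{1}fe fK /shift /= eqxx.
by rewrite -[in RHS]fe; congr (f (_, _)); exact: (scat_mkseq hd 1 (stream0 hd)).
Qed.

Lemma iter_tauK n : cancel (iter n tau) (iter n sig).
Proof. by elim: n => // n IH p; rewrite iterSr /= tauK IH. Qed.

Lemma iter_sigK n : cancel (iter n sig) (iter n tau).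
Proof. by elim: n => // n IH p; rewrite iterSr /= sigK IH. Qed.

Lemma hom_iter_tau n : hom (iter n tau).
Proof.
elim: n => [|n IH]; first exact: hom_id.
exact: (hom_comp hd IH hom_tau).
Qed.

Lemma hom_iter_sig n : hom (iter n sig).
Proof.
elim: n => [|n IH]; first exact: hom_id.
exact: (hom_comp hd IH hom_sig).
Qed.

Lemma iter_tau_xi n : iter n tau xi = xi.
Proof. by elim: n => //= n ->; exact: tau_xi. Qed.

Lemma iter_sig_xi n : iter n sig xi = xi.
Proof. by rewrite -{1}(iter_tau_xi n) iter_tauK. Qed.

Lemma degree_iter_tau m n : moves (iter m tau) (ball n) (ball (m + n)).
Proof.
elim: m => [|m IH]; first exact: sim_refl.
apply: (moves_comp IH); rewrite addSn; set k := m + n.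
suff -> : ball k.+1 = tau \o ball k by exact: sim_refl.
apply/funext => x; rewrite /tau /ball /sub /chart /= fK /shift /= eqxx.
by rewrite zerosS.
Qed.

Lemma degree_iter_sig m n : moves (iter m sig) (ball (m + n)) (ball n).
Proof. exact: moves_inv (iter_tauK m) (degree_iter_tau m n). Qed.

Lemma stab_tau g : hom g -> g xi = xi ->
  exists k, HH (iter k sig \o g) \/ HH (iter k tau \o g).
Proof.
move=> hg gx; have [m [n mg]] := degree_ex hg gx.
have [mn|/ltnW nm] := leqP m n.
  exists (n - m); left; apply: (@degree0 m).
  - exact: (hom_comp hd hg (hom_iter_sig _)).
  - by rewrite /= gx iter_sig_xi.
  - by apply: (moves_comp mg); have := degree_iter_sig (n - m) m; rewrite subnK.
exists (m - n); right; apply: (@degree0 m).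
- exact: (hom_comp hd hg (hom_iter_tau _)).
- by rewrite /= gx iter_tau_xi.
- by apply: (moves_comp mg); have := degree_iter_tau (m - n) n; rewrite subnK.
Qed.

(* Two powers of tau in the same double coset differ, up to HH, by an isometry
   fixing xi; the latter is in HH. *)
Lemma power_tau : exists2 M, 0 < M & HH (iter M tau).
Proof.
have [N [q [hq qP]]] := fH.
have /choice[i iP] (k : 'I_N.+1) : exists i, exists h a,
    [/\ HH h, piso 0 a & iter k tau = h \o q i \o pw id a].
  exact: qP (hom_iter_tau k).
have [k [l [kl ikl]]] : exists k l : 'I_N.+1, k < l /\ i k = i l.
  have : ~~ injectiveb i by apply/negP => /injectiveP/leq_card; rewrite !card_ord ltnn.
  move=> /injectivePn[k [l kl ee]].
  have [kl'|kl'|kl'] := ltngtP k l; [by exists k, l|by exists l, k|].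
  by move: kl; rewrite (val_inj kl') eqxx.
have [h [a [hh ia ek]]] := iP k; have [h' [a' [hh' ia' el]]] := iP l.
have [b ib [aK bK]] := pw_inv (fun j => (ia j).1).
have [hi hhi [hK hiK]] := hgV gH hh.
pose u := pw id b \o pw id a'.
have iu j : isom (b j \o a' j) by apply: isom_comp; [exact: ib|case: (ia' j)].
have elu : iter l tau = h' \o (hi \o (iter k tau \o u)).
  by rewrite el ek -ikl; apply/funext => p; rewrite /= bK hK.
have inj_u : injective (h' \o (hi \o iter k tau)).
  apply: inj_comp (hom_inj (hg_hom gH hh')) _.
  exact: inj_comp (hom_inj (hg_hom gH hhi)) (hom_inj (hom_iter_tau k)).
have ux : u xi = xi.
  apply: inj_u; have := congr1 (@^~ xi) elu; rewrite /= iter_tau_xi => <-.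
  by rewrite iter_tau_xi (fixH hhi) (fixH hh').
exists (l - k); first by rewrite subn_gt0.
have -> : iter (l - k) tau = h' \o (hi \o (iter k tau \o u \o iter k sig)).
  apply/funext => p; have := congr1 (@^~ (iter k sig p)) elu.
  rewrite -{1}(subnK (ltnW kl)) /= iterD iter_sigK => ->.
  by [].
apply: (hgM gH hh'); apply: (hgM gH hhi); apply: (@degree0 k).
- apply: (hom_comp hd (hom_iter_sig k)); apply: (hom_comp hd _ (hom_iter_tau k)).
  by apply: (hom_pw hd _ iu); exists id.
- by rewrite /= iter_sig_xi; have /= -> := ux; rewrite iter_tau_xi.
- apply: (@moves_comp _ _ _ _ _ (ball 0)); first by have := degree_iter_sig k 0; rewrite addn0.
  apply: (@moves_comp _ _ _ _ _ (ball 0)); last by have := degree_iter_tau k 0; rewrite addn0.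
  exact: degree_isom iu ux.
Qed.

Lemma stab_finite_cover : exists N (L : 'I_N -> P -> P),
  (forall j, hom (L j) /\ L j xi = xi) /\
  forall g, hom g -> g xi = xi -> exists j, exists2 h, HH h & g = L j \o h.
Proof.
have [N N0 HN] := power_tau.
have HNq q : HH (iter (q * N) tau).
  elim: q => [|q IH]; first exact: (hg1 gH).
  rewrite mulSn; suff -> : iter (N + q * N) tau = iter N tau \o iter (q * N) tau by exact: (hgM gH).
  by apply/funext => p; rewrite iterD.
exists N, (fun j => iter j tau); split=> [j|g hg gx].
  by split; [exact: hom_iter_tau|exact: iter_tau_xi].
have red k h : HH h -> exists j : 'I_N, exists2 h', HH h' & iter k tau \o h = iter j tau \o h'.
  move=> hh; exists (Ordinal (ltn_pmod k N0)), (iter (k %/ N * N) tau \o h).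
    exact: (hgM gH).
  by apply/funext => p; rewrite /= -iterD addnC -divn_eq.
have [k [hk|hk]] := stab_tau hg gx.
  have [j [h' hh' e']] := red k _ hk; exists j, h' => //; rewrite -e'.
  by apply/funext => p; rewrite /= iter_sigK.
(* The power of [tau] with exponent -k is written as the one with exponent k N - k times the inverse
   of the one with exponent k N, which is in [HH]. *)
have [hi hhi [hK hiK]] := hgV gH (HNq k).
have [j [h' hh' e']] := red (k * N - k) _ (hgM gH hhi hk); exists j, h' => //; rewrite -e'.
apply/funext => p; rewrite /=; apply: (hom_inj (hom_iter_tau k)).
by rewrite -iterD subnKC ?hiK// leq_pmulr.
Qed.

Definition level_fix g := HH g /\ exists2 b, piso r b & g = pw id b.

(** In the coordinates of [f] the element [v] acts by isometries of the pieces and fixes [xi], so by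
    [unshift_pw] its conjugate does too. The conjugate has degree 0 and is therefore in [HH]. *)
Lemma level_fix_tau v : level_fix v -> level_fix (sig \o (v \o tau)).
Proof.
move=> [hv [b rb vE]]; have [a ia aE] := stdl rb; have vx := fixH hv.
have ae : a e (stream0 hd) = stream0 hd.
  have := congr1 (@^~ (e, stream0 hd)) aE; rewrite /= fe -vE vx -fe => /(hom_inj ff.1).
  by case=> /esym.
have [a' ia' a'E] := unshift_pw (i1 := i1) i1e ia ae.
have [b' rb' b'E] := stdr ia'.
have e' : sig \o (v \o tau) = pw id b'.
  apply/funext => p; have := congr1 (@^~ (fi p)) b'E; rewrite /= fiK => <-.
  rewrite -a'E /sig /tau vE /= -[pw id b _]/((pw id b \o f) _) aE.
  by rewrite /= fK.
split; last by exists b'.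
rewrite e'; have xe : pw id b' xi = xi by rewrite -e' /= tau_xi vx -{1}tau_xi tauK.
apply: (@degree0 0); last by apply: degree_isom => // i; case: (rb' i).
  by apply: (hom_pw hd); [exists id|move=> i; case: (rb' i)].
exact: xe.
Qed.

(** The inclusion is strict: [w] exchanges the balls 0 and 1 of [i1] and is trivial elsewhere, so
    its conjugate by [tau] sends a point of [i1] into [e] and no longer preserves the pieces. If the
    conjugate by a higher power of [tau] were in the subgroup, conjugating back would put this one
    there. *)
Lemma level_fix_contracted : exists t ti w, [/\ HH t, HH ti, cancel t ti /\ cancel ti t &
  [/\ forall v, level_fix v -> level_fix (ti \o (v \o t)), level_fix w &
    ~ level_fix (t \o (w \o ti))]].
Proof.
have [[//|N] _ HN] := power_tau.
have [ti hti [tK tiK]] := hgV gH HN.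
have tiE : ti = iter N.+1 sig.
  by apply/funext => p; rewrite -[p in RHS]tiK iter_tauK.
have conjN k v : level_fix v -> level_fix (iter k sig \o (v \o iter k tau)).
  elim: k => [//|k IH] vv; have -> : iter k.+1 sig \o (v \o iter k.+1 tau) =
      sig \o ((iter k sig \o (v \o iter k tau)) \o tau).
    by apply/funext => p; rewrite /= -iterSr.
  by apply: level_fix_tau; exact: IH.
have [tl tli tlE] := tail_isom hd.
pose a i := if i == i1 then tl (tperm l0 (letter1 hd)) else id.
have ia i : isom (a i) by rewrite /a; case: ifP => _; [apply: tli; exact: perm_inj|exact: isom_id].
have [b rb bE] := stdr ia.
have wf p : pw id b (f p) = f (pw id a p) by have := congr1 (@^~ p) bE.
exists (iter N.+1 tau), ti, (pw id b); split=> //; split.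
- by move=> v; rewrite tiE; exact: conjN.
- split; last by exists b.
  have bx : pw id b xi = xi by rewrite -fe wf /pw /a /= eq_sym (negPf i1e).
  apply: (@degree0 0) => //; last by apply: degree_isom => // i; case: (rb i).
  by apply: (hom_pw hd); [exists id|move=> i; case: (rb i)].
- rewrite tiE => /(conjN N).
  have -> : iter N sig \o (iter N.+1 tau \o (pw id b \o iter N.+1 sig) \o iter N tau) =
      tau \o (pw id b \o sig).
    by apply/funext => p; rewrite /= -(iterS N tau) iterSr !iter_tauK.
  move=> [_ [b' rb' e']]; have [a' _ a'E] := stdl rb'.
  have /esym := congr1 (@^~ (i1, stream0 hd)) a'E.
  rewrite /= -e' /tau /sig /= !fK /unshift /= (negPf i1e) eqxx wf fK.
  rewrite /pw /a /= eqxx tlE tpermL /shift /= (negPf i1e) eqxx.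
  by move=> /(hom_inj ff.1)[/eqP]; rewrite (negPf i1e).
Qed.

End Coordinates.
End Stabilizer.

Theorem cocompact_dichotomy d (hd : 1 < d) (I0 : finType) (HH : (I0 * stream d -> I0 * stream d) -> Prop) :
  0 < #|I0| -> homgroup HH -> homclosed HH -> homcocompact HH ->
  (forall g, hom g -> HH g) \/ exists xi, [/\ forall h, HH h -> h xi = xi,
    exists N (L : 'I_N -> I0 * stream d -> I0 * stream d),
      (forall j, hom (L j) /\ L j xi = xi) /\
      forall g, hom g -> g xi = xi -> exists j, exists2 h, HH h & g = L j \o h &
    exists r t ti w, [/\ HH t, HH ti, cancel t ti /\ cancel ti t &
      [/\ forall v, level_fix HH r v -> level_fix HH r (ti \o (v \o t)), level_fix HH r w &
        ~ level_fix HH r (t \o (w \o ti))]]].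
Proof.
move=> I0pos gH cH fH.
have [|[xi [n1 [fixH rigid]]]] := rigidity hd I0pos gH cH fH; [by left|right].
(* The successor guarantees a second piece [i1] beside [e], even for n1 = 0. *)
pose r := n1.+1; have [I [f [e [ff cI fe [V1 V2 V3]]]]] := level_frame hd r xi.
have rI : r < #|I| by apply: leq_trans cI; exact: ltn_expl.
have [i1 i1e] : exists i1, i1 != e.
  by have [i1] := avoid (s := [:: e]) (leq_ltn_trans (ltn0Sn n1) rI); rewrite inE; exists i1.
have nI : n1 <= #|I| := ltnW (ltnW rI).
exists xi; split=> //.
- exact: (stab_finite_cover gH fH fixH rigid ff nI fe V3 i1e).
- exists r; exact: (level_fix_contracted gH fH fixH rigid ff nI fe V1 V2 V3 i1e).
Qed.

Local Open Scope classical_set_scope.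
Local Open Scope group_scope.
Local Open Scope nat_scope.

(** * The action of the Neretin group on the boundary *)

Section Bridge.
Variables (d k : nat) (hd : 1 < d).
Local Notation C := (stream d).
Local Notation P := ('I_k * stream d)%type.
Local Notation N := (neretin d k).
Local Notation V := (vertex d k).
Local Notation cls := (\pi_N)%qT.
Local Notation root := (Defs.root d k).

Lemma vx_subproof (i : 'I_k) (w : seq 'I_d) : is_vertex d k (val i :: map val w).
Proof. by rewrite /= ltn_ord; apply/allP => _ /mapP[x _ ->] /=. Qed.

Definition vx i w : V := Vertex (vx_subproof i w).

Lemma vx_inj i j u w : vx i u = vx j w -> i = j /\ u = w.
Proof.
by move=> /(congr1 (@word d k)) /= [/val_inj -> /(inj_map val_inj) ->].
Qed.

Lemma size_vx i w : size (vx i w) = (size w).+1. Proof. by rewrite /= size_map. Qed.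

Lemma vxP (v : V) : v <> root -> exists i w, v = vx i w.
Proof.
case: v => -[|x s] vs vr; first by case: vr; exact/val_inj.
have /= /andP[xk /allP sd] := vs.
exists (Ordinal xk), (pmap insub s); apply/val_inj; rewrite /=; congr (_ :: _).
elim: s sd {vs vr} => //= y s IH sd.
have yd : y < d by apply: sd; rewrite inE eqxx.
by rewrite insubT /= -IH// => z zs; apply: sd; rewrite inE zs orbT.
Qed.

Lemma child_vx i w (v : V) : child (vx i w) v <-> exists l, v = vx i (rcons w l).
Proof.
split=> [/childP[x e]|[l ->]]; last by apply/childP; exists (val l); rewrite /= map_rcons.
have [|j [u e']] := @vxP v; first by move=> vr; move: e; rewrite vr.
subst v; move: e; rewrite /= => -[/val_inj -> e].
case/lastP: u e => [|u l]; first by move=> /(congr1 size); rewrite size_rcons.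
by rewrite map_rcons => /rcons_inj[/(inj_map val_inj) -> _]; exists l.
Qed.

Definition en_letters (p : P) n : nat := if n is m.+1 then p.2 m else p.1.

Lemma en_word p n : mkseq (en_letters p) n.+1 = vx p.1 (mkseq p.2 n).
Proof.
rewrite /mkseq /= -[1]/(1 + 0) iotaDl -!map_comp; congr (_ :: _).
Qed.

Lemma en_subproof p n : is_vertex d k (mkseq (en_letters p) n).
Proof. by case: n => // n; rewrite en_word; exact: wordP. Qed.

Definition en p : tree_end d k := TreeEnd (en_subproof p).

Lemma ray_en p n : ray (en p) n.+1 = vx p.1 (mkseq p.2 n).
Proof. by apply/val_inj; rewrite /= en_word. Qed.

Lemma en_inj : injective en.
Proof.
move=> [i x] [j y] e.
have e' n : i = j /\ mkseq x n = mkseq y n by apply: vx_inj; rewrite -!(ray_en (_, _)) e.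
case: (e' 0) => -> _; congr (_, _); apply: agree_all => n; apply/(agreeP hd).
by case: (e' n).
Qed.

Lemma en_surj xi : exists p, en p = xi.
Proof.
have x0 : xi 0 < k by have := ray_vertex xi 1; rewrite /= andbT.
have xS n : xi n.+1 < d.
  have := ray_vertex xi n.+2; rewrite mkseqS is_vertex_rcons => /andP[_].
  by rewrite /mkseq.
exists (Ordinal x0, fun n => Ordinal (xS n)); apply: tree_end_eq.
by case.
Qed.

Definition act (g : N) (p : P) : P := projT1 (cid (en_surj (end_act g (en p)))).

Lemma actE g p : en (act g p) = end_act g (en p).
Proof. exact: projT2 (cid (en_surj (end_act g (en p)))). Qed.

Lemma act1 : act 1%g = id.
Proof. by apply/funext => p; apply: en_inj; rewrite actE end_act1. Qed.

Lemma actM g h : act (g * h)%g = act g \o act h.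
Proof. by apply/funext => p; apply: en_inj; rewrite /= !actE end_actM. Qed.

Lemma actK g : cancel (act g) (act g^-1%g).
Proof. by move=> p; rewrite -[LHS]/((act _ \o act _) p) -actM mulVg act1. Qed.

Lemma actKV g : cancel (act g^-1%g) (act g).
Proof. by move=> p; rewrite -[LHS]/((act _ \o act _) p) -actM mulgV act1. Qed.

Lemma act_maps (t : almost_aut d k) p q : maps_end t (en p) (en q) -> act (cls t) p = q.
Proof.
by move=> m; apply: en_inj; rewrite actE; apply: maps_end_uniq m; exact: end_actE.
Qed.

Section Local.
Variable t : almost_aut d k.

Lemma src_vx i w : ~ src t (vx i w) -> exists j u, t (vx i w) = vx j u.
Proof.
move=> /(iso_notin (amap_iso t)) nt; apply: vxP => e; apply: nt; rewrite e.
by case: (tgt_subtree t).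
Qed.

Lemma src_cat i w s : ~ src t (vx i w) -> ~ src t (vx i (w ++ s)).
Proof.
move=> nw; elim/last_ind: s => [|s l IH]; first by rewrite cats0.
apply: (subtree_child (src_subtree t) _ IH); apply/child_vx; exists l.
by rewrite rcons_cat.
Qed.

(** Below a vertex outside the source tree [t] respects the child relation, so the first n letters
    of the image suffix depend only on the first n letters of the suffix; [a] is the resulting map
    on streams. *)
Lemma local_map i w j u : ~ src t (vx i w) -> t (vx i w) = vx j u ->
  exists2 a : C -> C, nonexp a &
    forall x n, t (vx i (w ++ mkseq x n)) = vx j (u ++ mkseq (a x) n).
Proof.
move=> nw tw.
have /choice[E EP] (s : seq 'I_d) : exists s', t (vx i (w ++ s)) = vx j (u ++ s').
  elim/last_ind: s => [|s l [s' e]]; first by exists [::]; rewrite !cats0.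
  have /child_vx[l' ->] : child (vx j (u ++ s')) (t (vx i (w ++ rcons s l))).
    rewrite -e; apply: (iso_child (src_subtree t) (tgt_subtree t) (amap_iso t)).
      exact: src_cat.
    by apply/child_vx; exists l; rewrite rcons_cat.
  by exists (rcons s' l'); rewrite rcons_cat.
have E0 : E [::] = [::].
  have := EP [::]; rewrite cats0 tw -[u in LHS]cats0 => /vx_inj[_ /eqP].
  by rewrite eqseq_cat// eqxx => /eqP.
have ES s l : exists l', E (rcons s l) = rcons (E s) l'.
  have : child (t (vx i (w ++ s))) (t (vx i (w ++ rcons s l))).
    apply: (iso_child (src_subtree t) (tgt_subtree t) (amap_iso t)).
      exact: src_cat.
    by apply/child_vx; exists l; rewrite rcons_cat.
  rewrite !EP => /child_vx[l' /vx_inj[_ /eqP]].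
  by rewrite rcons_cat eqseq_cat// eqxx => /eqP ->; exists l'.
pose a x n := nth (letter0 hd) (E (mkseq x n.+1)) n.
have aE x n : E (mkseq x n) = mkseq (a x) n.
  elim: n => [|n IH]; first exact: E0.
  have [l' e] := ES (mkseq x n) (x n); rewrite mkseqS.
  rewrite -[mkseq (a x) n.+1]/(mkseq (a x) n.+1) [RHS]mkseqS -IH e; congr rcons.
  rewrite /a mkseqS e nth_rcons IH size_mkseq ltnn eqxx.
  done.
exists a => [n x y /(agreeP hd) xy|x n]; last by rewrite EP aE.
by apply/(agreeP hd); rewrite -!aE xy.
Qed.

End Local.

Lemma local_isom (t : almost_aut d k) i w j u : ~ src t (vx i w) -> t (vx i w) = vx j u ->
  exists2 a : C -> C, isom a &
    forall x n, t (vx i (w ++ mkseq x n)) = vx j (u ++ mkseq (a x) n).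
Proof.
move=> nw tw; have [a na aE] := local_map nw tw.
have nu : ~ tgt t (vx j u) by rewrite -tw; exact: (iso_notin (amap_iso t)).
have itw v : ~ src t v -> inv_aut t (t v) = v by exact: (iso_invK (amap_iso t)).
have wit : inv_aut t (vx j u) = vx i w by rewrite -tw itw.
have [b nb bE] := @local_map (inv_aut t) _ _ _ _ nu wit.
have cat_eq (s s1 s2 : seq 'I_d) : s ++ s1 = s ++ s2 -> s1 = s2.
  by move=> /eqP; rewrite eqseq_cat// eqxx => /eqP.
exists a => //; exists b; split=> // x; apply: agree_all => n; apply/(agreeP hd).
  have := bE (a x) n; rewrite -aE itw; last exact: src_cat.
  by move=> /vx_inj[_ /cat_eq].
have [v1 v2] := iso_invP (amap_iso t) (@src_cat (inv_aut t) j u (mkseq x n) nu).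
have := aE (b x) n; rewrite -bE /= v2.
by move=> /vx_inj[_ /cat_eq].
Qed.

Lemma act_local (t : almost_aut d k) i w j u (a : C -> C) :
  (forall x n, t (vx i (w ++ mkseq x n)) = vx j (u ++ mkseq (a x) n)) ->
  forall x, act (cls t) (i, scat w x) = (j, scat u (a x)).
Proof.
move=> aE x; apply: act_maps; exists (size w).+1 => -[//|n] /ltnSE wn.
exists (size u + (n - size w)).+1; rewrite !ray_en /= -[in LHS](subnKC wn).
by rewrite !(mkseqDr hd) !(scatK hd) !sdrop_scat aE.
Qed.

Lemma act_cls_local (t : almost_aut d k) i w j u : ~ src t (vx i w) -> t (vx i w) = vx j u ->
  exists2 a, isom a & forall x, act (cls t) (i, scat w x) = (j, scat u (a x)).
Proof.
by move=> nw tw; have [a ia aE] := local_isom nw tw; exists a => //; exact: act_local.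
Qed.

Lemma act_ls g : ls (act g).
Proof.
have [t ->] := cls_surj g; have [m mP] := finite_bounded (let: And3 a _ _ := src_subtree t in a).
exists m => i w mw; have nw : ~ src t (vx i w).
  by move=> /mP; rewrite size_vx leqNgt ltnS mw.
have [j [u tw]] := src_vx nw; have [a ia aE] := act_cls_local nw tw.
by exists j, u, a.
Qed.

Lemma hom_act g : hom (act g).
Proof.
by exists (act g^-1%g); split; [exact: actK|exact: actKV|exact: act_ls|exact: act_ls].
Qed.

(** If [w] extended [u] properly, a stream that starts with [u] and continues with another letter
    would leave the ball of [w]. This uses d > 1. *)
Lemma cylinder_inj (i j : 'I_k) (u w : seq 'I_d) (a b : C -> C) : isom a -> isom b ->
  (forall x, (i, scat u (a x)) = (j, scat w (b x))) -> i = j /\ u = w.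
Proof.
move=> ia ib e; split; first by have [] := e (stream0 hd).
wlog uw : i j u w a b ia ib e / size u <= size w.
  move=> wl; have [uw|/ltnW wu] := leqP (size u) (size w); first exact: (wl i j u w a b).
  by apply/esym; apply: (wl j i w u b a) => // x; rewrite e.
have [a' [ia' _ aK]] := isom_inv ia.
have e1 x : exists y, scat u x = scat w y by have [] := e (a' x); rewrite aK => _; exists (b (a' x)).
have [y0 ey0] := e1 (stream0 hd); have [v [wE _]] := scat_prefix hd uw ey0.
case: v wE => [|l v] wE; first by rewrite wE cats0.
have [l' ll'] : exists l', l' != l.
  by have [->|?] := eqVneq l (letter0 hd); [exists (letter1 hd)|exists (letter0 hd); rewrite eq_sym].
have [y1 ey1] := e1 (scat [:: l'] (stream0 hd)).
move: ey1; rewrite wE scat_cat => /(scat_inj hd erefl)[_] /(congr1 (@^~ 0)).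
by move=> /eqP; rewrite (negPf ll').
Qed.

Lemma act_inj : injective act.
Proof.
move=> g h; have [t ->] := cls_surj g; have [s ->] := cls_surj h => e.
have sC := subtreeU (src_subtree t) (src_subtree s).
apply: (eq_cls sC) => v /not_orP[tv sv].
have vr : v <> root by move=> vr; apply: tv; rewrite vr; case: (src_subtree t).
have [i [w vE]] := vxP vr; subst v.
have [j [u tw]] := src_vx tv; have [a ia aE] := act_cls_local tv tw.
have [j' [u' sw]] := src_vx sv; have [a' ia' aE'] := act_cls_local sv sw.
rewrite tw sw; have [|-> ->] // := @cylinder_inj j j' u u' a a' ia ia'.
by move=> x; rewrite -aE -aE' e.
Qed.

End Bridge.

(** * Every local similarity comes from an almost automorphism *)

Section Surjective.
Variables (d k : nat) (hd : 1 < d).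
Local Notation C := (stream d).
Local Notation P := ('I_k * stream d)%type.
Local Notation N := (neretin d k).
Local Notation V := (vertex d k).
Local Notation cls := (\pi_N)%qT.
Local Notation root := (Defs.root d k).

Definition tracks (f : P -> P) i w j u := exists2 a : C -> C, isom a &
  forall x, f (i, scat w x) = (j, scat u (a x)).

Lemma tracks_uniq f i w j u j' u' : tracks f i w j u -> tracks f i w j' u' -> j = j' /\ u = u'.
Proof.
by move=> [a ia aE] [b ib bE]; apply: (cylinder_inj hd ia ib) => x; rewrite -aE -bE.
Qed.

Lemma tracks_inv f g i w j u : cancel f g -> tracks f i w j u -> tracks g j u i w.
Proof.
move=> fK [a /isom_inv[b [ib aK bK]] aE]; exists b => // x.
by rewrite -[x in LHS]bK -aE fK.
Qed.

Lemma tracks_cat f i w j u (s : seq 'I_d) : tracks f i w j u ->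
  exists2 s', size s' = size s & tracks f i (w ++ s) j (u ++ s').
Proof.
move=> [a ia aE]; have [s' [a' [ss ia' a'E]]] := isom_scat hd s ia.
by exists s' => //; exists a' => // x; rewrite !scat_cat aE a'E.
Qed.

Lemma tracks_mkseq f i w j u (a : C -> C) x n : isom a ->
  (forall x, f (i, scat w x) = (j, scat u (a x))) ->
  tracks f i (w ++ mkseq x n) j (u ++ mkseq (a x) n).
Proof.
move=> ia aE; have [s' [a' [ss ia' a'E]]] := isom_scat hd (mkseq x n) ia.
exists a' => // y; rewrite !scat_cat aE a'E; congr (_, scat _ (scat _ _)).
have := a'E (sdrop n x); rewrite (scat_mkseq hd) => ->.
by have := scatK hd s' (a' (sdrop n x)); rewrite ss size_mkseq => ->.
Qed.

Variable phi : P -> P.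
Hypothesis hphi : hom phi.

Lemma hom_vertices : exists m (t : V -> V),
  (forall i w j u, tracks phi i w j u -> m <= size w -> t (vx i w) = vx j u) /\
  forall i w, m <= size w -> exists j u, tracks phi i w j u.
Proof.
have [m mP] := hom_ls hphi; exists m.
have ex i w : m <= size w -> exists j u, tracks phi i w j u.
  by move=> /(mP i w)[j [u [a [ia aE]]]]; exists j, u, a.
have /choice[t tP] (v : V) : exists v', forall i w j u, v = vx i w -> m <= size w ->
    tracks phi i w j u -> v' = vx j u.
  have [[i [w [vE mw]]]|no] := pselect (exists i w, v = vx i w /\ m <= size w); last first.
    by exists v => i w j u vE mw _; case: no; exists i, w.
  have [j [u tr]] := ex i w mw; exists (vx j u) => i' w' j' u'.
  by rewrite vE => /vx_inj[<- <-] _ /(tracks_uniq tr)[-> ->].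
by exists t; split=> // i w j u tr mw; apply: (tP _ i w).
Qed.

Lemma act_surj : exists g : N, act g = phi.
Proof.
have [m [t [tP tex]]] := hom_vertices; have [psi [hpsi phiK psiK]] := hom_inv hphi.
have [m' m'P] := hom_ls hpsi.
(* The vertex [vx i w] has length size w + 1, so outside [A] lie exactly the [vx i w] with size w >=
   m, where [t] follows [phi]. The target [B] has to be the complement of the image of [t]. *)
pose A : set V := [set v | size v <= m].
pose B : set V := [set v | ~ exists2 u, ~ A u & t u = v].
have AE i w : A (vx i w) <-> size w < m by rewrite /A /= size_map.
have AP v : ~ A v -> exists i w, v = vx i w /\ m <= size w.
  move=> Av; have [|i [w vE]] := @vxP _ _ v; first by move=> vr; apply: Av; rewrite vr.
  by exists i, w; split=> //; rewrite leqNgt; apply/negP => wm; apply: Av; rewrite vE; apply/AE.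
have vxA i w : m <= size w -> ~ A (vx i w) by move=> mw /AE; rewrite ltnNge mw.
have Avx v : ~ A v -> exists i w j u, [/\ v = vx i w, t v = vx j u, m <= size w & tracks phi i w j u].
  move=> /AP[i [w [-> mw]]]; have [j [u tr]] := tex i w mw.
  by exists i, w, j, u; split=> //; exact: tP.
have sA : finite_subtree A.
  split; [exact: finite_ball|by []|].
  by move=> u v /size_child e; rewrite /A /= e => /ltnW.
have Bn v : ~ B v -> exists2 u, ~ A u & t u = v by move=> /contrapT.
have Achild u v : child u v -> ~ A u -> ~ A v := subtree_child sA.
have tchild u v : ~ A u -> child u v -> child (t u) (t v).
  move=> /Avx[i [w [j [s [-> -> mw tr]]]]] /child_vx[l ->].
  have [[//|l' [|//]] _ tr'] := tracks_cat [:: l] tr.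
  rewrite -cats1 (tP _ _ _ _ tr'); last by rewrite size_cat (leq_trans mw) ?leq_addr.
  by rewrite cats1; apply/child_vx; exists l'.
have tchildV u z : ~ A u -> child (t u) z -> exists2 v, child u v & t v = z.
  move=> /Avx[i [w [j [s [-> -> mw tr]]]]] /child_vx[l ->].
  have [[//|l' [|//]] _ tr'] := tracks_cat [:: l] (tracks_inv phiK tr).
  exists (vx i (rcons w l')); first by apply/child_vx; exists l'.
  rewrite -!cats1; apply: tP; first exact: tracks_inv psiK tr'.
  by rewrite size_cat (leq_trans mw) ?leq_addr.
have tinj u v : ~ A u -> ~ A v -> t u = t v -> u = v.
  move=> /Avx[i [w [j [s [-> -> mw tr]]]]] /Avx[i' [w' [j' [s' [-> -> mw' tr']]]]].
  move=> /vx_inj[e1 e2]; subst j' s'.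
  by have [-> ->] := tracks_uniq (tracks_inv phiK tr) (tracks_inv phiK tr').
have sB : finite_subtree B.
  split.
  (* Of a word with at least m' + m letters, the first m' make [psi] a similarity, and the remaining
     ones are enough to put the preimage vertex outside [A]. *)
  - apply: (sub_finite_set _ (finite_ball d k (m' + m))) => z Bz /=.
    rewrite leqNgt; apply/negP => zs; apply: Bz.
    have [|j [u zE]] := @vxP _ _ z; first by move=> zr; rewrite zr in zs.
    move: zs; rewrite zE size_vx ltnS => su.
    have [|i [w [a [ia aE]]]] := m'P j (take m' u).
      by rewrite size_take; case: ltnP => // um; apply: leq_trans su; exact: leq_addr.
    have [|s ss tr] := @tracks_cat psi j (take m' u) i w (drop m' u); first by exists a.
    rewrite cat_take_drop in tr; exists (vx i (w ++ s)).
      by apply: vxA; rewrite size_cat ss size_drop (leq_trans _ (leq_addl _ _))// leq_subRL// (leq_trans _ su)// leq_addr.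
    apply: tP; first exact: tracks_inv psiK tr.
    by rewrite size_cat ss size_drop (leq_trans _ (leq_addl _ _))// leq_subRL// (leq_trans _ su)// leq_addr.
  - move=> [u /Avx[i [w [j [s [_ -> _ _]]]]] e].
    by have := congr1 (fun v : V => size v) e; rewrite size_vx.
  - move=> u v uv Bv [u' Au' e]; apply: Bv; rewrite -e in uv.
    have [v' u'v' e'] := tchildV _ _ Au' uv; exists v' => //.
    exact: Achild u'v' Au'.
have iphi : forest_iso A B t.
  split; [split|].
  - by move=> v Av; rewrite /B /= => nB; apply: nB; exists v.
  - by move=> u v; rewrite !inE; exact: tinj.
  - by move=> z /Bn[u Au <-]; exists u.
  - move=> u v Au Av; rewrite /adj.
    have h u' v' : ~ A u' -> ~ A v' -> child (t u') (t v') = child u' v'.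
      move=> Au' Av'; apply/idP/idP; last exact: tchild.
      move=> /(tchildV _ _ Au')[v1 c e]; rewrite -(tinj v1 v' _ Av' e)//.
      exact: Achild c Au'.
    by rewrite !h.
pose a := AlmostAut sA sB (iso_card_boundary sA sB iphi) iphi.
exists (cls a); apply/funext => -[i x].
have [j [u [b ib bE]]] := tex i (mkseq x m) ltac:(by rewrite size_mkseq).
rewrite -(scat_mkseq hd m x) bE; apply: (act_local hd) => y n.
by apply: tP; [exact: tracks_mkseq|rewrite size_cat size_mkseq leq_addr].
Qed.

End Surjective.

(** * Rooted automorphisms as isometries *)

Section Rooted.
Variables (d k : nat) (hd : 1 < d).
Local Notation C := (stream d).
Local Notation P := ('I_k * stream d)%type.
Local Notation V := (vertex d k).
Local Notation root := (Defs.root d k).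

(** The first letter of a vertex is the index of its piece, whence the shift from [n.+1] to [n]. *)
Lemma rooted_isometry n (a : rooted_aut d k) : fixes_ball n.+1 a ->
  exists2 b, piso n b & act (rooted_inclusion a) = pw id b.
Proof.
move=> fa; have vr i w : ~ [set root] (vx i w : V) by move=> /(congr1 (@word d k)).
have /choice[b bP] i : exists b : C -> C, isom b /\
    forall x n, a (vx i (mkseq x n)) = vx i (mkseq (b x) n).
  have [|b ib bE] := @local_isom d k hd (aut_of_rooted a) i [::] i [::] (@vr i [::]).
    by apply: fa; rewrite size_vx.
  by exists b.
exists b.
  move=> i; case: (bP i) => ib bE; split=> // x; apply/(agreeP hd).
  have e : vx i (mkseq x n) = vx i (mkseq (b i x) n).
    by rewrite -bE fa// size_vx size_mkseq.
  by have [] := vx_inj e.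
apply/funext => -[i x]; case: (bP i) => ib bE.
by have := act_local hd (t := aut_of_rooted a) (w := [::]) (u := [::]) bE x; rewrite !scat0.
Qed.

(** A vertex is sent to the prefix of the image of one stream through it; for nonexpanding maps any
    other stream through it gives the same prefix. The root is not of the form [vx i w] and is
    kept. *)
Definition isom_vertex (b : 'I_k -> C -> C) (v : V) : V :=
  match pselect (exists iw, v = vx iw.1 iw.2) with
  | left e => let iw := projT1 (cid e) in
      vx iw.1 (mkseq (b iw.1 (scat iw.2 (stream0 hd))) (size iw.2))
  | right _ => v
  end.

Lemma isom_vertexE b i w :
  isom_vertex b (vx i w) = vx i (mkseq (b i (scat w (stream0 hd))) (size w)).
Proof.
rewrite /isom_vertex; case: pselect => [e|[]]; last by exists (i, w).
by case: cid => -[j u] /= /vx_inj[<- <-].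
Qed.

Lemma isom_vertex_root b : isom_vertex b root = root.
Proof.
rewrite /isom_vertex; case: pselect => // -[[i w] e]; exfalso.
by have := congr1 (@word d k) e.
Qed.

Lemma isom_vertex_mkseq b i x n : isom (b i) ->
  isom_vertex b (vx i (mkseq x n)) = vx i (mkseq (b i x) n).
Proof.
move=> ib; rewrite isom_vertexE size_mkseq; congr vx; apply/(agreeP hd).
apply/(isom_agree n _ _ ib)/agree_sym; exact: (agree_mkseq hd).
Qed.

Lemma vertex_cases (v : V) : v = root \/ exists i x n, v = vx i (mkseq x n).
Proof.
have [->|vr] := pselect (v = root); [by left|right].
have [i [w ->]] := vxP vr; exists i, (scat w (stream0 hd)), (size w).
by rewrite (scatK hd).
Qed.

Lemma isom_vertexK b c : (forall i, isom (b i)) -> (forall i, isom (c i)) ->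
  (forall i, cancel (b i) (c i)) -> cancel (isom_vertex b) (isom_vertex c).
Proof.
move=> ib ic bK v; have [->|[i [x [n ->]]]] := vertex_cases v.
  by rewrite !isom_vertex_root.
by rewrite !isom_vertex_mkseq// bK.
Qed.

Lemma isom_vertex_child b u v : (forall i, isom (b i)) -> child u v ->
  child (isom_vertex b u) (isom_vertex b v).
Proof.
move=> ib uv; have [vr|[j [y [m vE]]]] := vertex_cases v.
  by rewrite vr in uv; case: (child_root uv).
have [ur|[i [x [n uE]]]] := vertex_cases u.
  have m0 : m = 0 by have := size_child uv; rewrite ur vE size_vx size_mkseq => -[].
  rewrite ur isom_vertex_root vE isom_vertex_mkseq// m0.
  by rewrite ur vE m0 in uv; move: uv => /childP[z e]; apply/childP; exists z.
rewrite uE vE in uv *; have /child_vx[l /vx_inj[ij]] := uv.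
have mn : m = n.+1 by have := size_child uv; rewrite !size_vx !size_mkseq => -[].
rewrite ij mn => e; have /rcons_inj[/(agreeP hd) xy _] : rcons (mkseq y n) (y n) = rcons (mkseq x n) l by rewrite -mkseqS.
rewrite !isom_vertex_mkseq//; apply/child_vx; exists (b i y n); rewrite mkseqS.
by congr (vx _ (rcons _ _)); apply/(agreeP hd)/isom_agree.
Qed.

Lemma isometry_rooted n b : piso n b -> exists2 a : rooted_aut d k,
  fixes_ball n.+1 a & act (rooted_inclusion a) = pw id b.
Proof.
move=> pb; have ib i : isom (b i) by case: (pb i).
have /choice[c cP] i : exists c, [/\ isom c, cancel (b i) c & cancel c (b i)].
  exact: isom_inv.
have ic i : isom (c i) by case: (cP i).
have bK : cancel (isom_vertex b) (isom_vertex c) by apply: isom_vertexK => // i; case: (cP i).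
have cK : cancel (isom_vertex c) (isom_vertex b) by apply: isom_vertexK => // i; case: (cP i).
have badj u v : adj (isom_vertex b u) (isom_vertex b v) = adj u v.
  have h u' v' : child (isom_vertex b u') (isom_vertex b v') = child u' v'.
    apply/idP/idP; last exact: isom_vertex_child.
    by move=> /(isom_vertex_child ic); rewrite !bK.
  by rewrite /adj !h.
pose a := RootedAut (Bijective bK cK) (isom_vertex_root b) badj.
exists a.
  move=> v; have [-> _|[i [x [m ->]]]] := vertex_cases v; first exact: isom_vertex_root.
  rewrite size_vx size_mkseq ltnS => mn; rewrite /= isom_vertex_mkseq//.
  congr vx; apply/(agreeP hd); apply: agree_sym; apply: (agree_le mn).
  by case: (pb i).
apply/funext => -[i x].
have := act_local hd (t := aut_of_rooted a) (i := i) (j := i) (w := [::]) (u := [::]) (a := b i) _ x.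
rewrite !scat0; apply => y m.
exact: isom_vertex_mkseq.
Qed.

End Rooted.

Local Open Scope group_scope.

(** * Locally profinite groups and Haar measure *)

(* A locally profinite group G with a countable basis: U n / U n.+1 is finite
   (chf), U 0 is complete (chl) and G / U n is countable (chc). *)
Record chain (G : topologicalGroupType) (U : nat -> set G) : Prop := Chain {
  ch1 : forall n, U n 1 ;
  chV : forall n x y, U n x -> U n y -> U n (x^-1 * y) ;
  chS : forall n, U n.+1 `<=` U n ;
  cho : forall n, open (U n) ;
  chb : forall A, nbhs 1 A -> exists n, U n `<=` A ;
  chf : forall n, exists (T : finType) (f : G -> T), forall x y, U n x -> U n y ->
    f x = f y <-> U n.+1 (x^-1 * y) ;
  chl : forall x : nat -> G, (forall n, U n ((x n)^-1 * x n.+1)) ->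
    exists y, forall n, U n ((x n)^-1 * y) ;
  chc : forall n, exists g : nat -> G, forall x, exists i, U n ((g i)^-1 * x) }.

Section Translations.
Variable G : topologicalGroupType.
Implicit Types (x y z : G) (A B : set G).

Definition lmul x y := x * y.
Definition rmul x y := y * x.

Lemma lmul_continuous x : continuous (lmul x).
Proof.
move=> y; apply: (@continuous_comp _ _ _ (fun z : G => (x, z))
  (fun xy : G * G => xy.1 * xy.2)); last exact: mulg_continuous.
by apply: cvg_pair; [exact: cvg_cst|exact: cvg_id].
Qed.

Lemma rmul_continuous x : continuous (rmul x).
Proof.
move=> y; apply: (@continuous_comp _ _ _ (fun z : G => (z, x))
  (fun xy : G * G => xy.1 * xy.2)); last exact: mulg_continuous.
by apply: cvg_pair; [exact: cvg_id|exact: cvg_cst].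
Qed.

Lemma lmul_imageE x A : lmul x @` A = lmul x^-1 @^-1` A.
Proof.
apply/seteqP; split=> [_ [y Ay <-]|y Ay]; first by rewrite /= /lmul mulKg.
by exists (x^-1 * y) => //; rewrite /lmul mulVKg.
Qed.

Lemma rmul_imageE x A : rmul x @` A = rmul x^-1 @^-1` A.
Proof.
apply/seteqP; split=> [_ [y Ay <-]|y Ay]; first by rewrite /= /rmul mulgK.
by exists (y * x^-1) => //; rewrite /rmul mulgKV.
Qed.

Lemma open_lmul x A : open A -> open (lmul x @` A).
Proof. by rewrite lmul_imageE; apply: open_comp => y _; exact: lmul_continuous. Qed.

Lemma open_rmul x A : open A -> open (rmul x @` A).
Proof. by rewrite rmul_imageE; apply: open_comp => y _; exact: rmul_continuous. Qed.

End Translations.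

Section Cosets.
Variables (G : topologicalGroupType) (U : nat -> set G).
Hypothesis ch : chain U.
Implicit Types (x y z : G) (A B : set G).

Definition cs x n : set G := [set y | U n (x^-1 * y)].

Lemma cs_refl x n : cs x n x.
Proof. by rewrite /cs /= mulVg; exact: ch1. Qed.

Lemma chI n x : U n x -> U n x^-1.
Proof. by move=> Ux; rewrite -[x^-1]mulg1; apply: chV => //; exact: ch1. Qed.

Lemma chM n x y : U n x -> U n y -> U n (x * y).
Proof. by move=> Ux Uy; rewrite -[x]invgK; apply: chV => //; exact: chI. Qed.

Lemma ch_le m n : m <= n -> U n `<=` U m.
Proof.
by move=> /subnK <-; elim: (n - m)%N => [//|j IH]; rewrite addSn => x /(chS ch)/IH.
Qed.

Lemma cs_sym x y n : cs x n y -> cs y n x.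
Proof. by rewrite /cs /= => /chI; rewrite invgM invgK. Qed.

Lemma cs_trans x y z n : cs x n y -> cs y n z -> cs x n z.
Proof.
rewrite /cs /= => xy yz; have -> : x^-1 * z = (x^-1 * y) * (y^-1 * z).
  by rewrite mulgA mulgK.
exact: chM.
Qed.

Lemma cs_eq x y n : cs x n y -> cs x n = cs y n.
Proof.
move=> xy; apply/seteqP; split=> z; first by apply: cs_trans; exact: cs_sym.
exact: cs_trans.
Qed.

Lemma cs_le x m n : m <= n -> cs x n `<=` cs x m.
Proof. by move=> mn y; exact: ch_le. Qed.

Lemma cs_meet x y z m n : m <= n -> cs x m z -> cs y n z -> cs y n `<=` cs x m.
Proof. by move=> mn /cs_eq -> /cs_eq ->; exact: cs_le. Qed.

Lemma cs1 n : cs 1 n = U n.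
Proof. by apply/seteqP; split=> x; rewrite /cs /= invg1 mul1g. Qed.

Lemma lmul_cs x y n : lmul x @` cs y n = cs (x * y) n.
Proof. by rewrite lmul_imageE; apply/seteqP; split=> z; rewrite /cs /= /lmul invgM mulgA. Qed.

Lemma open_cs x n : open (cs x n).
Proof. by rewrite -[x]mulg1 -lmul_cs cs1; apply: open_lmul; exact: cho. Qed.

Lemma open_coset A x : open A -> A x -> exists n, cs x n `<=` A.
Proof.
move=> oA Ax; have [|n UA] := chb ch (A := lmul x^-1 @` A).
  apply: open_nbhs_nbhs; split; first exact: open_lmul.
  by exists x => //; rewrite /lmul mulVg.
exists n => y /UA [z Az]; rewrite /lmul => /(congr1 (mulg x)).
by rewrite !mulVKg => <-.
Qed.

Lemma chain_reps : exists (q : nat -> nat) (e : nat -> nat -> G), forall n,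
  [/\ 0 < q n, forall j, j < q n -> U n (e n j),
    forall x, U n x -> exists2 j, j < q n & U n.+1 ((e n j)^-1 * x) &
    forall i j, i < q n -> j < q n -> U n.+1 ((e n i)^-1 * e n j) -> i = j].
Proof.
suff h n : exists qe : nat * (nat -> G), [/\ 0 < qe.1, forall j, j < qe.1 -> U n (qe.2 j),
    forall x, U n x -> exists2 j, j < qe.1 & U n.+1 ((qe.2 j)^-1 * x) &
    forall i j, i < qe.1 -> j < qe.1 -> U n.+1 ((qe.2 i)^-1 * qe.2 j) -> i = j].
  by have /choice[qe qeP] := h; exists (fun n => (qe n).1), (fun n => (qe n).2).
have [T [f fP]] := chf ch n.
pose s := [seq t <- enum T | `[< exists2 x, U n x & f x = t >]].
have sP t : t \in s <-> exists2 x, U n x & f x = t.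
  by rewrite mem_filter mem_enum andbT; split=> /asboolP.
have us : uniq s by rewrite filter_uniq// enum_uniq.
have [t0 ts0] : exists t0, t0 \in s.
  by exists (f 1); apply/sP; exists 1 => //; exact: ch1.
have /choice[e eP] j : exists x, j < size s -> U n x /\ f x = nth t0 s j.
  have [js|_] := boolP (j < size s); last by exists 1.
  by have /sP[x Ux fx] := mem_nth t0 js; exists x.
exists (size s, e); split=> /=.
- by case: (s) ts0.
- by move=> j /eP[].
- move=> x Ux; have ts : f x \in s by apply/sP; exists x.
  exists (index (f x) s); first by rewrite index_mem.
  have [|h1 h2] := eP (index (f x) s); first by rewrite index_mem.
  by apply/fP => //; rewrite h2 nth_index.
- move=> i j si sj; have [ui fi] := eP _ si; have [uj fj] := eP _ sj.
  by move=> /(fP _ _ ui uj); rewrite fi fj => /eqP; rewrite nth_uniq// => /eqP.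
Qed.

End Cosets.

Section Reps.
Variables (G : topologicalGroupType) (U : nat -> set G).
Hypothesis ch : chain U.
Variables (q : nat -> nat) (e : nat -> nat -> G).
Hypothesis qe : forall n,
  [/\ 0 < q n, forall j, j < q n -> U n (e n j),
    forall x, U n x -> exists2 j, j < q n & U n.+1 ((e n j)^-1 * x) &
    forall i j, i < q n -> j < q n -> U n.+1 ((e n i)^-1 * e n j) -> i = j].
Local Notation cs := (cs U).

Lemma cs_split x n y : cs x n y <-> exists2 j, j < q n & cs (x * e n j) n.+1 y.
Proof.
have [_ e1 e2 e3] := qe n; split.
  by move=> /e2[j jq h]; exists j => //; rewrite /cs /= invgM -mulgA.
move=> [j /e1 Ue /(chS ch)]; rewrite invgM -mulgA => /(chM ch Ue).
by rewrite mulVKg.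
Qed.

Lemma cs_child x n j : j < q n -> cs (x * e n j) n.+1 `<=` cs x n.
Proof. by move=> jq y cy; apply/cs_split; exists j. Qed.

Lemma cs_child_inj x n i j y : i < q n -> j < q n ->
  cs (x * e n i) n.+1 y -> cs (x * e n j) n.+1 y -> i = j.
Proof.
have [_ _ _ e3] := qe n => iq jq /(cs_trans ch) h /(cs_sym ch) /h.
by rewrite /cs /= invgM -mulgA mulKg; exact: e3.
Qed.

(* Otherwise cosets without the property Q would shrink to a point. *)
Lemma descent (Q : nat -> set G -> Prop) :
  (forall n x, (forall j, j < q n -> Q n.+1 (cs (x * e n j) n.+1)) -> Q n (cs x n)) ->
  forall m x, (forall y, exists2 n, m <= n & Q n (cs y n)) -> Q m (cs x m).
Proof.
move=> step m x near; apply: contrapT => nQ.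
have /choice[s sP] (nz : nat * G) : exists j, ~ Q nz.1 (cs nz.2 nz.1) ->
    j < q nz.1 /\ ~ Q nz.1.+1 (cs (nz.2 * e nz.1 j) nz.1.+1).
  have [h|h] := pselect (Q nz.1 (cs nz.2 nz.1)); first by exists 0.
  apply: contrapT => no; apply: h; apply: step => j jq.
  by apply: contrapT => h; apply: no; exists j.
pose z := fix z i := if i is i'.+1 then z i' * e (m + i') (s (m + i', z i'))%N else x.
have zP i : ~ Q (m + i)%N (cs (z i) (m + i)).
  elim: i => [|i /(sP (m + i, z i)%N)[_]] /=; first by rewrite addn0.
  by rewrite addnS.
have zU i : U (m + i) ((z i)^-1 * z i.+1).
  have [jq _] := sP (m + i, z i)%N (zP i); rewrite /= mulKg.
  by have [_ e1 _ _] := qe (m + i); exact: e1.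
have [y yP] : exists y, forall n, U n ((z (n - m)%N)^-1 * y).
  apply: (chl ch) => n; have [mn|nm] := leqP m n.
    by rewrite subSn// -{1}(subnKC mn).
  by rewrite (eqP (ltnW nm : n - m == 0)%N) (eqP (nm : n.+1 - m == 0)%N) mulVg; exact: ch1.
have [n mn] := near y; have := yP n; rewrite -/(cs (z (n - m)%N) n y) => /(cs_eq ch) <-.
by have := zP (n - m)%N; rewrite subnKC.
Qed.

(** Having a finite subcover passes from the finitely many cosets of the next level to their union,
    and around each point a small coset lies in a single member of the cover, so [descent] applies.
    The property [Q] is void for cosets outside [cs x n]. *)
Lemma compact_cs x n : compact (cs x n).
Proof.
rewrite compact_cover => I D f of_ cf.
pose Q (m : nat) (A : set G) := A `<=` cs x n -> exists2 D' : {fset I}, {subset D' <= D} &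
  A `<=` \bigcup_(i in [set` D']) f i.
suff : Q n (cs x n) by apply.
apply: (@descent Q) => [m y h ys|y].
  have /choice[E EP] j : exists D' : {fset I}, j < q m -> {subset D' <= D} /\
      cs (y * e m j) m.+1 `<=` \bigcup_(i in [set` D']) f i.
    have [jq|_] := boolP (j < q m); last by exists fset0.
    have [|D' D'D c] := h j jq; last by exists D'.
    by apply: subset_trans ys; exact: cs_child.
  exists (\bigcup_(j <- iota 0 (q m)) E j)%fset.
    move=> i /bigfcupP[j]; rewrite andbT mem_iota => /andP[_ jq] ij.
    by have [ED _] := EP j jq; exact: ED.
  move=> z /cs_split[j jq zj]; have [_ /(_ z zj)[i Ei fz]] := EP j jq.
  exists i => //=; apply/bigfcupP; exists j => //.
  by rewrite andbT mem_iota.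
have [ys|ny] := pselect (cs x n y); last first.
  exists n => // /(_ y (cs_refl ch y n)) ys.
  by case: ny; rewrite /Q.
have [i Di fy] := cf y ys; have [m ym] := open_coset ch (of_ i Di) fy.
exists (maxn n m); first exact: leq_maxl.
move=> _; exists [fset i]%fset.
  by move=> j; rewrite inE => /eqP ->; rewrite inE.
move=> z /(cs_le ch (leq_maxr n m))/ym fz.
by exists i => //=; rewrite inE.
Qed.

End Reps.

Import Order.TTheory GRing.Theory Num.Theory.

(** * An obstruction to unimodularity *)

Section Borel.
Variables (R : realType) (G : topologicalGroupType).
Implicit Types (x y z : G) (A B : set G).

Lemma open_borel A : open A -> (@measurable _ (borel G)) A.
Proof. exact: sub_sigma_algebra. Qed.

(** For a bi-invariant measure the subgroup t^-1 V t of V has the measure of V. It misses [w], so it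
    is disjoint from its translate by [w], which also lies in V. Hence mu V = 0, and countably many
    translates of V cover the group. *)
Lemma not_unimodular (U : nat -> set G) n (t w : G) (V : set G) : chain U ->
  open V -> compact V -> (forall x y, V x -> V y -> V (x^-1 * y)) -> U n `<=` V ->
  V w -> (forall v, V v -> V (t^-1 * v * t)) -> ~ V (t * w * t^-1) -> ~ unimodular R G.
Proof.
move=> ch oV cV VV UV Vw Vt nw [mu [mu0 [fin _ _] linv] rinv].
have V1 : V 1 by apply: UV; exact: ch1.
pose A := rmul t @` (lmul t^-1 @` V).
have AE x : A x <-> V (t * x * t^-1).
  split=> [[_ [v Vv <-] <-]|Vx].
    by rewrite /rmul /lmul !mulgA mulgV mul1g mulgK.
  exists (x * t^-1); last by rewrite /rmul mulgKV.
  by exists (t * x * t^-1) => //; rewrite /lmul -mulgA mulKg.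
have oA : open A by apply/open_rmul/open_lmul.
have AV : A `<=` V.
  by move=> _ [_ [v Vv <-] <-]; rewrite /rmul /lmul; exact: Vt.
have mA := open_borel oA; have mV := open_borel oV.
have muA : mu A = mu V.
  rewrite -[RHS](linv t^-1 V mV); apply: rinv; exact: (open_borel (open_lmul t^-1 oV)).
have owA : open (lmul w @` A) by exact: open_lmul.
have disj : A `&` (lmul w @` A) = set0.
  apply/seteqP; split=> // x [Ax [a /AE Aa xE]]; apply: nw.
  rewrite -xE in Ax; move/AE: Ax => Ax.
  have VI y : V y -> V y^-1 by move=> Vy; rewrite -[y^-1]mulg1; exact: VV.
  have := VV _ _ (VI _ Ax) (VI _ Aa).
  by rewrite /lmul !invgM !invgK !mulgA mulgKV mulgK.
have wAV : lmul w @` A `<=` V.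
  move=> _ [a /AV Va <-]; rewrite /lmul -[w]invgK; apply: (VV) => //.
  by rewrite -[w^-1]mulg1; exact: (VV _ _ Vw V1).
have le2 : (mu V + mu V <= mu V)%E.
  rewrite -{1}muA -{1}muA -{2}(linv w A mA) -measureU//; last exact: open_borel.
  apply: le_measure; rewrite ?inE//; first by apply: measurableU => //; exact: open_borel.
  by move=> x [/AV|/wAV].
have V0 : mu V = 0%E.
  have h0 : (0 <= mu V)%E by exact: measure_ge0.
  have := fin V cV; move: h0 le2.
  case: (mu V) => [r| |] //; rewrite -EFinD !lee_fin => r0 rr _.
  congr EFin; apply/eqP; rewrite eq_le r0 andbT.
  by rewrite -(lerD2l r) addr0.
apply: mu0; apply/eqP; rewrite eq_le measure_ge0 andbT.
have [g gP] := chc ch n.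
pose F i := lmul (g i) @` V.
have mF i : (@measurable _ (borel G)) (F i) by exact: (open_borel (open_lmul (g i) oV)).
apply: (@le_trans _ _ (\sum_(i <oo) mu (F i))%E).
  apply: measure_sigma_subadditive => // x _.
  have [i /UV h] := gP x; exists i => //; exists ((g i)^-1 * x) => //.
  by rewrite /lmul mulVKg.
rewrite eseries0// => i _ _; rewrite -V0; exact: linv.
Qed.

End Borel.

Section Power.
Variable G : topologicalGroupType.

(* mu_ext asks for a semiring of sets; here all sets are measurable. *)
Definition power : Type := G.

HB.instance Definition _ := Pointed.on power.
HB.instance Definition _ := @isMeasurable.Build default_measure_display power
  (@discrete_measurable G) (@discrete_measurable0 G) (@discrete_measurableC G)
  (@discrete_measurableU G).

End Power.

(** * Haar measure from the indices of the chain *)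

Section Outer.
Variables (R : realType) (G : topologicalGroupType) (U : nat -> set G).
Hypothesis ch : chain U.
Variables (q : nat -> nat) (e : nat -> nat -> G).
Hypothesis qe : forall n,
  [/\ 0 < q n, forall j, j < q n -> U n (e n j),
    forall x, U n x -> exists2 j, j < q n & U n.+1 ((e n j)^-1 * x) &
    forall i j, i < q n -> j < q n -> U n.+1 ((e n i)^-1 * e n j) -> i = j].
Local Notation cs := (cs U).
Implicit Types (x y z : G) (A B : set G).
Local Open Scope ereal_scope.

(** The inverse of the index of [U n] in [U 0]: the Haar measure of [U n] normalized by giving [U 0]
    measure 1. *)
Definition vol n : \bar R := ((\prod_(i < n) q i)%N%:R^-1)%R%:E.

Lemma vol_ge0 n : 0 <= vol n.
Proof. by rewrite lee_fin invr_ge0 ler0n. Qed.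

Lemma q_gt0 n : (0 < q n)%N. Proof. by case: (qe n). Qed.

Lemma volS n : \sum_(j < q n) vol n.+1 = vol n.
Proof.
rewrite sumEFin; congr EFin; rewrite sumr_const card_ord big_ord_recr /= natrM.
have qn : ((q n)%:R != 0 :> R)%R by rewrite pnatr_eq0 -lt0n q_gt0.
by rewrite invfM -[LHS]mulr_natr -mulrA mulVf// mulr1.
Qed.

(** One set may be a coset of several levels; all indices between these levels are then 1. This is
    what gives [weight] the value [vol n] on every coset of level [n]. *)
Lemma U_eq_vol m n : (m <= n)%N -> U m `<=` U n -> vol m = vol n.
Proof.
move=> mn; rewrite -(subnKC mn); elim: (n - m)%N => [|j IH]; first by rewrite addn0.
rewrite addnS => UU; rewrite IH; last by move=> x /UU/(chS ch).
have [q0 e1 _ e3] := qe (m + j); suff q1 : q (m + j) = 1%N.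
  by rewrite -volS q1 big_ord1.
apply/eqP; rewrite eqn_leq q0 andbT leqNgt; apply/negP => q2.
suff : 0%N = 1%N by [].
apply: (e3 0%N 1%N) => //; apply: UU; apply: (ch_le ch (leq_addr j m)).
by apply: (chV ch); exact: e1.
Qed.

Lemma cs_vol x y m n : cs x m = cs y n -> vol m = vol n.
Proof.
wlog mn : x y m n / (m <= n)%N.
  move=> wl xy; have [mn|nm] := leqP m n; first exact: (wl x y).
  exact/esym/(wl y x n m (ltnW nm)).
move=> xy; apply: U_eq_vol => //.
have yx : cs y n x by rewrite -xy; exact: cs_refl.
move: xy; rewrite (cs_eq ch yx) => xy z Uz.
have : cs x m (x * z)%g by rewrite /cs /= mulKg.
by rewrite xy /cs /= mulKg.
Qed.

(* infinite on the sets that are not cosets, so that only the covers by cosets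
   matter in the outer measure it generates *)
Definition weight (A : set G) : \bar R :=
  if `[< A = set0 >] then 0
  else ereal_inf [set vol n | n in [set n | exists x, A = cs x n]].

Definition haar : set G -> \bar R := @mu_ext _ (power G) R weight.

Lemma weight0 : weight set0 = 0.
Proof. by rewrite /weight asboolT. Qed.

Lemma weight_ge0 A : 0 <= weight A.
Proof.
rewrite /weight; case: asboolP => // _; apply: le_ereal_inf_tmp => _ [n _ <-].
exact: vol_ge0.
Qed.

Lemma weight_cs x n : weight (cs x n) = vol n.
Proof.
rewrite /weight asboolF; last by move=> c0; have := cs_refl ch x n; rewrite c0.
apply/eqP; rewrite eq_le; apply/andP; split.
  by apply: ereal_inf_lbound; exists n => //; exists x.
by apply: le_ereal_inf_tmp => _ [m [y /cs_vol ->] <-].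
Qed.

Lemma weight_coset A : weight A < +oo -> A = set0 \/ exists x n, A = cs x n.
Proof.
rewrite /weight; case: asboolP => [|_ lt]; [by left|right].
apply: contrapT => no; suff e0 : [set vol n | n in [set n | exists x, A = cs x n]] = set0.
  by rewrite e0 ereal_inf0 in lt.
by apply/seteqP; split=> // y [n [x xn] _]; case: no; exists x, n.
Qed.

Lemma weight_lmul x A : weight (lmul x @` A) = weight A.
Proof.
suff h y B : weight (lmul y @` B) <= weight B.
  apply/eqP; rewrite eq_le h /=.
  have {1}<- : lmul x^-1%g @` (lmul x @` A) = A; last exact: h.
  by rewrite !lmul_imageE; apply/seteqP; split=> z; rewrite /= /lmul invgK mulKg.
have [wB|] := eqVneq (weight B) +oo; first by rewrite wB leey.
rewrite -ltey => /weight_coset[->|[z [n ->]]]; first by rewrite image_set0.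
by rewrite lmul_cs !weight_cs.
Qed.

HB.instance Definition _ := isOuterMeasure.Build R G haar
  (@mu_ext0 _ (power G) R weight weight0 weight_ge0)
  (@mu_ext_ge0 _ (power G) R weight weight_ge0)
  (@le_mu_ext _ (power G) R weight)
  (@mu_ext_sigma_subadditive _ (power G) R weight weight_ge0).

Lemma haar_ge0 A : 0 <= haar A. Proof. exact: outer_measure_ge0. Qed.

Lemma haar_le A B : A `<=` B -> haar A <= haar B. Proof. exact: le_outer_measure. Qed.

Lemma haar_weight A : haar A <= weight A.
Proof.
apply: ge_ereal_inf; pose F i := if i is 0%N then A else set0.
exists (\sum_(i <oo) weight (F i)).
  by exists F => //; split=> // x Ax; exists 0%N.
rewrite nneseries_recl//; last by move=> i _; exact: weight_ge0.
rewrite eseries_cond/= eseries0 ?adde0// => -[|]// i _ _.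
by rewrite /= weight0.
Qed.

(** A cover with a member that is neither empty nor a coset has infinite total weight and cannot
    lower the infimum. *)
Lemma haar_covers A r : (forall F : nat -> set G, A `<=` \bigcup_i F i ->
    (forall i, F i = set0 \/ exists x n, F i = cs x n) -> r <= \sum_(i <oo) weight (F i)) ->
  r <= haar A.
Proof.
move=> h; apply: le_ereal_inf_tmp => _ [F [_ AF] <-].
have [[i wi]|no] := pselect (exists i, weight (F i) = +oo).
  by rewrite (nneseries_pinfty _ _ wi) ?leey// => j _; exact: weight_ge0.
apply: h => // i; apply: weight_coset; rewrite ltey; apply/eqP => wi.
by apply: no; exists i.
Qed.

Lemma haar_lmul x A : haar (lmul x @` A) = haar A.
Proof.
suff h y B : haar (lmul y @` B) <= haar B.
  apply/eqP; rewrite eq_le h /=.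
  have {1}<- : lmul x^-1%g @` (lmul x @` A) = A; last exact: h.
  by rewrite !lmul_imageE; apply/seteqP; split=> z; rewrite /= /lmul invgK mulKg.
apply: haar_covers => F BF _; apply: ge_ereal_inf.
exists (\sum_(i <oo) weight (lmul y @` F i)).
  exists (fun i => lmul y @` F i) => //; split=> // _ [z /BF[i _ Fz] <-].
  by exists i => //; exists z.
by apply: lee_nneseries => [i _ _|i _]; [exact: weight_ge0|rewrite weight_lmul].
Qed.

Lemma haar_bigcup (F : nat -> set G) : haar (\bigcup_i F i) <= \sum_(i <oo) haar (F i).
Proof. exact: outer_measure_sigma_subadditive. Qed.

Lemma cs_bigsetU x n (S : set G) :
  cs x n `&` S = \big[setU/set0]_(j < q n) (cs (x * e n j)%g n.+1 `&` S).
Proof.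
rewrite -(bigcup_mkord (q n) (fun j => cs (x * e n j)%g n.+1 `&` S)).
apply/seteqP; split=> y.
  by move=> [/(cs_split ch qe)[j jq yj] Sy]; exists j.
by move=> [j jq [yj Sy]]; split=> //; apply/(cs_split ch qe); exists j.
Qed.

Lemma haar_cs_split z p x m : (m <= p)%N ->
  haar (cs x m `&` cs z p) + haar (cs x m `&` ~` cs z p) <= vol m.
Proof.
move=> /subnK; move: (p - m)%N => l; elim: l m x => [|l IH] m x mp.
  rewrite add0n in mp; subst p.
  have [xz|nxz] := pselect (cs x m z).
    rewrite (cs_eq ch xz) setIid setICr outer_measure0 adde0.
    by rewrite -(weight_cs z m); exact: haar_weight.
  have -> : cs x m `&` cs z m = set0.
    apply/seteqP; split=> // y [xy zy]; apply: nxz.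
    by apply: (cs_trans ch xy); exact: cs_sym.
  rewrite outer_measure0 add0e -(weight_cs x m); apply: le_trans (haar_weight _).
  by apply: haar_le => y [].
have split S : haar (cs x m `&` S) <= \sum_(j < q m) haar (cs (x * e m j)%g m.+1 `&` S).
  rewrite cs_bigsetU.
  exact: (outer_measure_subadditive _ (fun j => cs (x * e m j)%g m.+1 `&` S)).
apply: le_trans (leeD (split _) (split _)) _.
rewrite -big_split /= -volS; apply: lee_sum => j _; apply: IH.
by rewrite addnS -addSn.
Qed.

(** A coset in a cover of the test set has level at most [p], and [haar_cs_split] handles it, or it
    is so small that it lies inside the given coset or misses it. *)
Lemma cs_cara z p : haar.-caratheodory (cs z p).
Proof.
apply: le_caratheodory_measurable => X; apply: haar_covers => F XF Fcs.
have inc S : haar (X `&` S) <= \sum_(i <oo) haar (F i `&` S).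
  apply: le_trans (haar_bigcup _); apply: haar_le => x [/XF[i _ Fx] Sx].
  by exists i.
apply: le_trans (leeD (inc _) (inc _)) _.
rewrite -nneseriesD; [|by move=> i _ _; exact: haar_ge0..].
apply: lee_nneseries => [i _ _|i _]; first by apply: adde_ge0; exact: haar_ge0.
have [->|[x [m ->]]] := Fcs i; first by rewrite !set0I outer_measure0 adde0 weight_ge0.
rewrite weight_cs; have [mp|pm] := leqP m p; first exact: haar_cs_split.
have h : haar (cs x m) <= vol m by rewrite -(weight_cs x m); exact: haar_weight.
have [zx|nzx] := pselect (cs z p x).
  have sub : cs x m `<=` cs z p.
    by apply: (cs_meet ch (ltnW pm) zx); exact: cs_refl.
  rewrite [X in haar X + _](_ : _ = cs x m); last by apply/setIidPl.
  rewrite [X in _ + haar X](_ : _ = set0) ?outer_measure0 ?adde0//.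
  by apply/seteqP; split=> // y [/sub].
rewrite [X in haar X + _](_ : _ = set0).
  by rewrite outer_measure0 add0e; apply: le_trans h; apply: haar_le => y [].
apply/seteqP; split=> // y [xy zy]; apply: nzx.
by apply: (cs_trans ch zy); apply: (cs_sym ch); exact: (cs_le ch (ltnW pm)).
Qed.

Lemma open_cosets (O : set G) : open O -> exists F : nat -> set G,
  O = \bigcup_i F i /\ forall i, F i = set0 \/ exists x n, F i = cs x n.
Proof.
move=> oO; have /choice[g gP] := chc ch.
pose F i := if (choice.unpickle i : option (nat * nat)) is Some (n, j) then
  if `[< cs (g n j) n `<=` O >] then cs (g n j) n else set0 else set0.
exists F; split; last first.
  move=> i; rewrite /F; case: choice.unpickle => [[n j]|]; last by left.
  by case: ifP => _; [right; exists (g n j), n|left].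
apply/seteqP; split=> [x Ox|x [i _]]; last first.
  by rewrite /F; case: choice.unpickle => [[n j]|//]; case: asboolP => // h /h.
have [n xO] := open_coset ch oO Ox; have [j gx] := gP n x.
exists (choice.pickle (n, j)) => //; rewrite /F choice.pickleK asboolT//.
by rewrite (cs_eq ch (gx : cs (g n j) n x)).
Qed.

Lemma borel_cara A : (@measurable _ (borel G)) A -> haar.-caratheodory A.
Proof.
apply: smallest_sub.
  split; first exact: caratheodory_measurable_set0.
    by move=> B mB; rewrite setTD; exact: caratheodory_measurable_setC.
  by move=> F mF; exact: caratheodory_measurable_bigcup.
move=> O /open_cosets[F [-> Fcs]]; apply: caratheodory_measurable_bigcup => i.
have [->|[x [n ->]]] := Fcs i; first exact: caratheodory_measurable_set0.
exact: cs_cara.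
Qed.

Let haar_borel0 : haar (set0 : set (borel G)) = 0. Proof. exact: outer_measure0. Qed.
Let haar_borel_ge0 (A : set (borel G)) : 0 <= haar A. Proof. exact: haar_ge0. Qed.
Let haar_semi_sigma_additive : semi_sigma_additive (haar : set (borel G) -> \bar R).
Proof.
move=> F mF tF mUF; apply: (caratheodory_measure_sigma_additive (mu := haar)) => //.
- by move=> i; exact: borel_cara.
- exact: borel_cara.
Qed.

HB.instance Definition _ := isMeasure.Build _ (borel G) R (haar : set (borel G) -> \bar R)
  haar_borel0 haar_borel_ge0 haar_semi_sigma_additive.

Let cs_borel x n : (@measurable _ (borel G)) (cs x n).
Proof. by apply: open_borel; exact: open_cs. Qed.

(* a cover of a coset of U 0 of smaller total weight would, by passing to a part at
   each level, miss a point *)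
Lemma haar_cs0 x : vol 0 <= haar (cs x 0).
Proof.
apply: haar_covers => F xF Fcs.
pose part A i := if `[< F i `<=` A >] then weight (F i) else 0.
have part_ge0 A i : 0 <= part A i by rewrite /part; case: ifP => _ //; exact: weight_ge0.
pose Q n A := A `<=` cs x 0 -> vol n <= \sum_(i <oo) part A i.
suff : Q 0%N (cs x 0).
  move=> /(_ (@subset_refl _ _))/le_trans; apply.
  apply: lee_nneseries => [i _ _|i _] //.
  by rewrite /part; case: ifP => _ //; exact: weight_ge0.
apply: (descent ch qe (Q := Q)) => [n y h yx|y]; last first.
  have [yx|nyx] := pselect (cs x 0 y); last first.
    by exists 0%N => // /(_ y (cs_refl ch y 0)).
  have [i _ Fy] := xF y yx; have [F0|[z [n Fz]]] := Fcs i.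
    by rewrite F0 in Fy.
  have Fyn : F i = cs y n by rewrite Fz; apply: (cs_eq ch); rewrite -Fz.
  exists n => // _; rewrite -(weight_cs y n) -Fyn.
  have -> : weight (F i) = part (F i) i by rewrite /part asboolT.
  rewrite (nneseriesD1 (n := i))//.
  by rewrite leeDl//; apply: nneseries_ge0 => j _ _.
rewrite -volS; apply: (@le_trans _ _ (\sum_(j < q n) \sum_(i <oo) part (cs (y * e n j)%g n.+1) i)).
  apply: lee_sum => j _; apply: h => //.
  by apply: subset_trans yx; apply: (cs_child ch qe).
rewrite -nneseries_sum//; apply: lee_nneseries => [i _ _|i _]; first exact: sume_ge0.
have [F0|[z [m Fz]]] := Fcs i.
  by rewrite big1 ?part_ge0// => j _; rewrite /part F0 weight0 if_same.
have Fz' : F i z by rewrite Fz; exact: cs_refl.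
have [[j Fj]|no] := pselect (exists j : 'I_(q n), F i `<=` cs (y * e n j)%g n.+1); last first.
  by rewrite big1 // => j _; rewrite /part asboolF// => Fj; apply: no; exists j.
rewrite (bigD1 j)//= big1 ?adde0; last first.
  move=> j' j'j; rewrite /part asboolF// => Fj'; case/eqP: j'j; apply/val_inj.
  exact: (cs_child_inj ch qe (ltn_ord _) (ltn_ord _) (Fj' z Fz') (Fj z Fz')).
rewrite /part asboolT// asboolT//; apply: subset_trans Fj _.
exact: (cs_child ch qe).
Qed.

Lemma rmul1 A : rmul 1%g @` A = A.
Proof.
apply/seteqP; split=> [_ [x Ax <-]|x Ax]; first by rewrite /rmul mulg1.
by exists x => //; rewrite /rmul mulg1.
Qed.

Lemma haar_children g x n S : open S ->
  haar (rmul g @` (cs x n `&` S)) = \sum_(j < q n) haar (rmul g @` (cs (x * e n j)%g n.+1 `&` S)).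
Proof.
move=> oS; pose F j := if (j < q n)%N then rmul g @` (cs (x * e n j)%g n.+1 `&` S) else set0.
have FE (j : 'I_(q n)) : F j = rmul g @` (cs (x * e n j)%g n.+1 `&` S) by rewrite /F ltn_ord.
have -> : rmul g @` (cs x n `&` S) = \big[setU/set0]_(j < q n) F j.
  rewrite cs_bigsetU -(bigcup_mkord _ (fun j => cs (x * e n j)%g n.+1 `&` S)).
  rewrite -(bigcup_mkord _ F) image_bigcup.
  by apply: eq_bigcupr => j /= jq; rewrite /F jq.
under [RHS]eq_bigr do rewrite -FE.
apply: (measure_bigsetU (haar : {measure set (borel G) -> \bar R}%R)).
  move=> j; rewrite /F; case: ifP => _; last exact: measurable0.
  by apply: open_borel; apply: open_rmul; apply: openI => //; exact: open_cs.
apply/trivIsetP => i j _ _ ij; rewrite /F.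
case: ifP => iq; last by rewrite set0I.
case: ifP => jq; last by rewrite setI0.
apply/seteqP; split=> // _ [[y [yi _] <-] [z [zj _]]].
rewrite /rmul => /mulIg zy; rewrite zy in zj; case/eqP: ij.
exact: (cs_child_inj ch qe iq jq yi zj).
Qed.

Lemma haar_rmul_cs g x n : haar (rmul g @` cs x n) = haar (rmul g @` U n).
Proof.
rewrite -(haar_lmul x (rmul g @` U n)).
suff -> : rmul g @` cs x n = lmul x @` (rmul g @` U n) by [].
rewrite -[x in cs x]mulg1 -(lmul_cs U) (cs1 U) !image_comp.
by apply: eq_imagel => y _; rewrite /= /lmul /rmul mulgA.
Qed.

(** By left invariance the right translates of the children of a coset have equal measure, so each
    level divides the measure by [q n]. The factor [r] is the value of the modular function at [g],
    up to convention. *)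
Lemma haar_rmul_vol g (r : R) n : haar (rmul g @` U 0) = r%:E ->
  haar (rmul g @` U n) = r%:E * vol n.
Proof.
move=> h0; elim: n => [|n IH]; first by rewrite h0 /vol big_ord0 invr1 mule1.
have := haar_children g 1%g n openT; rewrite setIT (cs1 U) IH.
under eq_bigr do rewrite setIT haar_rmul_cs.
rewrite -volS; have := haar_ge0 (rmul g @` U n.+1).
case: (haar (rmul g @` U n.+1)) => [s| |//] _.
  rewrite !sumEFin !sumr_const card_ord -EFinM => -[]; rewrite mulrnAr => /eqP.
  by rewrite eqr_pMn2r ?q_gt0// => /eqP <-.
suff -> : \sum_(i < q n) +oo = +oo :> \bar R by rewrite volS /vol -EFinM.
case: (q n) (q_gt0 n) => // N _.
by rewrite big_ord_recl addye// -ltNye; apply: lt_le_trans (sume_ge0 _ _).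
Qed.

Lemma haar_cs x n : haar (cs x n) = vol n.
Proof.
have v0 : vol 0 = 1 by rewrite /vol big_ord0 invr1.
have h0 : haar (rmul 1%g @` U 0) = 1.
  rewrite rmul1 -(cs1 U); apply/eqP; rewrite eq_le -{2}v0 haar_cs0 andbT.
  by rewrite -v0 -(weight_cs 1%g 0) haar_weight.
by rewrite -[LHS](congr1 haar (rmul1 _)) haar_rmul_cs (haar_rmul_vol n h0) mul1e.
Qed.

Lemma haar_compact K : compact K -> haar K < +oo.
Proof.
rewrite compact_cover => /(_ G K (fun x => cs x 0)) [x _|x Kx|D _ KD].
- exact: open_cs.
- by exists x => //; exact: cs_refl.
apply: (@le_lt_trans _ _ (haar (\bigcup_(x in [set` D]) cs x 0))); first exact: haar_le.
rewrite bigcup_fset; elim: (enum_fset D) => [|x s IH].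
  by rewrite big_nil outer_measure0 ltry.
rewrite big_cons; apply: le_lt_trans (outer_measureU2 _ _ _) _.
apply: lte_add_pinfty; last exact: IH.
by rewrite -[X in X < _]/(haar (cs x 0)) haar_cs ltry.
Qed.

(** Covers by cosets consist of open sets, which gives outer regularity. An open set is a countable
    union of cosets, which are compact, and this gives inner regularity. *)
Lemma radon_haar : radon haar.
Proof.
split; first exact: haar_compact.
- move=> B _; apply/eqP; rewrite eq_le; apply/andP; split.
    by apply: le_ereal_inf_tmp => _ [O [_ BO] <-]; exact: haar_le.
  apply: haar_covers => F BF Fcs; apply: ge_ereal_inf; exists (haar (\bigcup_i F i)).
    exists (\bigcup_i F i) => //; split=> //; apply: bigcup_open => i _.
    by have [->|[x [n ->]]] := Fcs i; [exact: open0|exact: open_cs].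
  apply: le_trans (haar_bigcup _) _; apply: lee_nneseries => [i _ _|i _].
    exact: haar_ge0.
  exact: haar_weight.
- move=> O oO; apply/eqP; rewrite eq_le; apply/andP; split; last first.
    by apply: ge_ereal_sup => _ [K [_ KO] <-]; exact: haar_le.
  have [F [OE Fcs]] := open_cosets oO.
  have mF i : (@measurable _ (borel G)) (F i).
    by have [->|[x [n ->]]] := Fcs i; [exact: measurable0|exact: cs_borel].
  pose K n := \big[setU/set0]_(i < n.+1) F i.
  have mK n : (@measurable _ (borel G)) (K n) by exact: bigsetU_measurable.
  have KO : O = \bigcup_n K n by rewrite OE bigcup_bigsetU_bigcup.
  have mU : (@measurable _ (borel G)) (\bigcup_n K n) by exact: bigcup_measurable.
  have hK : {homo K : m n / (m <= n)%N >-> (m <= n)%O}.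
    by move=> m n mn; apply/subsetPset; exact: subset_bigsetU.
  have cvK := @nondecreasing_cvg_mu _ (borel G) R haar K mK mU hK.
  rewrite KO -(cvg_lim _ cvK)//; apply: ereal_normedtype.lime_le.
    by apply/cvg_ex; eexists; exact: cvK.
  apply: nearW => n; apply: ereal_sup_ubound; exists (K n) => //; split.
    apply: bigsetU_compact => i _.
    by have [->|[x [m ->]]] := Fcs i; [exact: compact0|exact: (compact_cs ch qe)].
  by move=> x Kx; exists n.
Qed.

Section RightInvariance.
Variables (g : G) (K : set G) (p : nat) (y0 : G).
Hypotheses (Ky0 : K y0) (KU : K `<=` U 0) (Kp : forall y, K y -> cs y p `<=` K).
Hypothesis Kg : rmul g @` K = lmul g @` K.

Let openK : open K.
Proof.
rewrite openE => y Ky; apply: (filterS (Kp Ky)); apply: open_nbhs_nbhs.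
by split; [exact: open_cs|exact: cs_refl].
Qed.

Let haar_scale (r : R) : haar (rmul g @` U 0) = r%:E -> forall m x, (m <= p)%N ->
  haar (rmul g @` (cs x m `&` K)) = r%:E * haar (cs x m `&` K).
Proof.
move=> hr m x /subnK; move: (p - m)%N => l; elim: l m x => [|l IH] m x mp.
  rewrite add0n in mp; subst m; have [[y [xy Ky]]|no] := pselect (exists y, cs x p y /\ K y).
    have -> : cs x p `&` K = cs y p.
      by rewrite (cs_eq ch xy); apply/setIidPl; exact: Kp.
    by rewrite haar_rmul_cs (haar_rmul_vol p hr) haar_cs.
  have -> : cs x p `&` K = set0.
    by apply/seteqP; split=> // y [xy Ky]; apply: no; exists y.
  by rewrite image_set0 outer_measure0 mule0.
rewrite haar_children// -[in RHS](rmul1 (cs x m `&` K)) haar_children//.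
rewrite ge0_sume_distrr; last by move=> j _; exact: haar_ge0.
by apply: eq_bigr => j _; rewrite rmul1 IH// addnS -addSn.
Qed.

(** Right translation by [g] multiplies the measure of [K], a union of cosets of level [p], by [r].
    As K g = g K and [haar] is left invariant, r = 1, because the measure of [K] is positive and
    finite. *)
Lemma haar_rmul_le B : haar (rmul g @` B) <= haar B.
Proof.
have [r hr] : exists r, haar (rmul g @` U 0) = r%:E.
  have : haar (rmul g @` U 0) < +oo.
    apply: haar_compact; apply: continuous_compact; last first.
      by rewrite -(cs1 U); exact: (compact_cs ch qe).
    by apply: continuous_subspaceT => y; exact: rmul_continuous.
  have := haar_ge0 (rmul g @` U 0).
  by case: (haar _) => [r| |] // _ _; exists r.
have KE : cs 1%g 0 `&` K = K by rewrite (cs1 U); apply/setIidPr.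
have r1 : r = 1%R.
  have := haar_scale hr 1%g (leq0n p); rewrite KE Kg haar_lmul.
  have Kpos : 0 < haar K.
    apply: lt_le_trans (haar_le (Kp Ky0)); rewrite haar_cs lte_fin invr_gt0 ltr0n.
    by apply: prodn_gt0 => i; exact: q_gt0.
  have Kfin : haar K < +oo.
    by apply: le_lt_trans (haar_le KU) _; rewrite -(cs1 U) haar_cs ltry.
  case: (haar K) Kpos Kfin => [s| |] //; rewrite lte_fin => s0 _ [].
  rewrite -{1}[s]mul1r => /mulIf ->//; exact: lt0r_neq0.
rewrite r1 in hr; apply: haar_covers => F BF Fcs.
apply: (@le_trans _ _ (\sum_(i <oo) haar (rmul g @` F i))).
  apply: le_trans (haar_bigcup _); apply: haar_le => _ [x /BF[i _ Fx] <-].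
  by exists i => //; exists x.
apply: lee_nneseries => [i _ _|i _]; first exact: haar_ge0.
have [->|[x [n ->]]] := Fcs i; first by rewrite image_set0 outer_measure0 weight_ge0.
by rewrite haar_rmul_cs (haar_rmul_vol n hr) mul1e weight_cs.
Qed.

End RightInvariance.

Definition haar_rinv g := forall B, haar (rmul g @` B) = haar B.

Lemma haar_rinv1 : haar_rinv 1%g. Proof. by move=> B; rewrite rmul1. Qed.

Lemma rmulM g h B : rmul (g * h)%g @` B = rmul h @` (rmul g @` B).
Proof. by rewrite image_comp; apply: eq_imagel => x _; rewrite /= /rmul mulgA. Qed.

Lemma haar_rinvM g h : haar_rinv g -> haar_rinv h -> haar_rinv (g * h)%g.
Proof. by move=> hg hh B; rewrite rmulM hh hg. Qed.

Lemma haar_rinvV g : haar_rinv g -> haar_rinv g^-1%g.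
Proof. by move=> hg B; rewrite -[LHS]hg -rmulM mulVg rmul1. Qed.

Lemma haar_rinv_normalizer g K p y0 : K y0 -> K `<=` U 0 -> (forall y, K y -> cs y p `<=` K) ->
  rmul g @` K = lmul g @` K -> haar_rinv g.
Proof.
move=> Ky0 KU Kp Kg B; apply/eqP; rewrite eq_le; apply/andP; split.
  exact: (haar_rmul_le Ky0 KU Kp Kg).
have Kg' : rmul g^-1%g @` K = lmul g^-1%g @` K.
  rewrite rmul_imageE lmul_imageE invgK; apply/funext => x.
  have := congr1 (@^~ (g * x * g)%g) Kg; rewrite rmul_imageE lmul_imageE /= /rmul /lmul.
  by rewrite mulgK -mulgA mulKg => ->.
rewrite -{1}[B](rmul1) -(mulgV g) rmulM.
exact: (haar_rmul_le Ky0 KU Kp Kg').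
Qed.

Lemma haar_unimodular : (forall g, haar_rinv g) -> unimodular R G.
Proof.
move=> inv; exists (haar : {measure set (borel G) -> \bar R}%R); last by move=> g B _; exact: inv.
split; [|exact: radon_haar|by move=> g B _; exact: haar_lmul].
move=> h0; have := haar_cs 1%g 0; rewrite /vol big_ord0 invr1 => h1.
have : haar (cs 1%g 0) <= haar setT by exact: haar_le.
by rewrite h1 h0 lee_fin ler10.
Qed.

End Outer.

(** * Closed cocompact subgroups of the Neretin group *)

Section NeretinTopology.
Variables (d k : nat) (hd : 1 < d).
Local Notation C := (stream d).
Local Notation P := ('I_k * stream d)%type.
Local Notation N := (neretin d k).

Definition level n : set N := [set x | exists2 b, piso n b & act x = pw id b].

Lemma level_nbhs (x : N) (A : set N) :
  nbhs x A <-> exists n, forall y, level n y -> A (x * y).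
Proof.
split=> -[n nA].
  exists n => y [b pb e]; have [a fa ae] := isometry_rooted hd pb.
  have -> : y = rooted_inclusion a by apply: (act_inj hd); rewrite e ae.
  by apply: nA; apply: fixes_le fa.
exists n.+1 => a /(rooted_isometry hd)[b pb e]; apply: nA.
by exists b.
Qed.

Lemma level1 n : level n 1.
Proof.
exists (fun=> id); last by rewrite (act1 k hd); apply/funext => -[].
by move=> i; split; [exact: isom_id|].
Qed.

Lemma levelV n x y : level n x -> level n y -> level n (x^-1 * y).
Proof.
move=> [a pa ax] [b pb by_]; have [c ic [aK cK]] := pw_inv (fun i => (pa i).1).
have xV : act x^-1 = pw id c by apply/funext => p; rewrite -[p in LHS]cK -ax (actK hd).
exists (fun i => c i \o b i); last by rewrite (actM hd) xV by_.
move=> i; split; first by apply: isom_comp; [exact: ic|case: (pb i)].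
move=> z; have h : agree n (a i (c i (b i z))) (b i z).
  have := congr1 snd (cK (i, b i z)); rewrite /pw /= => ->.
  by [].
apply: (agree_trans (y := b i z)); first by case: (pb i).
apply: agree_sym; apply: agree_trans h.
by case: (pa i).
Qed.

Lemma level_le m n : m <= n -> level n `<=` level m.
Proof.
move=> mn x [b pb e]; exists b => // i; split; first by case: (pb i).
by move=> z; apply: (agree_le mn); case: (pb i).
Qed.

Lemma levelM n x y : level n x -> level n y -> level n (x * y).
Proof.
move=> lx ly; rewrite -[x]invgK; apply: levelV => //.
by rewrite -[x^-1]mulg1; apply: levelV => //; exact: level1.
Qed.

Lemma open_level n : open (level n).
Proof.
rewrite openE => x lx; apply/level_nbhs; exists n => y; exact: levelM.
Qed.

Lemma level_finite n : exists (T : finType) (f : N -> T), forall x y, level n x -> level n y ->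
  f x = f y <-> level n.+1 (x^-1 * y).
Proof.
pose f (x : N) := [ffun t : 'I_k * n.+1.-tuple 'I_d =>
  [tuple of mkseq (act x (t.1, scat t.2 (stream0 hd))).2 n.+1]].
exists {ffun 'I_k * n.+1.-tuple 'I_d -> n.+1.-tuple 'I_d}, f => x y lx ly.
have [a pa ax] := lx; have [b pb by_] := ly.
have fE : f x = f y <-> forall i z, agree n.+1 (a i z) (b i z).
  split=> [e i z|e]; last first.
    apply/ffunP => -[i w]; rewrite !ffunE /=; apply/val_inj => /=.
    by rewrite ax by_ /=; apply/(agreeP hd).
  have := congr1 (fun g : {ffun _ -> _} => g (i, [tuple of mkseq z n.+1])) e.
  rewrite !ffunE /= => /(congr1 val)/=; rewrite ax by_ /= => /(agreeP hd) h.
  have zz : agree n.+1 z (scat (mkseq z n.+1) (stream0 hd)) by exact: (agree_mkseq hd).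
  apply: (agree_trans (proj2 (isom_agree _ _ _ (pa i).1) zz)).
  apply: (agree_trans h); apply/(isom_agree _ _ _ (pb i).1).
  exact: agree_sym.
rewrite fE; have [c ic [aK cK]] := pw_inv (fun i => (pa i).1).
have xV : act x^-1 = pw id c by apply/funext => p; rewrite -[p in LHS]cK -ax (actK hd).
have cKi i z : a i (c i z) = z by have := congr1 snd (cK (i, z)).
split=> [e|[b' pb' e] i z].
  exists (fun i => c i \o b i); last by rewrite (actM hd) xV by_.
  move=> i; split; first by apply: isom_comp; [exact: ic|case: (pb i)].
  by move=> z; apply/(isom_agree _ _ _ (pa i).1); rewrite /= cKi.
have bE : b i z = a i (b' i z).
  have := congr1 (@^~ (i, z)) e; rewrite (actM hd) xV by_ /pw /= => -[<-].
  by rewrite cKi.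
by rewrite bE; apply/(isom_agree _ _ _ (pa i).1); case: (pb' i).
Qed.

Lemma level_complete (x : nat -> N) : (forall n, level n ((x n)^-1 * x n.+1)) ->
  exists y, forall n, level n ((x n)^-1 * y).
Proof.
move=> xS; have /choice[b bP] n : exists b, piso n b /\ act ((x n)^-1 * x n.+1) = pw id b.
  by have [b pb e] := xS n; exists b.
pose c := fix c n : 'I_k -> C -> C := if n is m.+1 then fun i => c m i \o b m i else fun i => id.
have cP n : act (x n) = act (x 0) \o pw id (c n).
  elim: n => [|n IH]; first by apply/funext => -[].
  rewrite -[x n.+1](mulVKg (x n)) (actM hd) IH; case: (bP n) => _ ->.
  by [].
have ic n i : isom (c n i).
  elim: n => [|n IH]; first exact: isom_id.
  by apply: isom_comp IH _; case: (bP n) => /(_ i)[].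
have /choice[a aP] i : exists a, isom a /\ forall l z, agree l (c l i z) (a z).
  apply: isom_limit => // l z; apply/(isom_agree _ _ _ (ic l i)).
  by case: (bP l) => /(_ i)[].
have [|y ye] := act_surj hd (phi := act (x 0) \o pw id a).
  apply: (hom_comp hd _ (hom_act hd _)); apply: (hom_pw hd); first by exists id.
  by move=> i; case: (aP i).
exists y => n; have [c' ic' [cK c'K]] := pw_inv (ic n).
exists (fun i => c' i \o a i).
  move=> i; split; first by apply: isom_comp; [exact: ic'|case: (aP i)].
  move=> z; apply/(isom_agree _ _ _ (ic n i)).
  have -> : c n i ((c' i \o a i) z) = a i z by have := congr1 snd (c'K (i, a i z)).
  by case: (aP i).
rewrite (actM hd) ye; apply/funext => p.
have e : pw id (c n) (pw id (fun i => c' i \o a i) p) = pw id a p := c'K (pw id a p).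
by rewrite -[RHS](actK hd (x n)) [act (x n) _](congr1 (@^~ _) (cP n)) /= e.
Qed.

(** A left coset of [level n] is determined by a depth m >= n and the finite table of the balls to
    which an element sends the balls of depth m by similarities. *)
Lemma level_countable n : exists (T : countType) (code : T -> N -> Prop),
  (forall x, exists t, code t x) /\ forall t x y, code t x -> code t y -> level n (x^-1 * y).
Proof.
exists {m : nat & {ffun 'I_k * m.-tuple 'I_d -> 'I_k * seq 'I_d}}.
exists (fun (t : {m : nat & {ffun 'I_k * m.-tuple 'I_d -> 'I_k * seq 'I_d}}) x => n <= tag t /\ forall iw : 'I_k * (tag t).-tuple 'I_d,
  tracks (act x) iw.1 iw.2 (tagged t iw).1 (tagged t iw).2); split.
  move=> x; have [m mP] := act_ls hd x.
  pose M := maxn n m; have /choice[f fP] (iw : 'I_k * M.-tuple 'I_d) :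
      exists ju, tracks (act x) iw.1 iw.2 ju.1 ju.2.
    have [|j [u [a [ia aE]]]] := mP iw.1 iw.2; first by rewrite size_tuple leq_maxr.
    by exists (j, u); exists a.
  exists (existT (fun m => {ffun 'I_k * m.-tuple 'I_d -> 'I_k * seq 'I_d}) M [ffun iw => f iw]).
  by split=> /=; [exact: leq_maxl|move=> iw; rewrite ffunE].
move=> [m t] x y /= [nm xt] [_ yt].
have xy i (w : m.-tuple 'I_d) : tracks (act (x^-1 * y)) i w i w.
  have [a ia aE] := yt (i, w); have [b ib bE] := tracks_inv (actK hd x) (xt (i, w)).
  exists (b \o a); first exact: isom_comp.
  by move=> z; rewrite (actM hd) /= aE bE.
have /choice[c cP] (iw : 'I_k * seq 'I_d) : exists c, isom c /\ (size iw.2 = m ->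
    forall z, act (x^-1 * y) (iw.1, scat iw.2 z) = (iw.1, scat iw.2 (c z))).
  have [/eqP sw|ns] := eqVneq (size iw.2) m.
    by have [c ic cE] := xy iw.1 (Tuple sw); exists c.
  by exists id; split; [exact: isom_id|move=> e; rewrite e eqxx in ns].
exists (fun i z => scat (mkseq z m) (c (i, mkseq z m) (sdrop m z))).
  move=> i; split; last by move=> z; apply: (agree_le nm); exact: (agree_mkseq hd).
  by apply: (isom_glue hd m (c := fun w => c (i, w))) => w; case: (cP (i, w)).
apply/funext => -[i z]; rewrite /pw /= -{1}(scat_mkseq hd m z).
by case: (cP (i, mkseq z m)) => _ /= ->//; rewrite size_mkseq.
Qed.

Section Subgroup.
Variable H : groupClosed N.
Hypothesis cH : closed [set` H].

Definition sub_level n : set (subgroup H) := [set x | level n (Defs.sgval x)].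

Let sgval_continuous : continuous (@Defs.sgval _ H).
Proof. exact: (@initial_continuous (subgroup H) N (@Defs.sgval _ H)). Qed.

Lemma sub_level_chain : chain sub_level.
Proof.
split.
- by move=> n; exact: level1.
- by move=> n x y; exact: levelV.
- by move=> n x; apply: level_le.
- by move=> n; apply: open_comp => [x _|]; [exact: sgval_continuous|exact: open_level].
- move=> A; rewrite nbhsE => -[_ [[O oO <-] O1] OA].
  have : nbhs (1 : N) O by apply: open_nbhs_nbhs; split.
  move=> /level_nbhs[n nO]; exists n => x lx; apply: OA => /=.
  by rewrite -[Defs.sgval x]mul1g; exact: nO.
- move=> n; have [T [f fP]] := level_finite n; exists T, (f \o @Defs.sgval _ H) => x y lx ly.
  exact: fP.
- move=> x xS; have [y yP] := level_complete xS.
  have yH : y \in (H : {pred N}).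
    have : closure [set` H] y; last by move=> /cH.
    move=> B /level_nbhs[n nB]; exists (Defs.sgval (x n)); split; first exact: (valP (x n)).
    rewrite -[Defs.sgval (x n)](mulVKg y); apply: nB.
    rewrite -[y^-1 * _]invgK -[_^-1]mulg1; apply: levelV; last exact: level1.
    by rewrite invgM invgK; exact: yP.
  by exists (Subgroup yH).
- move=> n; have [T [code [cex cP]]] := level_countable n.
  have ex (i : nat) : exists x : subgroup H, forall (t : T) (y : subgroup H),
      choice.unpickle i = Some t -> code t (Defs.sgval y) -> code t (Defs.sgval x).
    case: (choice.unpickle i) => [t|]; last by exists 1.
    have [[x xt]|no] := pselect (exists x : subgroup H, code t (Defs.sgval x)).
      by exists x => t' y [<-].
    by exists 1 => t' y [<-] yt; case: no; exists y.
  pose g i := projT1 (cid (ex i)).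
  exists g => x; have [t xt] := cex (Defs.sgval x); exists (choice.pickle t).
  have gt := projT2 (cid (ex (choice.pickle t))) t x (choice.pickleK t) xt.
  exact: cP gt xt.
Qed.

Definition sub_homs (f : P -> P) := exists2 x, x \in (H : {pred N}) & f = act x.

Lemma sub_homs_group : homgroup sub_homs.
Proof.
split.
- by move=> _ [x _ ->]; exact: hom_act.
- by exists 1; [exact: gpred1|rewrite (act1 k hd)].
- by move=> _ _ [x xH ->] [y yH ->]; exists (x * y); [exact: gpredM|rewrite (actM hd)].
- move=> _ [x xH ->]; exists (act x^-1); first by exists x^-1; rewrite ?gpredV.
  by split; [exact: (actK hd)|exact: (actKV hd)].
Qed.

Lemma sub_homs_closed : homclosed sub_homs.
Proof.
move=> g hg gm; have [x xg] := act_surj hd hg; exists x => //.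
have : closure [set` H] x; last by move=> /cH.
move=> B /level_nbhs[n nB]; have [_ [h hH ->] [a pa ga]] := gm n.
exists h; split=> //; rewrite -[h](mulVKg x); apply: nB.
rewrite -[x^-1 * _]invgK -[_^-1]mulg1; apply: levelV; last exact: level1.
exists a => //; rewrite invgM invgK (actM hd) xg ga; apply/funext => p.
by rewrite /= (actK hd).
Qed.

Local Notation coset x := ((\pi_({eq_quot left_coset_rel H}) x)%qT : left_cosets H).

Let coset_eq x y : coset x = coset y <-> x^-1 * y \in (H : {pred N}).
Proof.
have E := @eqquotE _ _ {eq_quot left_coset_rel H}%qT x y.
split=> [e|h]; first by rewrite -[_ \in _]/(left_coset_rel H x y) -E; apply/eqP.
by have /eqP := etrans E h.
Qed.

Let orbit (g : N) : set (left_cosets H) := [set c | exists u h,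
  [/\ level 0 u, h \in (H : {pred N}) & c = coset (u * g * h)]].

Let open_orbit g : open (orbit g).
Proof.
suff : open [set x : N | orbit g (coset x)] by [].
rewrite openE => x [u [h [lu hH /coset_eq xe]]]; apply/level_nbhs.
(* For y close to 1 the conjugate x y x^-1 is in [level 0], so x y stays in the orbit of x. *)
have [n nP] := piso_conj hd 0 (hom_act hd x).
exists n => y [a pa ay]; have [b pb ab] := nP a pa.
exists (x * y * x^-1 * u), h; split=> //; last first.
  by apply/coset_eq; rewrite !mulgA in xe; rewrite invgM !mulgA mulgKV mulVg mul1g.
apply: levelM lu; exists b => //; apply/funext => p.
by rewrite !(actM hd) ay ab /= (actKV hd).
Qed.

(** The orbits of U = [level 0] on G / H are open, so finitely many of them cover it, and G is a
    finite union of sets U g H. Inversion turns these into H g^-1 U, the form that [homcocompact]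
    asks for. *)
Lemma sub_homs_cocompact : cocompact H -> homcocompact sub_homs.
Proof.
rewrite /cocompact compact_cover => /(_ N setT orbit) h.
have {h} := h (fun g _ => @open_orbit g).
case=> [c _|D _ DP].
  exists (generic_quotient.repr (c : {eq_quot left_coset_rel H}%qT)) => //.
  exists 1, 1; split; [exact: level1|exact: gpred1|].
  by rewrite mul1g mulg1; exact/esym/generic_quotient.reprK.
exists #|` D|, (fun i => act (nth 1 (enum_fset D) i)^-1); split.
  by move=> i; exact: hom_act.
move=> _ /(act_surj hd)[x <-].
have [g /= gD [u [h [lu hH]]]] := DP (coset x^-1) I.
move=> /coset_eq; rewrite invgK => xH.
have ig : index g (enum_fset D) < #|` D| by rewrite index_mem.
have [a pa ae] : level 0 u^-1 by rewrite -[u^-1]mulg1; apply: levelV => //; exact: level1.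
exists (Ordinal ig), (act (x * (u * g * h) * h^-1)), a; split=> //.
  by exists (x * (u * g * h) * h^-1) => //; apply: gpredM; rewrite ?gpredV.
rewrite -ae /= nth_index// -!(actM hd); congr act.
by rewrite !mulgA !mulgK.
Qed.

End Subgroup.
End NeretinTopology.

(** * The whole group is unimodular *)

Section Full.
Variables (R : realType) (d k : nat) (hd : 1 < d) (hk : 1 < k).
Local Notation C := (stream d).
Local Notation P := ('I_k * stream d)%type.
Local Notation N := (neretin d k).

Let I0pos : 0 < #|'I_k|. Proof. by rewrite card_ord ltnW. Qed.

Lemma pw_conj (J : finType) n (s s' : J -> J) (a c : J -> C -> C) : cancel s' s -> cancel s s' ->
  (forall j, isom (a j)) -> piso n c ->
  exists2 b, piso n b & pw s a \o pw id c = pw id b \o pw s a.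
Proof.
move=> s'K sK ia pc; have [a' ia' [aK a'K]] := pw_inv ia.
exists (fun j => a (s' j) \o (c (s' j) \o a' (s' j))).
  move=> j; split.
    by apply: isom_comp => //; apply: isom_comp => //; case: (pc (s' j)).
  move=> x; have ex : x = a (s' j) (a' (s' j) x) by have := congr1 snd (a'K (s' j, x)).
  by rewrite {1}ex; apply/isom_agree => //; case: (pc (s' j)).
apply/funext => -[j x]; rewrite /pw /= sK; congr (_, a _ (c _ _)).
by have := congr1 snd (aK (j, x)).
Qed.

Section Group.
Variable H : groupClosed N.
Hypothesis HT : [set` H] = [set: N].

Let inH x : x \in (H : {pred N}).
Proof. by have : [set` H] x by rewrite HT. Qed.

Let ch : chain (@sub_level d k H) := sub_level_chain hd (eq_ind_r (fun A => closed A) closedT HT).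

Lemma full_unimodular : unimodular R (subgroup H).
Proof.
have [q [e qe]] := chain_reps ch.
apply: (haar_unimodular (R := R) ch qe) => g.
pose rinv (phi : P -> P) := exists2 x : subgroup H, phi = act (Defs.sgval x) &
  haar_rinv R (@sub_level d k H) q x.
have grinv : homgroup rinv.
  split.
  - by move=> _ [x -> _]; exact: hom_act.
  - by exists 1; [exact/esym/(act1 k hd)|exact: haar_rinv1].
  - move=> _ _ [x -> hx] [y -> hy]; exists (x * y); first exact/esym/(actM hd).
    exact: haar_rinvM.
  - move=> _ [x -> hx]; exists (act (Defs.sgval x^-1)).
      by exists x^-1 => //; exact: haar_rinvV.
    by split; [exact: (actK hd)|exact: (actKV hd)].
have W (J : finType) (F : J * C -> P) (s : J -> J) phi : frame F -> 0 <= #|J| -> hom phi ->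
    (forall j, moves phi (chart F j) (chart F (s j))) ->
    (forall p : P, False -> False) -> rinv phi.
  move=> fF _ hphi ms _; have [x0 x0E] := act_surj hd hphi.
  pose x : subgroup H := Subgroup (inH x0).
  have [s' sK s'K] := injF_bij (moves_injective hd fF.1 hphi ms).
  have [Fi [hFi FK FiK]] := hom_inv fF.1.
  (* The depth [n] puts [K] inside [level 0], and [p] makes [K] contain [level p]. Conjugation by x
     preserves [K], because x permutes the pieces of [F] by isometries, which keep the depth. *)
  have [n nP] := piso_conj hd 0 fF.1; have [p pP] := piso_conj hd n hFi.
  pose K : set (subgroup H) := [set y | exists2 c, piso n c & act (Defs.sgval y) \o F = F \o pw id c].
  have KM y z : K y -> K z -> K (y * z).
    move=> [c pc yc] [c' pc' zc]; exists (fun j => c j \o c' j).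
      move=> j; split; first by apply: isom_comp; [case: (pc j)|case: (pc' j)].
      move=> u; apply: (agree_trans (y := c' j u)); first by case: (pc' j).
      by case: (pc j).
    apply/funext => u; rewrite /= (actM hd) /=.
    have := congr1 (@^~ u) zc; rewrite /= => ->.
    exact: (congr1 (@^~ (pw id c' u)) yc).
  have conj z y (t t' : J -> J) a : cancel t' t -> cancel t t' -> (forall j, isom (a j)) ->
      act (Defs.sgval z) \o F = F \o pw t a -> K y -> K (z * y * z^-1).
    move=> t'K tK ia zE [c pc yE]; have [b pb bE] := pw_conj t'K tK ia pc.
    exists b => //; apply/funext => u.
    have [v uv] : exists v, F u = act (Defs.sgval z) (F v).
      by exists (Fi (act (Defs.sgval z)^-1 (F u))); rewrite FiK (actKV hd).
    have uE : u = pw t a v.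
      by apply: (hom_inj fF.1); rewrite uv; exact: (congr1 (@^~ v) zE).
    rewrite -[LHS]/(act (Defs.sgval z * Defs.sgval y * (Defs.sgval z)^-1) (F u)).
    rewrite !(actM hd) /= uv (actK hd).
    have := congr1 (@^~ v) yE; rewrite /= => ->.
    have := congr1 (@^~ (pw id c v)) zE; rewrite /= => ->.
    by have := congr1 (@^~ v) bE; rewrite /= -uE => ->.
  exists x; first exact: esym x0E.
  have [a ia xE] := moves_pw ms.
  have [b ib [aK bK]] := pw_inv ia.
  apply: (@haar_rinv_normalizer R _ _ ch q e qe x K p 1).
  - exists (fun=> id); first by move=> j; split; [exact: isom_id|].
    by rewrite (act1 k hd); apply/funext => -[].
  - move=> y [c pc yE]; have [b' pb' bE] := nP c pc; exists b' => //.
    by apply/funext => u; rewrite -[u]FiK; have := congr1 (@^~ (Fi u)) yE; rewrite /= => ->;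
      exact: (congr1 (@^~ (Fi u)) bE).
  - move=> y Ky z [c pc zE]; rewrite -[z](mulVKg y); apply: KM => //.
    have [c' pc' cE] := pP c pc; exists c' => //.
    apply/funext => u; apply: (can_inj FiK); rewrite /= FK.
    rewrite -[Defs.sgval (y^-1 * z)]/((Defs.sgval y)^-1 * Defs.sgval z) in zE *.
    by rewrite zE; have := congr1 (@^~ (F u)) cE; rewrite /= FK.
  - have xF : act (Defs.sgval x) \o F = F \o pw s a by rewrite -x0E in xE.
    have xV : act (Defs.sgval x^-1) \o F = F \o pw s' (fun j => b (s' j)).
      apply/funext => -[j u]; apply: (can_inj (actK hd (Defs.sgval x))).
      rewrite /= (actKV hd); have := congr1 (@^~ (pw s' (fun j => b (s' j)) (j, u))) xF.
      rewrite /= => ->; congr F; rewrite /pw /= s'K; congr (_, _).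
      by have /= := congr1 snd (bK (s' j, u)).
    apply/seteqP; split=> _ [y Ky <-].
      exists (x^-1 * y * x^-1^-1).
        by apply: (conj _ _ s' s) Ky; [exact: sK|exact: s'K| |exact: xV].
      by rewrite /lmul /rmul invgK !mulgA mulgV mul1g.
    exists (x * y * x^-1); last by rewrite /lmul /rmul mulgKV.
    by apply: (conj _ _ s s') Ky; [exact: s'K|exact: sK| |exact: xF].
(* With [B] empty no piece is tainted, and [generate] reaches every element. *)
have [J [F [fF _]]] := @large_frame d hd 'I_k I0pos 0.
have [x gx hx] : rinv (act (Defs.sgval g)).
  apply: (generate hd grinv (B := fun=> False) _ W fF (leq0n _) (hom_act hd _)) => //.
  by move=> i [].
by have -> : g = x by apply/val_inj; exact: (act_inj hd gx).
Qed.

End Group.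
End Full.

(** * Proper closed cocompact subgroups *)

Section Proper.
Variables (R : realType) (d k : nat) (hd : 1 < d) (hk : 1 < k).
Local Notation P := ('I_k * stream d)%type.
Local Notation N := (neretin d k).

Lemma end_stab_act (p : P) (g : N) : end_stab (en p) g <-> act g p = p.
Proof.
split=> [e|e]; last by rewrite /end_stab /= -actE e.
by apply: (en_inj hd); rewrite actE.
Qed.

Variable H : groupClosed N.
Hypotheses (cH : closed [set` H]) (ccH : cocompact H) (HT : [set` H] <> [set: N]).

Lemma proper_fixes_end : exists xi : tree_end d k,
  [/\ [set` H] `<=` end_stab xi, finite_index H (end_stab xi) & ~ unimodular R (subgroup H)].
Proof.
have I0pos : 0 < #|'I_k| by rewrite card_ord ltnW.
have [all|[xi [fixH [M [L [LP cover]]] [r [t [ti [w [ht hti [tK tiK] [Vt Vw nVw]]]]]]]]] :=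
    cocompact_dichotomy hd I0pos (sub_homs_group hd H) (sub_homs_closed hd cH)
      (sub_homs_cocompact hd ccH).
  case: HT; apply/seteqP; split=> // x _.
  by have [y yH /(act_inj hd) ->] := all _ (hom_act hd x).
exists (en xi); split.
- by move=> x xH; apply/end_stab_act; apply: fixH; exists x.
- have /choice[l lP] j : exists x : N, act x = L j by exact: (act_surj hd (LP j).1).
  apply: (@sub_finite_set _ _ [set (fun h => l j * h) @` [set` H] | j in [set: 'I_M]]).
    move=> _ [g /end_stab_act gx <-]; have [j [_ [h hH ->] ge]] := cover _ (hom_act hd g) gx.
    have gE : g = l j * h by apply: (act_inj hd); rewrite ge (actM hd) lP.
    exists j => //; rewrite gE; apply/seteqP; split=> _ [y yH <-].
      by exists (h^-1 * y); [apply: gpredM; rewrite ?gpredV|rewrite mulgA mulgK].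
    by exists (h * y); [exact: gpredM|rewrite mulgA].
  exact/finite_image/finite_finset.
- have ch := sub_level_chain hd cH; have [q [e qe]] := chain_reps ch.
  have fixE (x : subgroup H) : sub_level r x <-> level_fix (sub_homs H) r (act (Defs.sgval x)).
    split=> [[b pb xb]|[_ [b pb xb]]]; last by exists b.
    by split; [exists (Defs.sgval x) => //; exact: (valP x)|exists b].
  have [t0 t0H te] := ht; pose T : subgroup H := Subgroup t0H.
  have tiE : ti = act (Defs.sgval T^-1).
    by apply/funext => p; rewrite -[p in LHS](actKV hd t0) -te tK.
  have [[w0 w0H we] _] := Vw; pose W : subgroup H := Subgroup w0H.
  apply: (@not_unimodular R _ (@sub_level d k H) r T W (@sub_level d k H r) ch).
  + exact: cho.
  + by rewrite -(cs1 (@sub_level d k H)); exact: (compact_cs ch qe).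
  + exact: chV.
  + by [].
  + by apply/fixE; rewrite -we.
  + move=> v /fixE/Vt h; apply/fixE.
    by rewrite !(actM hd) -te -/(Defs.sgval T^-1) -tiE; exact: h.
  + move=> /fixE; rewrite !(actM hd) -tiE -te -we; exact: nVw.
Qed.

End Proper.

Theorem theorem4p9 (R : realType) (d k : nat) (hd : (2 <= d)%N) (hk : (2 <= k)%N) :
  (forall H : groupClosed (neretin d k),
      closed [set` H] -> cocompact H -> [set` H] <> [set: neretin d k] ->
      exists xi : tree_end d k,
        [set` H] `<=` end_stab xi /\ finite_index H (end_stab xi)) /\
  (forall H : groupClosed (neretin d k),
      (closed [set` H] /\ cocompact H /\ unimodular R (subgroup H)) <->
      [set` H] = [set: neretin d k]).
Proof.
split=> [H cH ccH HT|H].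
  by have [xi [? ? _]] := proper_fixes_end R hd hk cH ccH HT; exists xi.
split=> [[cH [ccH uH]]|HT].
  by apply: contrapT => /(proper_fixes_end R hd hk cH ccH)[xi [_ _]].
split; first by rewrite HT; exact: closedT.
split; last exact: full_unimodular.
suff e : [set: left_cosets H] = [set (\pi_({eq_quot left_coset_rel H}) 1%g)%qT].
  by rewrite /cocompact e; exact: compact_set1.
apply/seteqP; split=> // c _; rewrite /=.
rewrite -[c](generic_quotient.reprK (c : {eq_quot left_coset_rel H}%qT)).
have xH : left_coset_rel H (generic_quotient.repr (c : {eq_quot left_coset_rel H}%qT)) 1%g.
  set x := (X in left_coset_rel H X _).
  by have : [set` H] (x^-1 * 1)%g by rewrite HT.
by have /eqP := etrans (@eqquotE _ _ {eq_quot left_coset_rel H}%qT _ _) xH.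
Qed.
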